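(* Fix a prime $p$. There exists a parameter-free $\mathcal{L}_{\mathrm{ring}}$-formula $\phi_p(x)$ such that for every field $K$ with either $\mathrm{char}(K)=p$ or $\zeta_p\in K$ (a primitive $p$-th root of unity), the following are equivalent: (1) $\phi_p$ defines $v_K^p$ as such; (2) $v_K^p$ is $\emptyset$-definable as such; (3) $p\neq 2$ or the residue field $Kv_K^p$ is not Euclidean.
   Context: $\mathcal{L}_{\mathrm{ring}}=\{+,\times;0,1\}$. For a field $K$ and a prime $p$, $K(p)$ denotes the compositum (in a fixed algebraic closure) of all finite Galois extensions of $K$ of $p$-power degree. A valuation $v$ on $K$ (valuation ring $\mathcal{O}_v$, residue field $Kv$, value group $vK$) is $p$-henselian if it extends uniquely to $K(p)$. A valuation $v$ is finer than $w$ (and $w$ coarser than $v$) if $\mathcal{O}_v\subseteq\mathcal{O}_w$. The canonical $p$-henselian valuation $v_K^p$ is defined as follows: if there is a $p$-henselian valuation $v$ on $K$ with $Kv=Kv(p)$, then $v_K^p$ is the coarsest such valuation; otherwise $v_K^p$ is the finest $p$-henselian valuation on $K$ (these exist and are unique). A field $F$ is Euclidean if $[F(2):F]=2$. We say $v_K^p$ is $\emptyset$-definable as such if there is a parameter-free $\mathcal{L}_{\mathrm{ring}}$-formula $\phi(x)$ such that for every field $L$ elementarily equivalent to $K$ in $\mathcal{L}_{\mathrm{ring}}$, $\phi(L)=\mathcal{O}_{v_L^p}$; in that case one says $\phi$ defines $v_K^p$ as such. *)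

(* Defs.v *)
From HB Require Import structures.
From mathcomp Require Import all_boot all_order all_algebra all_field.
From mathcomp Require Import generic_quotient ring_quotient.
From mathcomp Require Import boolp classical_sets.

Set Implicit Arguments.
Unset Strict Implicit.
Unset Printing Implicit Defensive.

Import Order.TTheory GRing.Theory Num.Theory.
Local Open Scope ring_scope.

Section MaxQuotient.
Variables (R : comNzRingType) (I : idealr R).
Hypothesis Imax : forall x, x \notin I -> exists y, y * x - 1 \in I.

Definition max_quot of (forall x, x \notin I -> exists y, y * x - 1 \in I) :=
  {ideal_quot I}.

Local Notation Q := (max_quot Imax).

HB.instance Definition _ := GRing.ComNzRing.on Q.

Definition max_quot_pi : R -> Q := \pi_({ideal_quot I})%qT.

Fact max_quot_pi_zmod : zmod_morphism max_quot_pi.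
Proof. exact: (@pi_is_zmod_morphism _ _ _ {ideal_quot I}). Qed.

HB.instance Definition _ :=
  GRing.isZmodMorphism.Build R Q max_quot_pi max_quot_pi_zmod.

Fact max_quot_pi_monoid : monoid_morphism max_quot_pi.
Proof. exact: (@pi_is_monoid_morphism _ _ _ {ideal_quot I}). Qed.

HB.instance Definition _ :=
  GRing.isMonoidMorphism.Build R Q max_quot_pi max_quot_pi_monoid.

Lemma max_quot_pi_eq0 x : (max_quot_pi x == 0) = (x \in I).
Proof.
rewrite -(rmorph0 max_quot_pi) -[in RHS](subr0 x).
by rewrite Quotient.idealrBE.
Qed.

Lemma max_quot_pi_surj (q : Q) : exists x, max_quot_pi x = q.
Proof. by exists (repr (q : {ideal_quot I})); rewrite /max_quot_pi reprK. Qed.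

Fact max_quot_inv_ex (q : Q) :
  exists q' : Q, (q != 0 -> q' * q = 1) /\ (q = 0 -> q' = 0).
Proof.
have [->|q0] := eqVneq q 0; first by exists 0.
have [x xq] := max_quot_pi_surj q; move: q0.
rewrite -xq max_quot_pi_eq0 => xI.
have [y yP] := Imax xI; exists (max_quot_pi y); split=> [_|/eqP]; last first.
  by rewrite max_quot_pi_eq0 (negPf xI).
apply/eqP; rewrite -subr_eq0 -rmorphM -(rmorph1 max_quot_pi) -rmorphB.
by rewrite max_quot_pi_eq0.
Qed.

Definition max_quot_inv (q : Q) : Q := projT1 (cid (max_quot_inv_ex q)).

Fact max_quot_mulVf q : q != 0 -> max_quot_inv q * q = 1.
Proof. by rewrite /max_quot_inv; case: (cid _) => ? []. Qed.

Fact max_quot_invr0 : max_quot_inv 0 = 0.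
Proof. exact: (projT2 (cid (max_quot_inv_ex 0))).2. Qed.

HB.instance Definition _ :=
  GRing.ComNzRing_isField.Build Q max_quot_mulVf max_quot_invr0.

End MaxQuotient.

Section Subfield.
Variables (F : fieldType) (S : divringClosed F).

Definition subfield_of := {x : F | x \in S}.

HB.instance Definition _ := SubChoice.on subfield_of.
HB.instance Definition _ := [SubChoice_isSubComUnitRing of subfield_of by <:].
HB.instance Definition _ :=
  [SubComUnitRing_isSubIntegralDomain of subfield_of by <:].
HB.instance Definition _ :=
  [SubIntegralDomain_isSubField of subfield_of by <:].

End Subfield.

Record algClosure (K : fieldType) := AlgClosure {
  closure_field :> closedFieldType;
  closure_emb : {rmorphism K -> closure_field};
  closure_alg : forall x : closure_field, algebraicOver closure_emb x
}.

Section Splitting.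

Lemma irreducible_divisor (F : fieldType) (p : {poly F}) :
  (1 < size p)%N -> exists2 r, r %| p & irreducible_poly r.
Proof.
elim: {p}_.+1 {-2}p (ltnSn (size p)) => // n IHn p lep p_gt1.
have [irr|irrN] := pselect (irreducible_poly p); first by exists p.
have [q /not_implyP[q1 /not_implyP[qp /negP qNp]]] :
    exists q : {poly F}, ~ (size q != 1%N -> q %| p -> q %= p).
  by apply/existsNP => irr; apply: irrN; split.
have p0 : p != 0 by rewrite -size_poly_gt0 ltnW.
have q0 : q != 0 := dvdpN0 qp p0.
have qltp : (size q < size p)%N.
  by rewrite ltn_neqAle dvdp_size_eqp // qNp dvdp_leq.
have [|| r rq irr] := IHn q; first exact: leq_trans qltp _.
  by rewrite ltn_neqAle eq_sym q1 size_poly_gt0.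
by exists r => //; apply: dvdp_trans rq qp.
Qed.

Lemma splitting_extension n (F : fieldType) (p : {poly F}) :
  (size p <= n)%N -> p != 0 ->
  exists (L : fieldType) (i : {rmorphism F -> L}) (zs : seq L),
    map_poly i p %= \prod_(z <- zs) ('X - z%:P).
Proof.
elim: n F p => [|n IHn] F p lep p0.
  by move: p0; rewrite -size_poly_eq0 -leqn0 lep.
have [p_le1|p_gt1] := leqP (size p) 1.
  exists F, idfun, [::]; rewrite big_nil map_poly_id // -size_poly_eq1.
  by rewrite eqn_leq p_le1 size_poly_gt0.
have [r rp irr] := irreducible_divisor p_gt1.
have [L0 _ [x rx _]] := irredp_FAdjoin irr.
pose i0 : {rmorphism F -> L0} := in_alg L0.
have /factor_theorem[q Dp] : root (map_poly i0 p) x.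
  by rewrite -(divpK rp) rmorphM rootM rx orbT.
have q0 : q != 0.
  by apply: contra_neq p0 => q0; apply/eqP; rewrite -(map_poly_eq0 i0) Dp q0 mul0r.
have qn : (size q <= n)%N.
  by move: lep; rewrite -(size_map_poly i0) Dp size_Mmonic ?monicXsubC //
     size_XsubC addn2.
have [L [i [zs qzs]]] := IHn L0 q qn q0.
exists L, (i \o i0), (i x :: zs).
rewrite big_cons map_poly_comp Dp rmorphM mulrC /= map_polyXsubC.
by rewrite eqp_mul2l ?polyXsubC_eq0.
Qed.

End Splitting.

Section MaximalIdeals.
Variable (R : comNzRingType).
Local Open Scope classical_set_scope.

Let ideal (J : set R) :=
  [/\ J 0, ~ J 1 & forall a u v, J u -> J v -> J (a * u + v)].

Lemma proper_ideal_killed (J0 : set R) :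
    [/\ J0 0, ~ J0 1 & forall a u v, J0 u -> J0 v -> J0 (a * u + v)] ->
  exists (E : fieldType) (f : {rmorphism R -> E}), forall x, J0 x -> f x = 0.
Proof.
move=> idJ0; pose P (J : set R) := J = set0 \/ (ideal J /\ J0 `<=` J).
have [F FP totF|J [PJ Jmax]] := @Zorn_bigcup R P.
  have [[X FX [idX J0X]]|nX] :=
    pselect (exists2 X, F X & ideal X /\ J0 `<=` X); last first.
    left; rewrite -subset0 => x [X FX Xx].
    have [X0|idX] := FP _ FX; first by rewrite X0 in Xx.
    by apply: nX; exists X.
  right; have idF Y y : F Y -> Y y -> ideal Y.
    by move=> FY Yy; have [Y0|[]] := FP _ FY => //; rewrite Y0 in Yy.
  split; last by move=> x /J0X Xx; exists X.
  split; first by exists X => //; case: idX.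
    by case=> Y FY Y1; have [_ /(_ Y1)] := idF _ _ FY Y1.
  move=> a u v [Y FY Yu] [Z FZ Zv].
  have [YZ|ZY] := totF _ _ FY FZ.
    exists Z => //; have [_ _ h] := idF _ _ FZ Zv.
    by apply: h => //; apply: YZ.
  exists Y => //; have [_ _ h] := idF _ _ FY Yu.
  by apply: h => //; apply: ZY.
have [idJ J0J] : ideal J /\ J0 `<=` J.
  case: PJ => // J_0; exfalso; apply: (Jmax J0); last by right; split.
  by rewrite J_0; split=> // /(_ 0) h; apply: h; case: idJ0.
have [J_0 J_1 J_D] := idJ.
pose I : {pred R} := fun x => `[< J x >].
have II : idealr_closed I.
  split; [exact/asboolP|exact/asboolPn|].
  by move=> a u v /asboolP Ju /asboolP Jv; apply/asboolP/J_D.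
pose Ii := isIdealr.Build R I II.
pose idI : idealr R := HB.pack I Ii.
have Imax x : x \notin idI -> exists y, y * x - 1 \in idI.
  move=> /asboolPn Jx.
  pose J' : set R := [set z | exists a, J (z - a * x)].
  apply: contrapT => /forallNP nJ'.
  apply: (Jmax J'); first split.
  - move=> z Jz; exists 0; by rewrite mul0r subr0.
  - move=> /(_ x) h; apply: Jx; apply: h; exists 1.
    by rewrite mul1r subrr.
  right; split; last by move=> z /J0J Jz; exists 0; rewrite mul0r subr0.
  split; first by exists 0; rewrite mul0r subrr.
    case=> a Ja; apply: (nJ' a); apply/asboolP.
    by rewrite -opprB -mulN1r -[X in J X]addr0; apply: J_D.
  move=> a u v [b Jb] [c Jc]; exists (a * b + c).
  suff -> : a * u + v - (a * b + c) * x = a * (u - b * x) + (v - c * x).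
    exact: J_D.
  by rewrite mulrBr mulrDl opprD mulrA addrACA.
exists (max_quot Imax), (@max_quot_pi R idI Imax) => x Jx.
by apply/eqP; rewrite max_quot_pi_eq0; apply/asboolP/J0J.
Qed.

End MaximalIdeals.

Section ProductRing.
Variables (T : Type) (L : T -> fieldType) (t0 : T).

Definition prod_ring of T := forall t, L t.
Local Notation P := (prod_ring t0).

HB.instance Definition _ := Choice.on P.

Let add (f g : P) : P := fun t => f t + g t.
Let opp (f : P) : P := fun t => - f t.
Let mul (f g : P) : P := fun t => f t * g t.
Let zero : P := fun t => 0.
Let one : P := fun t => 1.

Let funE (f g : P) : (forall t, f t = g t) -> f = g.
Proof. exact: functional_extensionality_dep. Qed.

Fact prod_ring_addA : associative add.
Proof. by move=> f g h; apply: funE => t; apply: addrA. Qed.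
Fact prod_ring_addC : commutative add.
Proof. by move=> f g; apply: funE => t; apply: addrC. Qed.
Fact prod_ring_add0 : left_id zero add.
Proof. by move=> f; apply: funE => t; apply: add0r. Qed.
Fact prod_ring_addN : left_inverse zero opp add.
Proof. by move=> f; apply: funE => t; apply: addNr. Qed.
Fact prod_ring_mulA : associative mul.
Proof. by move=> f g h; apply: funE => t; apply: mulrA. Qed.
Fact prod_ring_mulC : commutative mul.
Proof. by move=> f g; apply: funE => t; apply: mulrC. Qed.
Fact prod_ring_mul1 : left_id one mul.
Proof. by move=> f; apply: funE => t; apply: mul1r. Qed.
Fact prod_ring_mulD : left_distributive mul add.
Proof. by move=> f g h; apply: funE => t; apply: mulrDl. Qed.
Fact prod_ring_1neq0 : one != zero.
Proof.
by apply/eqP => /(congr1 (@^~ t0)) /eqP; rewrite /one /zero oner_eq0.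
Qed.

HB.instance Definition _ := GRing.isZmodule.Build P
  prod_ring_addA prod_ring_addC prod_ring_add0 prod_ring_addN.
HB.instance Definition _ := GRing.Zmodule_isComNzRing.Build P
  prod_ring_mulA prod_ring_mulC prod_ring_mul1 prod_ring_mulD prod_ring_1neq0.

Definition prod_ev (t : T) (f : P) : L t := f t.

HB.instance Definition _ t := GRing.isZmodMorphism.Build P (L t) (@prod_ev t)
  (fun f g => erefl).
HB.instance Definition _ t := GRing.isMonoidMorphism.Build P (L t) (@prod_ev t)
  (conj erefl (fun f g => erefl)).

Variables (K : fieldType) (i : forall t, {rmorphism K -> L t}).

Definition prod_diag (a : K) : P := fun t => i t a.

Fact prod_diag_zmod : zmod_morphism prod_diag.
Proof. by move=> a b; apply: funE => t; apply: (rmorphB (i t)). Qed.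
Fact prod_diag_monoid : monoid_morphism prod_diag.
Proof.
split=> [|a b]; apply: funE => t; first exact: (rmorph1 (i t)).
exact: (rmorphM (i t)).
Qed.

HB.instance Definition _ := GRing.isZmodMorphism.Build K P prod_diag
  prod_diag_zmod.
HB.instance Definition _ := GRing.isMonoidMorphism.Build K P prod_diag
  prod_diag_monoid.

End ProductRing.

Section ExistsClosure.
Variable K : fieldType.

(* Every finite set s of polynomials splits in some extension L s of K; in a  *)
(* quotient field of the product of the L s that kills the elements vanishing *)
(* at all large s, every polynomial over K splits. The algebraic closure of K *)
(* is the subfield of the elements algebraic over K.                          *)

Lemma splitting_seq (s : seq {poly K}) :
  exists (L : fieldType) (i : {rmorphism K -> L}),
  forall f, f \in s -> f \is monic ->
    exists zs : seq L, map_poly i f = \prod_(z <- zs) ('X - z%:P).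
Proof.
pose p := \prod_(f <- s | f != 0) f.
have p0 : p != 0 by rewrite prodf_seq_neq0; apply/allP => f _; apply/implyP.
have [L [i [zs pzs]]] := splitting_extension (leqnn _) p0.
exists L, i => f fs fmon.
have : map_poly i f %| \prod_(z <- zs) ('X - z%:P).
  rewrite -(eqp_dvdr _ pzs) dvdp_map /p (big_rem f) //= monic_neq0 //.
  exact: dvdp_mulIl.
case/dvdp_prod_XsubC => m; rewrite eqp_monic ?monic_map ?monic_prod_XsubC //.
by move/eqP=> ->; exists (mask m zs).
Qed.

Lemma splitting_all : exists (E : fieldType) (phi : {rmorphism K -> E}),
  forall f : {poly K}, f \is monic ->
    exists zs : seq E, map_poly phi f = \prod_(z <- zs) ('X - z%:P).
Proof.
pose L s : fieldType := projT1 (cid (splitting_seq s)).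
pose i s : {rmorphism K -> L s} := projT1 (cid (projT2 (cid (splitting_seq s)))).
have iP s (f : {poly K}) : f \in s -> f \is monic ->
    exists zs : seq (L s), map_poly (i s) f = \prod_(z <- zs) ('X - z%:P).
  exact: (projT2 (cid (projT2 (cid (splitting_seq s))))).
pose R := @prod_ring _ L [::].
pose J0 (g : R) := exists s0 : seq {poly K}, forall s : seq {poly K}, {subset s0 <= s} -> g s = 0.
have [|E [pi piP]] := @proper_ideal_killed R J0.
  split; first by exists [::].
    case=> s0 /(_ s0 (fun _ => id)) /eqP; apply/negP; exact: oner_neq0.
  move=> a u v [su suP] [sv svP]; exists (su ++ sv) => s sP.
  suff [us vs] : u s = 0 /\ v s = 0.
    by change (a s * u s + v s = 0); rewrite us vs mulr0 addr0.
  by split; [apply: suP|apply: svP] => x xs; apply: sP; rewrite mem_cat xs ?orbT.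
pose c : {rmorphism K -> R} := prod_diag [::] i.
exists E, (pi \o c) => f fmon.
have zs_ex s : exists zs : seq (L s), f \in s ->
    map_poly (i s) f = \prod_(z <- zs) ('X - z%:P).
  have [fs|] := boolP (f \in s); last by exists [::].
  by have [zs] := iP s f fs fmon; exists zs.
pose zs s := projT1 (cid (zs_ex s)).
have zsP s : f \in s -> map_poly (i s) f = \prod_(z <- zs s) ('X - z%:P).
  exact: (projT2 (cid (zs_ex s))).
pose n := (size f).-1.
pose r (k : nat) : R := fun s => (zs s)`_k.
pose g := map_poly c f - \prod_(k < n) ('X - (r k)%:P).
have g0 : map_poly pi g = 0.
  apply/polyP => m; rewrite coef_map coef0; apply: piP; exists [:: f] => s fs.
  have {}fs : f \in s by apply: fs; rewrite inE.
  change (prod_ev s g`_m = 0); rewrite -coef_map /g rmorphB rmorph_prod /=.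
  rewrite -map_poly_comp.
  have -> : map_poly (prod_ev s \o c) f = map_poly (i s) f by [].
  have zs_size : size (zs s) = n.
    have := congr1 (fun q : {poly _} => (size q).-1) (zsP s fs).
    by rewrite size_map_poly size_prod_XsubC.
  rewrite zsP // (big_nth 0) zs_size big_mkord.
  have -> : \prod_(k < n) map_poly (prod_ev s) ('X - (r k)%:P) =
            \prod_(k < n) ('X - ((zs s)`_k)%:P).
    by apply: eq_bigr => k _; rewrite map_polyXsubC.
  by rewrite subrr coef0.
exists [seq pi (r k) | k : 'I_n].
move/eqP: g0; rewrite rmorphB subr_eq0 /= -map_poly_comp => /eqP ->.
rewrite rmorph_prod big_image /=.
by apply: eq_bigr => k _; rewrite map_polyXsubC.
Qed.

Lemma algClosure_exists : exists C : algClosure K, True.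
Proof.
have [E [phi phiP]] := splitting_all.
pose A : {pred E} := fun x => `[< algebraicOver phi x >].
have A_closed : divring_closed A.
  split; first exact/asboolP/algebraic1.
    by move=> x y /asboolP xA /asboolP yA; apply/asboolP/algebraic_sub.
  by move=> x y /asboolP xA /asboolP yA; apply/asboolP/algebraic_div.
pose Ai := GRing.isDivringClosed.Build E A A_closed.
pose dA : divringClosed E := HB.pack A Ai.
pose C := subfield_of dA.
have C_closed : GRing.closed_field_axiom C.
  move=> n P n_gt0.
  pose p : {poly C} := 'X^n - \poly_(i < n) P i.
  have sp : (size (\poly_(i < n) P i) < size ('X^n : {poly C}))%N.
    by rewrite size_polyXn ltnS size_poly.
  have p_mon : p \is monic.
    by rewrite monicE lead_coefDl ?size_polyN // lead_coefXn.
  suff [x /rootP px] : exists x, root p x.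
    exists x; apply/eqP; rewrite -subr_eq0 -[_ - _]/(_ - _).
    move: px; rewrite /p hornerD hornerN hornerXn horner_poly => /eqP.
    by [].
  pose q : {poly E} := map_poly val p.
  have q0 : q != 0 by rewrite map_poly_eq0 monic_neq0.
  have [L [j [zs qzs]]] := splitting_extension (leqnn _) q0.
  have [y qy] : exists y, root (map_poly j q) y.
    case: zs qzs => [|y zs] qzs.
      have /eqp_size := qzs; rewrite big_nil size_poly1 !size_map_poly.
      by rewrite /p size_polyDl ?size_polyN // size_polyXn => -[n0]; rewrite n0 in n_gt0.
    by exists y; rewrite (eqp_root qzs) big_cons rootM root_XsubC eqxx.
  have y_int : integralOver (j \o phi) y.
    apply: (integral_root_monic _ qy); first by rewrite !monic_map.
    apply/integral_poly => k; rewrite !coef_map /=; apply: integral_rmorph.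
    by apply/integral_algebraic/asboolP; exact: (valP p`_k).
  have [f fmon] := y_int; rewrite map_poly_comp.
  have [rs frs] := phiP f fmon; rewrite frs rmorph_prod.
  have -> : \prod_(z <- rs) map_poly j ('X - z%:P) =
            \prod_(z <- map j rs) ('X - z%:P).
    by rewrite big_map; apply: eq_bigr => z _; rewrite map_polyXsubC.
  rewrite root_prod_XsubC => /mapP[z zrs yz].
  have zA : z \in dA.
    apply/asboolP; exists f; first exact: monic_neq0.
    by rewrite frs root_prod_XsubC.
  exists (Sub z zA); rewrite -(fmorph_root (val : {rmorphism C -> E})) /=.
  by move: qy; rewrite yz fmorph_root.
have phiA a : phi a \in dA by apply/asboolP/algebraic_id.
pose iota a : C := Sub (phi a) (phiA a).
have iota_zmod : zmod_morphism iota.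
  by move=> a b; apply: val_inj; rewrite /= rmorphB.
have iota_monoid : monoid_morphism iota.
  by split=> [|a b]; apply: val_inj; rewrite /= ?rmorph1 ?rmorphM.
pose Ccl := Field_isAlgClosed.Build C C_closed.
pose Cc : closedFieldType := HB.pack C Ccl.
pose iotaZ := GRing.isZmodMorphism.Build K Cc iota iota_zmod.
pose iotaM := GRing.isMonoidMorphism.Build K Cc iota iota_monoid.
pose iotaR : {rmorphism K -> Cc} := HB.pack iota iotaZ iotaM.
have iota_alg : forall x : Cc, algebraicOver iotaR x.
  move=> x; have /asboolP[f f0 fx] := valP (x : C); exists f => //.
  pose valR : {rmorphism C -> E} := val.
  have e : map_poly phi f = map_poly valR (map_poly iotaR f : {poly C}).
    by apply/polyP => k; rewrite (coef_map phi) (coef_map valR) (coef_map iotaR).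
  by move: fx; rewrite e (fmorph_root valR).
by exists (AlgClosure iota_alg).
Qed.

End ExistsClosure.

Definition alg_closure (K : fieldType) : algClosure K :=
  projT1 (cid (algClosure_exists K)).

Section PExtension.
Variables (p : nat) (K : fieldType).
Local Notation C := (alg_closure K).
Local Notation iota := (closure_emb C).

(* Membership in K(p): the finite Galois extensions of K inside C are the     *)
(* images of the K-embeddings j : L -> C of abstract finite Galois extensions *)
(* L of K; their compositum is the smallest subfield containing these images. *)
Definition in_p_extension (x : C) : Prop :=
  forall F : {pred C}, divring_closed F ->
    (forall (L : splittingFieldType K) (j : {rmorphism L -> C}) (n : nat),
       (forall a : K, j a%:A = iota a) ->
       galois 1 {:L} -> \dim {:L} = (p ^ n)%N ->
       forall y : L, j y \in F) ->
    x \in F.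

Definition p_extension_pred : {pred C} := fun x => `[< in_p_extension x >].

Fact p_extension_divring_closed : divring_closed p_extension_pred.
Proof.
split; first by apply/asboolP => F [].
- move=> x y /asboolP xP /asboolP yP; apply/asboolP => F FF FL.
  by case: (FF) => _ FB _; apply: FB; [apply: xP|apply: yP].
- move=> x y /asboolP xP /asboolP yP; apply/asboolP => F FF FL.
  by case: (FF) => _ _ FV; apply: FV; [apply: xP|apply: yP].
Qed.

HB.instance Definition _ :=
  GRing.isDivringClosed.Build C p_extension_pred p_extension_divring_closed.

Definition p_extension : fieldType := subfield_of p_extension_pred.

Fact p_extension_emb_subproof a : iota a \in p_extension_pred.
Proof.
apply/asboolP => F _ /(_ K^o iota 0) FL; apply: (FL _ _ _ (a : K^o)).
- by move=> b; rewrite /GRing.scale /= mulr1.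
- rewrite regular_fullv /galois subvv separable_refl /=.
  apply/normalFieldP => b b1; exists [:: b]; first by rewrite /= b1.
  by rewrite big_seq1; apply/minPoly_XsubC.
- by rewrite dimvf.
Qed.

Definition p_extension_emb (a : K) : p_extension :=
  Sub (iota a) (p_extension_emb_subproof a).

Fact p_extension_emb_zmod : zmod_morphism p_extension_emb.
Proof. by move=> a b; apply: val_inj; rewrite /= rmorphB. Qed.
Fact p_extension_emb_monoid : monoid_morphism p_extension_emb.
Proof. by split=> [|a b]; apply: val_inj; rewrite /= ?rmorph1 ?rmorphM. Qed.

HB.instance Definition _ :=
  GRing.isZmodMorphism.Build K p_extension p_extension_emb p_extension_emb_zmod.
HB.instance Definition _ :=
  GRing.isMonoidMorphism.Build K p_extension p_extension_emb
    p_extension_emb_monoid.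

(* K = K(p): the embedding of K in K(p) is onto. *)
Definition p_closed : Prop :=
  forall y : p_extension, exists a : K, p_extension_emb a = y.

End PExtension.

(* [L : K] = n, the vector space structure of L over K being given by i. *)
Definition extension_degree (K L : fieldType) (i : {rmorphism K -> L})
    (n : nat) : Prop :=
  exists b : 'I_n -> L,
    forall y : L, exists! c : 'rV[K]_n, y = \sum_(k < n) i (c 0 k) * b k.

Definition euclidean (F : fieldType) : Prop :=
  extension_degree (@p_extension_emb 2 F) 2.

(* Krull valuations, written additively. The value at 0, which should be      *)
(* infinity, is replaced with an irrelevant element of the value group:       *)
(* nothing below depends on it.                                               *)
Record valuation (K : fieldType) := Valuation {
  value_group : porderZmodType;
  value :> K -> value_group;
  value_group_total : total (<=%R : rel value_group);
  value_group_leD : forall a b c : value_group, b <= c -> a + b <= a + c;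
  value_surj : forall a, exists2 x, x != 0 & value x = a;
  valueM : forall x y, x != 0 -> y != 0 -> value (x * y) = value x + value y;
  valueD : forall x y, x != 0 -> y != 0 -> x + y != 0 ->
    Num.min (value x) (value y) <= value (x + y)
}.

Section ValuationRing.
Variables (K : fieldType) (v : valuation K).

Definition valuation_ring : {pred K} := fun x => (x == 0) || (0 <= v x).

Definition valuation_max_ideal : {pred K} := fun x => (x == 0) || (0 < v x).

Lemma mem_valuation_ring x :
  (x \in valuation_ring) = (x == 0) || (0 <= v x).
Proof. by []. Qed.

Lemma mem_valuation_max_ideal x :
  (x \in valuation_max_ideal) = (x == 0) || (0 < v x).
Proof. by []. Qed.

Lemma value1 : v 1 = 0.
Proof.
have := valueM v (oner_neq0 K) (oner_neq0 K).
by rewrite mulr1 -[LHS]addr0 => /addrI.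
Qed.

Lemma valueN x : x != 0 -> v (- x) = v x.
Proof.
move=> x0; have N1 : -1 != 0 :> K by rewrite oppr_eq0 oner_neq0.
suff vN1 : v (-1) = 0 by rewrite -mulN1r valueM // vN1 add0r.
have vv : v (-1) + v (-1) = 0 by rewrite -valueM // mulrNN mulr1 value1.
apply: le_anti; apply/andP.
have [le|le] := orP (value_group_total (v (-1)) 0).
  by split=> //; rewrite -vv -[leRHS]addr0; apply: value_group_leD.
by split=> //; rewrite -vv -[leLHS]addr0; apply: value_group_leD.
Qed.

Lemma valueV x : x != 0 -> v x^-1 = - v x.
Proof.
move=> x0; apply/eqP; rewrite -addr_eq0 -valueM ?invr_eq0 //.
by rewrite mulVf // value1.
Qed.

Let leD (a b : value_group v) : 0 <= a -> 0 <= b -> 0 <= a + b.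
Proof.
move=> a0 b0; apply: le_trans a0 _.
by rewrite -[leLHS]addr0; apply: value_group_leD.
Qed.

Let ltD (a b : value_group v) : 0 <= a -> 0 < b -> 0 < a + b.
Proof.
move=> a0 b0; rewrite lt_neqAle leD ?(ltW b0) // andbT eq_sym.
apply: contraTneq b0 => ab0; suff b_le0 : b <= 0 by rewrite le_gtF.
rewrite -ab0 -[leLHS]add0r addrC [a + b]addrC; exact: value_group_leD.
Qed.

Let min_split (a b c : value_group v) :
  Num.min a b <= c -> (a <= c) \/ (b <= c).
Proof. by rewrite minEle; case: ifP; [left|right]. Qed.

Fact valuation_ring_subring_closed : subring_closed valuation_ring.
Proof.
split; first by rewrite mem_valuation_ring value1 lexx orbT.
- move=> x y; have [->|x0] := eqVneq x 0.
    rewrite sub0r !mem_valuation_ring oppr_eq0 => _.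
    by case: eqP => //= /eqP y0; rewrite valueN.
  have [->|y0] := eqVneq y 0; first by rewrite subr0.
  rewrite !mem_valuation_ring (negPf x0) (negPf y0) /= => vx vy.
  have [//|xy0] := eqVneq (x - y) 0; rewrite /=.
  have Ny0 : - y != 0 by rewrite oppr_eq0.
  have := valueD v x0 Ny0 xy0; rewrite valueN // => /min_split[]; exact: le_trans.
- move=> x y; rewrite !mem_valuation_ring mulf_eq0.
  case: (eqVneq x 0) => //= x0; case: (eqVneq y 0) => //= y0.
  by rewrite valueM //; apply: leD.
Qed.

HB.instance Definition _ :=
  GRing.isSubringClosed.Build K valuation_ring valuation_ring_subring_closed.

Definition valuation_ring_type := {x : K | x \in valuation_ring}.

HB.instance Definition _ := SubChoice.on valuation_ring_type.
HB.instance Definition _ :=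
  [SubChoice_isSubComNzRing of valuation_ring_type by <:].

Definition valuation_ideal : {pred valuation_ring_type} :=
  fun x => val x \in valuation_max_ideal.

Lemma mem_valuation_ideal x :
  (x \in valuation_ideal) = (val x == 0) || (0 < v (val x)).
Proof. by []. Qed.

Fact valuation_ideal_closed : idealr_closed valuation_ideal.
Proof.
split; first by rewrite mem_valuation_ideal eqxx.
- rewrite mem_valuation_ideal rmorph1 oner_eq0.
  by rewrite value1 ltxx.
move=> a x y; rewrite !mem_valuation_ideal.
rewrite rmorphD rmorphM /=; set a' := \val a; set x' := \val x.
set y' := \val y => xm ym.
have axm : (a' * x' == 0) || (0 < v (a' * x')).
  have := valP a; rewrite mem_valuation_ring -/a' mulf_eq0.
  case: (eqVneq a' 0) => //= a0 va; case: (eqVneq x' 0) xm => //= x0 vx.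
  by rewrite valueM //; apply: ltD.
have [->|ax0] := eqVneq (a' * x') 0; first by rewrite add0r.
have [->|y0] := eqVneq y' 0; first by rewrite addr0.
rewrite (negPf ax0) /= in axm; rewrite (negPf y0) /= in ym.
have [//|xy0] := eqVneq (a' * x' + y') 0; rewrite /=.
by case/min_split: (valueD v ax0 y0 xy0); apply: lt_le_trans.
Qed.

HB.instance Definition _ :=
  isIdealr.Build valuation_ring_type valuation_ideal valuation_ideal_closed.

Fact valuation_ideal_max (x : valuation_ring_type) :
  x \notin valuation_ideal -> exists y, y * x - 1 \in valuation_ideal.
Proof.
rewrite mem_valuation_ideal negb_or.
case/andP=> x0 vx; have := valP x; rewrite mem_valuation_ring (negPf x0) /=.
rewrite le_eqVlt (negPf vx) orbF eq_sym => /eqP vx0.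
have xV : (val x)^-1 \in valuation_ring.
  by rewrite mem_valuation_ring valueV // vx0 oppr0 lexx orbT.
exists (Sub (val x)^-1 xV : valuation_ring_type); rewrite mem_valuation_ideal.
by rewrite rmorphB rmorphM rmorph1 /= mulVf // subrr eqxx.
Qed.

Definition residue_field : fieldType := max_quot valuation_ideal_max.

End ValuationRing.

Section TrivialValuation.

Definition trivial_group := unit.

HB.instance Definition _ := Choice.on trivial_group.

Let le (_ _ : trivial_group) := true.
Let lt (_ _ : trivial_group) := false.

Fact trivial_lt_def x y : lt x y = (y != x) && le x y.
Proof. by case: x y => -[]. Qed.
Fact trivial_le_anti : antisymmetric le. Proof. by do 2!case. Qed.

HB.instance Definition _ := Order.isPOrder.Build ring_display trivial_group
  trivial_lt_def (fun _ => isT) trivial_le_anti (fun _ _ _ _ _ => isT).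

Let add (_ _ : trivial_group) : trivial_group := tt.
Let opp (_ : trivial_group) : trivial_group := tt.

Fact trivial_addA : associative add. Proof. by []. Qed.
Fact trivial_addC : commutative add. Proof. by []. Qed.
Fact trivial_add0 : left_id (tt : trivial_group) add. Proof. by case. Qed.
Fact trivial_addN : left_inverse (tt : trivial_group) opp add.
Proof. by case. Qed.

HB.instance Definition _ := GRing.isZmodule.Build trivial_group
  trivial_addA trivial_addC trivial_add0 trivial_addN.

Variable K : fieldType.

Definition trivial_valuation : valuation K.
Proof.
refine (@Valuation K trivial_group (fun _ => tt) _ _ _ _ _) => //.
by case; exists 1; rewrite ?oner_neq0.
Defined.

End TrivialValuation.

Definition extends (K L : fieldType) (i : {rmorphism K -> L})
    (w : valuation L) (v : valuation K) : Prop :=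
  forall x : K, (i x \in valuation_ring w) = (x \in valuation_ring v).

(* Uniqueness of extensions is up to equivalence, i.e. equality of valuation  *)
(* rings.                                                                     *)
Definition p_henselian (p : nat) (K : fieldType) (v : valuation K) : Prop :=
  exists w : valuation (p_extension p K),
    extends (@p_extension_emb p K) w v /\
    forall w' : valuation (p_extension p K),
      extends (@p_extension_emb p K) w' v ->
      valuation_ring w' =i valuation_ring w.

Definition finer (K : fieldType) (v w : valuation K) : Prop :=
  {subset valuation_ring v <= valuation_ring w}.

Definition is_canonical (p : nat) (K : fieldType) (v : valuation K) : Prop :=
  let S (w : valuation K) := p_henselian p w /\ p_closed p (residue_field w) in
  ((exists w, S w) -> S v /\ forall w, S w -> finer w v) /\
  (~ (exists w, S w) ->
    p_henselian p v /\ forall w, p_henselian p w -> finer v w).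

(* v_K^p: it exists, and its valuation ring is unique, so that the default    *)
(* value and the choice of a representative are immaterial.                   *)
Definition canonical_valuation (p : nat) (K : fieldType) : valuation K :=
  if pselect (exists v : valuation K, is_canonical p v) is left ex_v
  then projT1 (cid ex_v) else trivial_valuation K.

(* The index n is the number of free variables; under a quantifier, variable  *)
(* 0 is the bound one and the others are shifted.                             *)
Inductive ring_term (n : nat) : Type :=
| tVar of 'I_n
| tZero
| tOne
| tAdd of ring_term n & ring_term n
| tMul of ring_term n & ring_term n.

Inductive ring_formula : nat -> Type :=
| fEqual n of ring_term n & ring_term n : ring_formula n
| fNot n of ring_formula n : ring_formula n
| fAnd n of ring_formula n & ring_formula n : ring_formula n
| fOr n of ring_formula n & ring_formula n : ring_formula n
| fImplies n of ring_formula n & ring_formula n : ring_formula n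
| fExists n of ring_formula n.+1 : ring_formula n
| fForall n of ring_formula n.+1 : ring_formula n.

Fixpoint eval (K : fieldType) (n : nat) (e : n.-tuple K) (t : ring_term n) : K :=
  match t with
  | tVar i => tnth e i
  | tZero => 0
  | tOne => 1
  | tAdd t u => eval e t + eval e u
  | tMul t u => eval e t * eval e u
  end.

Fixpoint holds (K : fieldType) (n : nat) (f : ring_formula n) :
    n.-tuple K -> Prop :=
  match f with
  | fEqual _ t u => fun e => eval e t = eval e u
  | fNot _ f => fun e => ~ holds f e
  | fAnd _ f g => fun e => holds f e /\ holds g e
  | fOr _ f g => fun e => holds f e \/ holds g e
  | fImplies _ f g => fun e => holds f e -> holds g e
  | fExists _ f => fun e => exists x : K, holds f [tuple of x :: e]
  | fForall _ f => fun e => forall x : K, holds f [tuple of x :: e]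
  end.

Definition elementarily_equivalent (K L : fieldType) : Prop :=
  forall s : ring_formula 0,
    holds s ([tuple] : 0.-tuple K) <-> holds s ([tuple] : 0.-tuple L).

Definition defines_as_such (p : nat) (K : fieldType) (phi : ring_formula 1) :
    Prop :=
  forall L : fieldType, elementarily_equivalent K L ->
    forall x : L,
      holds phi [tuple x] <-> x \in valuation_ring (canonical_valuation p L).

Definition definable_as_such (p : nat) (K : fieldType) : Prop :=
  exists phi : ring_formula 1, defines_as_such p K phi.

(* Main.v *)
(** Let z be a root of 1 + z + ... + z^(p-1) (so z = 1 in characteristic p), put
    [i] = 1 + ... + z^(i-1), f(y) = (y - [0]) ... (y - [p-1]), lambda = z - 1. Then
    1 + lambda^p f(y) = (1 + lambda y)^p, and f(y) = y^p - y if lambda = 0, so that the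
    extensions of degree p are the extensions by roots of f(y) = a in both cases. Let S = f(K).
    A valuation ring O with maximal ideal m is p-henselian iff m is contained in S; its residue
    field is then p-closed iff S also contains all x in O such that 1 + lambda^p x is a unit.

    Two incomparable p-henselian rings generate a ring with p-closed residue field. If there is
    a p-henselian ring with p-closed residue field, the coarsest one has an explicit definition
    (coarseN). Otherwise the p-henselian rings form a chain, and the canonical one, O, is the
    finest. For b in O \ S with 1 + lambda^p b a unit, the set xbase b is contained in O and
    generates a ring which is p-henselian, hence equal to O. On the residue field, either two
    rounds of sums of products exhaust everything, or xbase b is a neighbourhood of 0 for a field
    topology; as the residue field has no nontrivial p-henselian ring, the topology is archimedean, which
    forces p = 2 and a Euclidean residue field. So outside of this case three rounds give O,
    uniformly in b, and this carries over to elementarily equivalent fields.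

    If p = 2 and the residue field is Euclidean, a formula defining the valuation would define
    in an ultrapower a ring with non-archimedean Euclidean residue field; the finite elements
    of the latter give a strictly finer 2-henselian ring. This is absurd, since a canonical
    valuation whose residue field is not 2-closed is the finest one. *)

From HB Require Import structures.
Require Import Defs.
From mathcomp Require Import generic_quotient ring_quotient.
From mathcomp Require Import all_boot all_order all_fingroup all_algebra all_solvable all_field.
From mathcomp Require Import ring zify.
From mathcomp Require Import boolp.

Set Implicit Arguments.
Unset Strict Implicit.
Unset Printing Implicit Defensive.

Import Order.TTheory GRing.Theory Num.Theory.
Local Open Scope ring_scope.

(** * Kummer and Artin-Schreier equations *)

(** The coefficients of f lie in Z[z], so f reduces modulo every valuation ring: Kummer theory over
    K may become Artin-Schreier theory over a residue field of characteristic p, and most arguments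
    need not separate equal from mixed characteristic. The price is that the group law behind f is
    [tmul], for which the x with 1 + lambda^p x = 0 is not invertible; hence the recurring
    conditions that 1 + lambda^p x be nonzero or a unit. The other obstacle is uniformity: nothing
    is known about the residue field of a field elementarily equivalent to K. The conditions
    [has_coarse] and [has_finest] are therefore first-order and force the formula to be correct
    wherever one of them holds; the residue field is used only to establish them in K itself. The
    third round is spent on adding an element of m to a lift from the residue field, where two
    rounds suffice. *)

Section KummerArtinSchreier.
Variables (p : nat) (p_prime : prime p).

(* [n] and f(y) in the notation above; 1 + c (tmul c x y) = (1 + c x)(1 + c y). *)
Definition qnat (R : comNzRingType) (z : R) n := \sum_(i < n) z ^+ i.

Definition kas (R : comNzRingType) (z y : R) := \prod_(i < p) (y - qnat z i).

Definition tmul (R : comNzRingType) (c x y : R) := x + y + c * x * y.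

Lemma qnat_rmorph (R S : comNzRingType) (h : {rmorphism R -> S}) (z : R) n :
  h (qnat z n) = qnat (h z) n.
Proof. by rewrite rmorph_sum; apply: eq_bigr => i _; rewrite rmorphXn. Qed.

Lemma kas_rmorph (R S : comNzRingType) (h : {rmorphism R -> S}) (z y : R) :
  h (kas z y) = kas (h z) (h y).
Proof.
by rewrite rmorph_prod; apply: eq_bigr => i _; rewrite rmorphB qnat_rmorph.
Qed.

Lemma qnat0 (R : comNzRingType) (z : R) : qnat z 0 = 0.
Proof. by rewrite /qnat big_ord0. Qed.

Lemma qnat1 (R : comNzRingType) (z : R) : qnat z 1 = 1.
Proof. by rewrite /qnat big_ord1 expr0. Qed.

Lemma qnatE (R : comNzRingType) (z : R) n : (z - 1) * qnat z n = z ^+ n - 1.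
Proof. by rewrite subrX1. Qed.

Lemma qnatD (R : comNzRingType) (z : R) m n :
  qnat z (m + n) = qnat z m + z ^+ m * qnat z n.
Proof.
rewrite /qnat big_split_ord /=; congr (_ + _).
by rewrite mulr_sumr; apply: eq_bigr => i _; rewrite exprD.
Qed.

Lemma qnat_tmul (R : comNzRingType) (z : R) m n :
  qnat z (m + n) = tmul (z - 1) (qnat z m) (qnat z n).
Proof. by rewrite qnatD /tmul qnatE; ring. Qed.

Lemma qnatM (R : comNzRingType) (z : R) m n :
  qnat z (m * n) = qnat z m * qnat (z ^+ m) n.
Proof.
elim: n => [|n IHn]; first by rewrite muln0 !qnat0 mulr0.
by rewrite mulnS addnC qnatD IHn -(addn1 n) qnatD qnat1 exprM; ring.
Qed.

Lemma tmulA (R : comNzRingType) (c x y w : R) :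
  tmul c (tmul c x y) w = tmul c x (tmul c y w).
Proof. by rewrite /tmul; ring. Qed.

Lemma tmulC (R : comNzRingType) (c x y : R) : tmul c x y = tmul c y x.
Proof. by rewrite /tmul; ring. Qed.

Lemma tmul0 (R : comNzRingType) (c x : R) : tmul c x 0 = x.
Proof. by rewrite /tmul; ring. Qed.

Lemma tmulE (R : comNzRingType) (c x y : R) :
  1 + c * tmul c x y = (1 + c * x) * (1 + c * y).
Proof. by rewrite /tmul; ring. Qed.

Section Field.
Variables (K : fieldType) (z : K) (zP : qnat z p = 0).
Local Notation lam := (z - 1).
Local Notation fz := (kas z).
Local Notation qz := (qnat z).

Lemma zetaX : z ^+ p = 1.
Proof. by apply/eqP; rewrite -subr_eq0 -qnatE zP mulr0. Qed.

Lemma zeta_neq0 : z != 0.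
Proof.
apply: contraTneq (oner_neq0 K) => z0.
by rewrite -zetaX z0 expr0n; case: (p) p_prime => [|n] //= _; rewrite eqxx.
Qed.

Lemma lam0_char : lam = 0 -> p \in [pchar K].
Proof.
move/eqP; rewrite subr_eq0 => /eqP z1; rewrite inE p_prime /=.
rewrite -zP z1 /qnat.
by under eq_bigr do rewrite expr1n; rewrite sumr_const card_ord.
Qed.

Lemma zeta_prim : lam != 0 -> p.-primitive_root z.
Proof.
move=> lam0; have [m zm mp] := prim_order_exists (prime_gt0 p_prime) zetaX.
have /orP[/eqP m1|/eqP <- //] := (primeP p_prime).2 _ mp.
by move: lam0; rewrite -(expr1 z) -m1 prim_expr_order // subrr eqxx.
Qed.

(** For z = 1 one has [i] = i, and both sides are monic of degree p with the p elements of the prime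
    field as roots. *)
Lemma kasE0 y : lam = 0 -> fz y = y ^+ p - y.
Proof.
move=> lam0; have chp := lam0_char lam0.
have z1 : z = 1 by apply/eqP; rewrite -subr_eq0 lam0.
have qn i : qz i = i%:R.
  rewrite /qnat z1; under eq_bigr do rewrite expr1n.
  by rewrite sumr_const card_ord.
pose rs := [seq i%:R : K | i <- iota 0 p].
have p2 := prime_gt1 p_prime.
have sP : size ('X^p - 'X : {poly K}) = p.+1.
  by rewrite size_polyDl ?size_polyXn // size_polyN size_polyX ltnS.
have lP : lead_coef ('X^p - 'X : {poly K}) = 1.
  by rewrite lead_coefDl ?lead_coefXn // size_polyN size_polyX size_polyXn.
have: 'X^p - 'X = lead_coef ('X^p - 'X) *: \prod_(x <- rs) ('X - x%:P).
  apply: all_roots_prod_XsubC.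
  - by rewrite size_map size_iota.
  - apply/allP => _ /mapP[i _ ->]; rewrite /root hornerD hornerN hornerXn hornerX.
    by rewrite -(pFrobenius_autE chp) rmorph_nat subrr.
  - rewrite uniq_rootsE map_inj_in_uniq ?iota_uniq // => i j.
    rewrite !mem_iota /= !add0n => ip jp /eqP.
    wlog ij: i j ip jp / (i <= j)%N.
      by move=> H; case/orP: (leq_total i j) => h e; [|apply/esym]; apply: H; rewrite // eq_sym.
    rewrite eq_sym -subr_eq0 -natrB // -(dvdn_pcharf chp) => dv.
    apply/eqP; rewrite eqn_leq ij -subn_eq0 /=.
    rewrite -[_ == _]negbK -lt0n; apply/negP => /dvdn_leq /(_ dv).
    by rewrite leqNgt (leq_ltn_trans (leq_subr i j) jp).
rewrite lP scale1r => /(congr1 (fun q => q.[y])).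
rewrite hornerD hornerN hornerXn hornerX horner_prod big_map => ->.
have -> : iota 0 p = index_iota 0 p by rewrite /index_iota subn0.
rewrite big_mkord; apply: eq_bigr => i _.
by rewrite qn hornerXsubC.
Qed.

(** This is the factorization of X^p - 1 into the X - z^i, evaluated at X = 1 + lam y: each factor
    equals lam (y - [i]). *)
Lemma kasE y : 1 + lam ^+ p * fz y = (1 + lam * y) ^+ p.
Proof.
have [l0|l0] := eqVneq lam 0.
  by rewrite l0 expr0n; case: (p) p_prime => [|n] //= _; rewrite !mul0r addr0 expr1n.
have := factor_Xn_sub_1 (zeta_prim l0).
move=> /(congr1 (fun q => q.[1 + lam * y])).
rewrite big_mkord horner_prod hornerD hornerN hornerXn hornerC => h.
rewrite -[RHS](subrK 1) -h [RHS]addrC; congr (_ + _).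
rewrite -[p in lam ^+ p]card_ord -prodr_const -big_split /=; apply: eq_bigr => i _.
by rewrite hornerXsubC mulrBr qnatE; ring.
Qed.

Lemma kas_qnat i : (i < p)%N -> fz (qz i) = 0.
Proof. by move=> ip; rewrite /kas (bigD1 (Ordinal ip)) //= subrr mul0r. Qed.

Lemma kas0 : fz 0 = 0.
Proof. by have := kas_qnat (prime_gt0 p_prime); rewrite qnat0. Qed.

Lemma kas_eq0 y : fz y = 0 -> exists2 i, (i < p)%N & y = qz i.
Proof.
by move=> /eqP/prodf_eq0[i _ /eqP/subr0_eq yi]; exists i.
Qed.

(** Multiplicativity of p-th powers, transported by [kasE]; for lam = 0 it is additivity of the
    Frobenius. *)
Lemma kas_tmul x y : fz (tmul lam x y) = tmul (lam ^+ p) (fz x) (fz y).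
Proof.
have [l0|l0] := eqVneq lam 0.
  rewrite /tmul l0 expr0n; case: (p) p_prime (kasE0 ^~ l0) (lam0_char l0) => [|n] //= _ kE chp.
  by rewrite !mul0r !addr0 !kE -!(pFrobenius_autE chp) rmorphD /=; ring.
have lp : lam ^+ p != 0 by rewrite expf_neq0.
apply: (mulfI lp); apply: (addrI 1).
by rewrite kasE tmulE exprMn -!kasE -tmulE.
Qed.

Lemma qnatDp m k : qz (m + k * p) = qz m.
Proof. by rewrite qnatD mulnC qnatM zP mul0r mulr0 addr0. Qed.

Lemma qnat_mod m n : m = n %[mod p] -> qz m = qz n.
Proof.
move=> e; rewrite (divn_eq m p) (divn_eq n p) addnC [(n %/ p * p + _)%N]addnC.
by rewrite !qnatDp e.
Qed.

(** A cyclotomic unit: if i j = 1 mod p, then the product is [i j] = [1]. The inverse is again a sum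
    of powers of z, so [i] is a unit in every valuation ring. *)
Lemma qnat_inv i : (0 < i < p)%N -> exists j, qz i * qnat (z ^+ i) j = 1.
Proof.
case/andP=> i0 ip; have cp : coprime i p.
  by rewrite coprime_sym prime_coprime // gtnNdvd.
case: (egcdnP p i0) => km kn e _.
exists km; rewrite -qnatM -(qnat1 z); apply: qnat_mod.
by rewrite mulnC e (eqP cp) modnMDl.
Qed.

Lemma qnat_neq0 i : (0 < i < p)%N -> qz i != 0.
Proof.
move/qnat_inv=> [j e]; apply: contraTneq (oner_neq0 K) => q0.
by rewrite -e q0 mul0r eqxx.
Qed.

Definition tinv c x : K := - x / (1 + c * x).

Lemma tmulV c x : 1 + c * x != 0 -> tmul c x (tinv c x) = 0.
Proof. by move=> h; rewrite /tmul /tinv; field. Qed.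

Lemma tinvE c x : 1 + c * x != 0 -> 1 + c * tinv c x = (1 + c * x)^-1.
Proof. by move=> h; rewrite /tinv; field. Qed.

(** The fibres of the homomorphism f are the cosets of its kernel, which consists of the [i]. *)
Lemma kas_inj x y : 1 + lam * x != 0 -> fz x = fz y ->
  exists2 i, (i < p)%N & y = tmul lam x (qz i).
Proof.
move=> x0 e; have := kas_tmul (tinv lam x) y.
rewrite -e -kas_tmul (tmulC _ _ x) tmulV // kas0 => /kas_eq0[i ip h]; exists i => //.
by rewrite -h -tmulA tmulV // tmulC tmul0.
Qed.

Definition inS a := exists y, fz y = a.

Lemma inS0 : inS 0. Proof. by exists 0; rewrite kas0. Qed.

Lemma inS_tmul a b : inS a -> inS b -> inS (tmul (lam ^+ p) a b).
Proof. by move=> [x <-] [y <-]; exists (tmul lam x y); rewrite kas_tmul. Qed.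

Lemma inS_tinv a : inS a -> 1 + lam ^+ p * a != 0 -> inS (tinv (lam ^+ p) a).
Proof.
move=> [x <-] h; have x0 : 1 + lam * x != 0.
  by apply: contraNneq h => x0; rewrite kasE x0 expr0n; case: (p) p_prime.
exists (tinv lam x).
have : tmul (lam ^+ p) (fz x) (fz (tinv lam x)) = 0.
  by rewrite -kas_tmul tmulV // kas0.
move=> /(congr1 (tmul (lam ^+ p) (tinv (lam ^+ p) (fz x)))).
by rewrite -tmulA [tmul _ (tinv _ _) (fz x)]tmulC tmulV // tmulC !tmul0.
Qed.

(** The fraction is the quotient of b by a for the law [tmul (lam ^+ p)]. Approximations a = f(y) of
    b are turned into membership of b in S in this way. *)
Lemma inS_div a b : inS a -> 1 + lam ^+ p * a != 0 ->
  inS ((b - a) / (1 + lam ^+ p * a)) -> inS b.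
Proof.
move=> Sa a0 /(inS_tmul Sa); congr inS.
by rewrite /tmul; field.
Qed.

(** The element without inverse for [tmul (lam ^+ p)] is the value of f at -1/lam, where 1 + lam y
    vanishes. *)
Lemma inS_special : lam != 0 -> inS (- (lam ^+ p)^-1).
Proof.
move=> l0; have lp : lam ^+ p != 0 by rewrite expf_neq0.
exists (- lam^-1); apply: (mulfI lp); apply: (addrI 1).
rewrite kasE mulrN mulfV // subrr expr0n mulrN mulfV // subrr.
by case: (p) p_prime.
Qed.

Lemma notS_neq0 b : ~ inS b -> 1 + lam ^+ p * b != 0.
Proof.
move=> Sb; apply/eqP => h; apply: Sb.
have l0 : lam != 0.
  apply: contraTneq (oner_neq0 K) => l0; rewrite -h l0 expr0n.
  by case: (p) p_prime => //= n _; rewrite mul0r addr0 eqxx.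
have lp : lam ^+ p != 0 by rewrite expf_neq0.
suff -> : b = - (lam ^+ p)^-1 by exact: inS_special.
apply: (mulfI lp); apply: (addrI 1); rewrite h mulrN mulfV // subrr //.
Qed.

End Field.
End KummerArtinSchreier.

(** * Valuation rings *)

Record valring (K : fieldType) (O : K -> Prop) : Prop := Valring {
  vr1 : O 1;
  vrB : forall x y, O x -> O y -> O (x - y);
  vrM : forall x y, O x -> O y -> O (x * y);
  vrV : forall x, O x \/ O x^-1
}.

(* x^-1 is 0 at x = 0, hence the first alternative. *)
Definition mxi (K : fieldType) (O : K -> Prop) (x : K) := x = 0 \/ ~ O x^-1.

Section Valring.
Variables (K : fieldType) (O : K -> Prop) (vO : valring O).
Local Notation m := (mxi O).

Lemma vr0 : O 0. Proof. by rewrite -(subrr 1); apply: (vrB vO); apply: (vr1 vO). Qed.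
Lemma vrN x : O x -> O (- x).
Proof. by move=> Ox; rewrite -sub0r; apply: (vrB vO) => //; apply: vr0. Qed.
Lemma vrD x y : O x -> O y -> O (x + y).
Proof. by move=> Ox Oy; rewrite -[y]opprK; apply: (vrB vO) => //; apply: vrN. Qed.
Lemma vrX x n : O x -> O (x ^+ n).
Proof.
by move=> Ox; elim: n => [|n IH]; rewrite ?expr0 ?exprS; [apply: vr1|apply: (vrM vO)].
Qed.
Lemma vr_sum (I : Type) (r : seq I) (P : pred I) (F : I -> K) :
  (forall i, P i -> O (F i)) -> O (\sum_(i <- r | P i) F i).
Proof. by move=> OF; apply: big_ind => //; [apply: vr0|apply: vrD]. Qed.
Lemma vr_prod (I : Type) (r : seq I) (P : pred I) (F : I -> K) :
  (forall i, P i -> O (F i)) -> O (\prod_(i <- r | P i) F i).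
Proof. by move=> OF; apply: big_ind => //; [apply: vr1|apply: (vrM vO)]. Qed.
Lemma vr_nat n : O n%:R.
Proof. by elim: n => [|n IH]; [apply: vr0|rewrite -natr1; apply: vrD => //; apply: vr1]. Qed.

Lemma mx_sub x : m x -> O x.
Proof. by case=> [->|nO]; [apply: vr0|case: (vrV vO x)]. Qed.
Lemma mxM a x : O a -> m x -> m (a * x).
Proof.
move=> Oa [->|nO]; first by rewrite mulr0; left.
have [->|ax0] := eqVneq (a * x) 0; [by left|right=> h; apply: nO].
move: ax0; rewrite mulf_eq0 negb_or => /andP[a0 x0].
suff -> : x^-1 = a * (a * x)^-1 by apply: (vrM vO).
by field; rewrite a0 x0.
Qed.
Lemma mxMr a x : O a -> m x -> m (x * a).
Proof. by rewrite mulrC; apply: mxM. Qed.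
Lemma mxN x : m x -> m (- x).
Proof. by move=> mx; rewrite -mulN1r; apply: mxM => //; apply: vrN; apply: (vr1 vO). Qed.
Lemma mxD x y : m x -> m y -> m (x + y).
Proof.
have [->|x0] := eqVneq x 0; first by rewrite add0r.
have [->|y0] := eqVneq y 0; first by rewrite addr0.
move=> mx my; case: (vrV vO (x / y)) => h.
  have -> : x + y = (x / y + 1) * y by field.
  by apply: mxM => //; apply: vrD => //; apply: vr1.
have -> : x + y = (1 + (x / y)^-1) * x by field; rewrite x0 y0.
by apply: mxM => //; apply: vrD => //; apply: vr1.
Qed.
Lemma mxB x y : m x -> m y -> m (x - y).
Proof. by move=> mx my; apply: mxD => //; apply: mxN. Qed.
Lemma mx_sum (I : Type) (r : seq I) (P : pred I) (F : I -> K) :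
  (forall i, P i -> m (F i)) -> m (\sum_(i <- r | P i) F i).
Proof. by move=> OF; apply: big_ind => //; [left|apply: mxD]. Qed.
Lemma mx1 : ~ m 1.
Proof.
case=> [/eqP|h]; first by rewrite oner_eq0.
by apply: h; rewrite invr1; apply: (vr1 vO).
Qed.
Lemma mx_vr x : x != 0 -> m x -> ~ O x^-1.
Proof. by move=> x0 [x0'|//]; rewrite x0' eqxx in x0. Qed.
Lemma nvr_neq0 x : ~ O x -> x != 0.
Proof. by move=> nO; apply/eqP => x0; apply: nO; rewrite x0; apply: vr0. Qed.
Lemma nvr_mx x : ~ O x -> m x^-1.
Proof. by move=> nO; right; rewrite invrK. Qed.
Lemma nvr_vr x : ~ O x -> O x^-1.
Proof. by move=> /nvr_mx/mx_sub. Qed.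
Lemma nmx_vr x : ~ m x -> O x^-1.
Proof. by move=> nm; apply: contrapT => h; apply: nm; right. Qed.
Lemma nmx_neq0 x : ~ m x -> x != 0.
Proof. by move=> nm; apply/eqP => x0; apply: nm; left. Qed.
Lemma mx_unit x : O x^-1 -> x != 0 -> ~ m x.
Proof. by move=> Ox x0 /mx_vr; apply. Qed.
Lemma mxXn x n : (0 < n)%N -> m x -> m (x ^+ n).
Proof.
by case: n => // n _ mx; rewrite exprSr; apply: mxM => //; apply: vrX; apply: mx_sub.
Qed.
Lemma mx_1D x : m x -> 1 + x != 0 /\ O (1 + x)^-1.
Proof.
move=> mx; suff nm : ~ m (1 + x) by split; [apply: nmx_neq0|apply: nmx_vr].
by move=> /mxB/(_ mx); rewrite addrK; apply: mx1.
Qed.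
Lemma nmx_1D x : m x -> ~ m (1 + x).
Proof. by move=> mx; have [? ?] := mx_1D mx; apply: mx_unit. Qed.
Lemma nmxM x y : ~ m x -> ~ m y -> ~ m (x * y).
Proof.
move=> nx ny mxy; apply: ny.
have -> : y = x^-1 * (x * y) by rewrite mulKf // nmx_neq0.
by apply: mxM => //; apply: nmx_vr.
Qed.
Lemma nmx_nvr x : ~ O x -> ~ m x.
Proof. by move=> nO /mx_sub. Qed.
Lemma mx_prod (I : finType) (F : I -> K) (i : I) (P : pred I) : P i ->
  m (F i) -> (forall i, P i -> O (F i)) -> m (\prod_(i | P i) F i).
Proof.
by move=> Pi mi OF; rewrite (bigD1 i) //=; apply: mxMr => //; apply: vr_prod => j /andP[/OF].
Qed.
Lemma mx_prime (I : finType) (F : I -> K) :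
  m (\prod_i F i) -> exists i, m (F i).
Proof.
apply: contraPP => /forallNP h; elim/big_ind: _ => //; [exact: mx1|exact: nmxM].
Qed.
End Valring.

Lemma vr_mxS (K : fieldType) (O O' : K -> Prop) :
  (forall x, O x -> O' x) -> forall x, mxi O' x -> mxi O x.
Proof. by move=> OO' x [->|h]; [left|right=> /OO']. Qed.

Definition ring_of (K : fieldType) (v : valuation K) (x : K) : Prop :=
  x \in valuation_ring v.

Lemma ring_of_valring (K : fieldType) (v : valuation K) : valring (ring_of v).
Proof.
have [h1 hB hM] := valuation_ring_subring_closed v.
split=> //; rewrite /ring_of => x; rewrite !mem_valuation_ring.
have [->|x0] := eqVneq x 0; [by left|rewrite (negPf (invr_neq0 x0)) /= valueV //].
have [|le] := orP (value_group_total 0 (v x)); [by left|right].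
by have := value_group_leD (- v x) le; rewrite addr0 addNr.
Qed.

Lemma mxi_ring_of (K : fieldType) (v : valuation K) x :
  mxi (ring_of v) x <-> x \in valuation_max_ideal v.
Proof.
have vO := ring_of_valring v.
rewrite mem_valuation_max_ideal /mxi /ring_of mem_valuation_ring.
have [->|x0] := eqVneq x 0; first by split=> // _; left.
rewrite (negPf (invr_neq0 x0)) /= valueV //; split=> [[x0'|/negP h]|lt].
- by rewrite x0' eqxx in x0.
- rewrite lt_neqAle; apply/andP; split.
    by apply: contraNneq h => <-; rewrite oppr0.
  have [//|le] := orP (value_group_total 0 (v x)).
  by have := value_group_leD (- v x) le; rewrite addNr addr0 (negPf h).
- right=> le; have := value_group_leD (v x) le; rewrite addr0 subrr => le'.
  by have := lt_geF lt; rewrite le'.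
Qed.

(** * The valuation of a valuation ring: nonzero elements modulo units *)

Section ValuationOfRing.
Variables (K : fieldType) (O : K -> Prop) (vO : valring O).

Definition nz := {x : K | x != 0}.
HB.instance Definition _ := Choice.on nz.

Definition assoc (x y : nz) : bool :=
  `[< O (val x / val y) /\ O (val y / val x) >].

Let nzP (x : nz) : val x != 0 := valP x.

Fact assoc_equiv : equiv_class_of assoc.
Proof.
split=> [x|x y|y x w].
- by apply/asboolP; rewrite divff // ?nzP //; split; apply: (vr1 vO).
- by apply/asboolP/asboolP => [][].
- move=> /asboolP[xy yx] /asboolP[yw wy]; apply/asboolP; split.
    have -> : val x / val w = (val x / val y) * (val y / val w).
      by field; rewrite !nzP.
    exact: (vrM vO).
  have -> : val w / val x = (val w / val y) * (val y / val x).
    by field; rewrite !nzP.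
  exact: (vrM vO).
Qed.

Definition assoc_rel := EquivRelPack assoc_equiv.
Definition vgroup of valring O := {eq_quot assoc_rel}%qT.
Local Notation G := (vgroup vO).
HB.instance Definition _ := Choice.on G.

Definition vpi (x : nz) : G := \pi_({eq_quot assoc_rel})%qT x.
Definition vrepr (a : G) : nz := generic_quotient.repr (a : {eq_quot assoc_rel}%qT).

Lemma vreprK a : vpi (vrepr a) = a. Proof. exact: reprK. Qed.

Lemma vpi_eq x y : vpi x = vpi y <-> O (val x / val y) /\ O (val y / val x).
Proof.
split=> [/eqmodP/asboolP //|h]; apply/eqmodP; exact/asboolP.
Qed.

Definition nzM (x y : nz) : nz := exist _ (val x * val y) (mulf_neq0 (nzP x) (nzP y)).
Definition nz1 : nz := exist _ 1 (oner_neq0 K).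
Definition nzV (x : nz) : nz := exist _ (val x)^-1 (invr_neq0 (nzP x)).

Definition vadd (a b : G) : G := vpi (nzM (vrepr a) (vrepr b)).
Definition vopp (a : G) : G := vpi (nzV (vrepr a)).
Definition vzero : G := vpi nz1.
Definition vle (a b : G) : bool := `[< O (val (vrepr b) / val (vrepr a)) >].
Definition vlt (a b : G) : bool := (b != a) && vle a b.

Lemma vrepr_pi x : O (val (vrepr (vpi x)) / val x) /\ O (val x / val (vrepr (vpi x))).
Proof. by apply/vpi_eq; rewrite vreprK. Qed.

Lemma vaddE x y : vadd (vpi x) (vpi y) = vpi (nzM x y).
Proof.
apply/vpi_eq; rewrite /=; have [x1 x2] := vrepr_pi x; have [y1 y2] := vrepr_pi y.
set x' := val (vrepr (vpi x)) in x1 x2 *; set y' := val (vrepr (vpi y)) in y1 y2 *.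
have [x'0 y'0] : x' != 0 /\ y' != 0 by split; apply: nzP.
by split; rewrite invfM mulrACA; apply: (vrM vO).
Qed.

Lemma voppE x : vopp (vpi x) = vpi (nzV x).
Proof.
apply/vpi_eq; rewrite /=; have [x1 x2] := vrepr_pi x.
by rewrite !invrK ![_^-1 * _]mulrC.
Qed.

Lemma vleE x y : vle (vpi x) (vpi y) <-> O (val y / val x).
Proof.
have [x1 x2] := vrepr_pi x; have [y1 y2] := vrepr_pi y.
set x' := val (vrepr (vpi x)) in x1 x2 *; set y' := val (vrepr (vpi y)) in y1 y2 *.
have [x'0 y'0] : x' != 0 /\ y' != 0 by split; apply: nzP.
split=> [/asboolP|] h.
  have -> : val y / val x = (val y / y') * ((y' / x') * (x' / val x)).
    by field; rewrite !nzP.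
  by do 2!apply: (vrM vO) => //.
apply/asboolP; rewrite -/x' -/y'.
have -> : y' / x' = (y' / val y) * ((val y / val x) * (val x / x')).
  by field; rewrite !nzP.
by do 2!apply: (vrM vO) => //.
Qed.

Lemma vgroupP (a : G) : exists x, vpi x = a.
Proof. by exists (vrepr a); apply: vreprK. Qed.

Let nz_inj (x y : nz) : val x = val y -> x = y. Proof. exact: val_inj. Qed.

Fact vaddA : associative vadd.
Proof.
move=> a b c; have [[x <-] [y <-] [w <-]] := And3 (vgroupP a) (vgroupP b) (vgroupP c).
by rewrite !vaddE; congr vpi; apply: nz_inj; rewrite /= mulrA.
Qed.
Fact vaddC : commutative vadd.
Proof.
move=> a b; have [[x <-] [y <-]] := (vgroupP a, vgroupP b).
by rewrite !vaddE; congr vpi; apply: nz_inj; rewrite /= mulrC.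
Qed.
Fact vadd0 : left_id vzero vadd.
Proof.
move=> a; have [x <-] := vgroupP a.
by rewrite !vaddE; congr vpi; apply: nz_inj; rewrite /= mul1r.
Qed.
Fact vaddN : left_inverse vzero vopp vadd.
Proof.
move=> a; have [x <-] := vgroupP a.
by rewrite voppE vaddE; congr vpi; apply: nz_inj; rewrite /= mulVf // nzP.
Qed.
HB.instance Definition _ := GRing.isZmodule.Build G vaddA vaddC vadd0 vaddN.

Fact vlt_def a b : vlt a b = (b != a) && vle a b. Proof. by []. Qed.
Fact vle_refl : reflexive vle.
Proof.
move=> a; have [x <-] := vgroupP a; apply/vleE.
by rewrite divff ?nzP //; apply: (vr1 vO).
Qed.
Fact vle_anti : antisymmetric vle.
Proof.
move=> a b; have [[x <-] [y <-]] := (vgroupP a, vgroupP b).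
by case/andP=> /vleE h1 /vleE h2; apply/vpi_eq.
Qed.
Fact vle_trans : transitive vle.
Proof.
move=> b a c; have [[x <-] [y <-] [w <-]] := And3 (vgroupP a) (vgroupP b) (vgroupP c).
move=> /vleE h1 /vleE h2; apply/vleE.
have -> : val w / val x = (val w / val y) * (val y / val x).
  by field; rewrite !nzP.
exact: (vrM vO).
Qed.
HB.instance Definition _ := Order.isPOrder.Build ring_display G
  vlt_def vle_refl vle_anti vle_trans.

Definition vval (x : K) : G :=
  if insub x is Some u then vpi (u : nz) else vzero.

Lemma vvalE (x : K) (x0 : x != 0) : vval x = vpi (exist _ x x0).
Proof. by rewrite /vval insubT. Qed.

Lemma vval_le x y : x != 0 -> y != 0 -> (vval x <= vval y) <-> O (y / x).
Proof. by move=> x0 y0; rewrite (vvalE x0) (vvalE y0); apply: vleE. Qed.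

Definition valuation_of_ring : valuation K.
Proof.
refine (@Valuation K G vval _ _ _ _ _).
- move=> a b; have [[x <-] [y <-]] := (vgroupP a, vgroupP b).
  apply/orP; case: (vrV vO (val x / val y)) => h; [right|left]; apply/vleE => //.
  by rewrite -invf_div.
- move=> a b c; have [[x <-] [y <-] [w <-]] := And3 (vgroupP a) (vgroupP b) (vgroupP c).
  move=> /vleE h; rewrite -![vpi _ + _]/(vadd _ _) !vaddE; apply/vleE => /=.
  suff -> : val x * val w / (val x * val y) = val w / val y by [].
  by field; rewrite !nzP.
- move=> a; have [[x x0] <-] := vgroupP a.
  by exists x => //; apply: vvalE.
- move=> x y x0 y0; rewrite (vvalE x0) (vvalE y0) (vvalE (mulf_neq0 x0 y0)).
  by rewrite -[RHS]/(vadd _ _) vaddE; congr vpi; apply: nz_inj.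
- move=> x y x0 y0 xy0; case: (vrV vO (x / y)) => h.
    have le : vval y <= vval x by apply/vval_le.
    rewrite minEle; case: ifP => [le'|_]; [apply: (le_trans le')|];
      apply/vval_le => //; rewrite mulrDl ?(divff y0) //;
      apply: (vrD vO) => //; exact: (vr1 vO).
  rewrite invf_div in h.
  have le : vval x <= vval y by apply/vval_le.
  rewrite minEle le; apply/vval_le => //; rewrite mulrDl ?(divff x0) //.
  by apply: (vrD vO) => //; exact: (vr1 vO).
Defined.

Lemma ring_of_valuation_of_ring x : ring_of valuation_of_ring x <-> O x.
Proof.
rewrite /ring_of mem_valuation_ring.
have [->|x0] := eqVneq x 0; first by split=> // _; apply: (vr0 vO).
have := vval_le (oner_neq0 K) x0; rewrite divr1 => <- /=.
suff -> : vval 1 = 0 by [].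
by rewrite (vvalE (oner_neq0 K)); congr vpi; apply: nz_inj.
Qed.

End ValuationOfRing.

Section Residue.
Variables (K : fieldType) (v : valuation K).
Local Notation O := (ring_of v).
Local Notation F := (residue_field v).

Definition res (x : K) : F :=
  if insub x is Some u
  then max_quot_pi (@valuation_ideal_max K v) (u : valuation_ring_type v) else 0.

Lemma resE x (Ox : O x) :
  res x = max_quot_pi (@valuation_ideal_max K v) (Sub x Ox : valuation_ring_type v).
Proof. by rewrite /res insubT. Qed.

Lemma res1 : res 1 = 1.
Proof.
rewrite (resE (vr1 (ring_of_valring v))) -(rmorph1 (max_quot_pi _)).
by congr max_quot_pi; apply: val_inj.
Qed.
Lemma resB x y : O x -> O y -> res (x - y) = res x - res y.
Proof.
move=> Ox Oy; rewrite (resE Ox) (resE Oy) (resE (vrB (ring_of_valring v) Ox Oy)).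
by rewrite -rmorphB; congr max_quot_pi; apply: val_inj.
Qed.
Lemma resM x y : O x -> O y -> res (x * y) = res x * res y.
Proof.
move=> Ox Oy; rewrite (resE Ox) (resE Oy) (resE (vrM (ring_of_valring v) Ox Oy)).
by rewrite -rmorphM; congr max_quot_pi; apply: val_inj.
Qed.
Lemma res_surj (a : F) : exists2 x, O x & res x = a.
Proof.
have [u <-] := max_quot_pi_surj a; exists (val u); first exact: (valP u).
by rewrite (resE (valP u)); congr max_quot_pi; apply: val_inj.
Qed.
Lemma res_eq0 x : O x -> res x = 0 <-> mxi O x.
Proof.
move=> Ox; rewrite (resE Ox) mxi_ring_of.
by split=> [/eqP|h]; [|apply/eqP]; rewrite max_quot_pi_eq0.
Qed.

End Residue.

(** * The field K(p) *)

Definition over_emb (K : fieldType) (L : fieldExtType K) (E : fieldType)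
  (iota : K -> E) (j : L -> E) := forall a : K, j a%:A = iota a.

Lemma map_poly_roots (R S : comNzRingType) (h : {rmorphism R -> S}) (rs : seq R) :
  map_poly h (\prod_(z <- rs) ('X - z%:P)) = \prod_(z <- map h rs) ('X - z%:P).
Proof.
by rewrite rmorph_prod big_map; apply: eq_bigr => z _; rewrite rmorphB /= map_polyX map_polyC.
Qed.

(** The elements are adjoined one at a time; a nonzero polynomial of least degree over L with root x
    is irreducible, as [SubFieldExtType] demands. *)
Lemma finite_subext (K E : fieldType) (iota : {rmorphism K -> E}) (xs : seq E) :
  (forall x, algebraicOver iota x) ->
  exists (L : fieldExtType K) (j : {rmorphism L -> E}),
    over_emb iota j /\ forall x, x \in xs -> exists u, j u = x.
Proof.
move=> algE; elim: xs => [|x xs [L [j [jP xsP]]]].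
  exists K^o, iota; split=> // a; by rewrite /GRing.scale /= mulr1.
have [q0 q00 q0x] := algE x.
pose P n := `[< exists q : {poly L}, [/\ size q = n, q != 0 & root (map_poly j q) x] >].
have exP : exists n, P n.
  exists (size (map_poly (in_alg L) q0)); apply/asboolP; exists (map_poly (in_alg L) q0).
  split=> //; first by rewrite map_poly_eq0.
  by rewrite -map_poly_comp (eq_map_poly jP).
have [n /asboolP[q [sq q_0 qx]] qmin] := ex_minnP exP.
have irr : irreducible_poly q.
  apply/(subfx_irreducibleP qx q_0) => r rx r0; rewrite sq; apply: qmin.
  by apply/asboolP; exists r.
pose L1 : fieldExtType L := SubFieldExtType qx irr.
pose j1 : {rmorphism subFExtend j x q -> E} := subfx_inj.
have j1P a : j1 a%:A = j a by apply: subfx_inj_base.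
pose L2 : fieldExtType K := baseFieldType L1.
pose j2 : {rmorphism L2 -> E} := j1.
exists L2, j2; split.
  by move=> a; rewrite -jP -j1P; congr (j1 _); rewrite [LHS]baseField_scaleE.
move=> y; rewrite inE => /orP[/eqP ->|/xsP[u <-]]; last by exists (in_alg L1 u); apply: j1P.
by exists (subfx_root j x q); apply: subfx_inj_root.
Qed.

(** The definition of K(p) speaks of abstract splitting fields; a splitting field E found as a
    subspace of L has to be made into one. *)
Lemma splitting_subvs (K : fieldType) (L : fieldExtType K) (g : {poly K}) (E : {subfield L}) :
  splittingFieldFor 1 (map_poly (in_alg L) g) E ->
  exists (L0 : splittingFieldType K) (i : {rmorphism L0 -> L}),
    [/\ over_emb (in_alg L) i, splittingFieldFor 1 (map_poly (in_alg L0) g) {:L0},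
        \dim {:L0} = \dim E & forall u, u \in E <-> exists u0, i u0 = u].
Proof.
case=> ys Dg defE; pose Lp := subvs_of E; pose toL := linfun (vsval : Lp -> L).
have ysE y : y \in ys -> y \in E by move=> yys; rewrite -defE seqv_sub_adjoin.
have [zs Dys]: {zs | map toL zs = ys}.
  exists (map (vsproj _) ys); rewrite -map_comp map_id_in // => y ys_y.
  by rewrite /= lfunE /= vsprojK ?ysE.
have splitLp : splittingFieldFor 1 (map_poly (in_alg Lp) g) {:Lp}.
  exists zs.
    set lhs := (lhs in lhs %= _); set rhs := (rhs in _ %= rhs).
    suffices: map_poly toL lhs %= map_poly toL rhs by rewrite eqp_map.
    move: Dg; rewrite -Dys big_map; apply: etrans; apply: congr2.
      by rewrite -map_poly_comp; apply/eq_map_poly=> x; apply: rmorph_alg.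
    rewrite rmorph_prod; apply/eq_bigr=> z _.
    by rewrite rmorphB /= map_polyX map_polyC.
  set Lzs := LHS; pose Lys := (toL @: Lzs)%VS; apply/vspaceP=> u.
  have: val u \in Lys by rewrite /Lys aimg_adjoin_seq aimg1 Dys defE (valP u).
  by case/memv_imgP=> v Lzs_v; rewrite memvf lfunE => /val_inj->.
have ax : SplittingField.axiom Lp.
  by exists (map_poly (in_alg Lp) g) => //; apply/polyOver1P; exists g.
pose Ls := FieldExt_isSplittingField.Build K Lp ax.
pose L0 : splittingFieldType K := HB.pack Lp Ls.
pose i : {rmorphism L0 -> L} := (vsval : Lp -> L).
exists L0, i; split=> //.
- by move=> a; rewrite /i /= algid1 //.
- by rewrite -[LHS]/(\dim {:Lp}) dimvf.
- move=> u; split=> [uE|[u0 <-]]; last exact: (valP u0).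
  by exists (vsproj E u); apply: vsprojK.
Qed.

Lemma splitting_subext (K : fieldType) (C : closedFieldType) (iota : {rmorphism K -> C})
    (g : {poly K}) :
  (forall x, algebraicOver iota x) -> g != 0 ->
  exists (L : splittingFieldType K) (j : {rmorphism L -> C}),
    over_emb iota j /\ splittingFieldFor 1 (map_poly (in_alg L) g) {:L}.
Proof.
move=> algC g0; have [rs gE] := closed_field_poly_normal (map_poly iota g).
have [L [j [jP rsP]]] := finite_subext rs algC.
have [us usE] : exists us, map j us = rs.
  elim: rs rsP {gE} => [|r rs IH] rsP; first by exists [::].
  have [|us <-] := IH; first by move=> x xrs; apply: rsP; rewrite inE xrs orbT.
  by have [|u <-] := rsP r; rewrite ?inE ?eqxx //; exists (u :: us).
have spl : splittingFieldFor 1 (map_poly (in_alg L) g) <<1 & us>>%AS.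
  exists us => //; rewrite -(eqp_map j) -map_poly_comp (eq_map_poly jP) gE -usE.
  by rewrite map_poly_roots; apply: eqp_scale; rewrite lead_coef_eq0 map_poly_eq0.
have [L0 [i [iP L0g _ _]]] := splitting_subvs spl.
exists L0, (j \o i); split=> // a /=.
by rewrite iP jP.
Qed.

(** * The largest Galois p-subextension of a finite Galois extension *)

Section Core.
Variables (p : nat) (p_prime : prime p) (K : fieldType) (L : splittingFieldType K).
Hypothesis galL : galois 1 {:L}.
Local Notation G := ('Gal({:L} / 1)%g).

(** They generate the smallest normal subgroup whose quotient is a p-group. With its fixed field,
    composita of p-extensions need no computation of degrees: it suffices that every automorphism of
    order prime to p fixes an element. *)
Definition pcore_gens : {set gal_of {:L}} := [set s in G | coprime #[s]%g p].
Definition pcore_field : {subfield L} := [aspace of fixedField <<pcore_gens>>%g].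

Lemma pcore_fieldP u :
  u \in pcore_field <-> forall s, s \in G -> coprime #[s]%g p -> s u = u.
Proof.
split=> [/fixedFieldP h s sG cs|h].
  by apply: h; rewrite ?memvf //; apply: mem_gen; rewrite inE sG cs.
apply/fixedFieldP; rewrite ?memvf // => s sA.
have : s \in 'Gal({:L} / <<1; u>>)%g.
  move: s sA; apply/subsetP; rewrite gen_subG; apply/subsetP => s; rewrite inE => /andP[sG cs].
  rewrite gal_kHom ?subvf //; apply/kAHomP => a /Fadjoin_polyP[q q1 ->].
  by rewrite -horner_map (fixedPoly_gal (sub1v _) sG q1) /= h.
move/fixed_gal; apply; rewrite ?subvf ?memv_adjoin //.
Qed.

Lemma pcore_normal : (<<pcore_gens>>%G <| G)%g.
Proof.
apply/andP; split.
  by rewrite gen_subG; apply/subsetP => s; rewrite inE => /andP[].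
apply: norms_gen; apply/subsetP => t tG; rewrite inE; apply/subsetP => _ /imsetP[s sA ->].
by move: sA; rewrite !inE => /andP[sG cs]; rewrite groupJ //= orderJ.
Qed.

Lemma pcore_galois : galois 1 pcore_field.
Proof. exact: normal_fixedField_galois galL _ pcore_normal. Qed.

Lemma pcore_dim : exists n, \dim pcore_field = (p ^ n)%N.
Proof.
have sE : (1 <= pcore_field <= {:L})%VS by rewrite sub1v subvf.
have := galois_dim pcore_galois; rewrite dimv1 divn1 => ->.
have nE : normalField 1 pcore_field by case/and3P: pcore_galois.
rewrite -(card_isog (normalField_isog galL sE nE)) gal_fixedField.
suff pQ : (p.-group (G / <<pcore_gens>>))%g by have [n ->] := p_natP pQ; exists n.
apply/pgroupP => q q_pr /(Cauchy q_pr)[x xQ ox].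
case/morphimP: xQ => y Ny Gy xE.
(* The p'-part of y is one of the generators, so the p'-part of its image x is trivial, and the
   prime order q of x is p. *)
have yH : (y.`_p^')%g \in <<pcore_gens>>%g.
  apply: mem_gen; rewrite inE groupX //= order_constt.
  by rewrite coprime_sym prime_coprime // -p'natE // part_pnat.
have : (x.`_p^' = 1)%g by rewrite xE -morph_constt //; apply: coset_id.
by move/constt1P; rewrite p_eltNK /p_elt ox pnatE.
Qed.

(** The restriction of s to E has an order dividing both the order of s and p^n, so it is
    trivial. *)
Lemma core_fix (E : {subfield L}) n u :
  galois 1 E -> \dim E = (p ^ n)%N -> u \in E -> u \in pcore_field.
Proof.
move=> galE dimE uE; apply/pcore_fieldP => s sG cs.
have sE : (1 <= E <= {:L})%VS by rewrite sub1v subvf.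
have nE : normalField 1 E by case/and3P: galE.
rewrite -(normalField_cast_eq sE nE sG uE).
suff -> : normalField_cast E s = 1%g by rewrite gal_id.
apply/eqP; rewrite -order_eq1 -dvdn1.
have c1 : (#[normalField_cast E s]%g %| #[s]%g)%N.
  exact: (morph_order (normalField_cast_morphism sE nE) sG).
have c2 : (#[normalField_cast E s]%g %| p ^ n)%N.
  rewrite -dimE; have := galois_dim galE; rewrite dimv1 divn1 => ->.
  apply: order_dvdG; have := mem_morphim (normalField_cast_morphism sE nE) sG sG.
  by rewrite (normalField_img galL).
by rewrite -(eqP (coprimeXr n cs)) dvdn_gcd c1 c2.
Qed.

End Core.

Section Compositum.
Variables (p : nat) (p_prime : prime p) (K : fieldType).
Variables (C : closedFieldType) (iota : {rmorphism K -> C}).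
Hypothesis algC : forall x, algebraicOver iota x.

Lemma sub_image (L1 L : fieldExtType K) (j1 : {rmorphism L1 -> C}) (j : {rmorphism L -> C})
    (rs : seq L1) :
  over_emb iota j1 -> over_emb iota j ->
  (forall r, r \in rs -> exists u, j u = j1 r) ->
  forall u1, u1 \in <<1 & rs>>%VS -> exists u, j u = j1 u1.
Proof.
move=> j1P jP; elim/last_ind: rs => [|rs r IH] rsP u1.
  by rewrite Fadjoin_nil => /vlineP[a ->]; exists a%:A; rewrite jP j1P.
rewrite adjoin_rcons => /Fadjoin_polyP[q /polyOverP qE ->].
rewrite horner_coef rmorph_sum; elim/big_ind: _ => [|_ _ [a <-] [b <-]|i _].
- by exists 0; rewrite rmorph0.
- by exists (a + b); rewrite rmorphD.
have [|a ea] := IH _ _ (qE i); first by move=> w wrs; apply: rsP; rewrite mem_rcons inE wrs orbT.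
have [|b eb] := rsP r; first by rewrite mem_rcons inE eqxx.
by exists (a * b ^+ i); rewrite !rmorphM !rmorphXn ea eb.
Qed.

Lemma galois_of_roots (L : splittingFieldType K) (g : {poly L}) :
  splittingFieldFor 1 g {:L} -> g \is a polyOver 1%VS ->
  (forall r, root g r -> separable_element 1 r) -> galois 1 {:L}.
Proof.
move=> spl g1 sep; have [rs gE rsE] := spl.
apply/and3P; split; first exact: sub1v.
  rewrite -rsE; apply: separable_Fadjoin_seq; apply/allP => r rrs.
  by apply: sep; rewrite (eqp_root gE) root_prod_XsubC.
by apply/splitting_normalField; [exact: sub1v|exists g].
Qed.

(** As j is injective, j1 factors through it by a K-algebra morphism from L1 to L; E is the
    image. *)
Lemma transfer_image (L1 L : splittingFieldType K) (j1 : {rmorphism L1 -> C}) (j : {rmorphism L -> C}) :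
  over_emb iota j1 -> over_emb iota j -> galois 1 {:L1} ->
  (forall u1, exists u, j u = j1 u1) ->
  exists E : {subfield L}, [/\ galois 1 E, \dim E = \dim {:L1} &
    forall u1 u, j u = j1 u1 -> u \in E].
Proof.
move=> j1P jP gal1 sub; pose h u1 := projT1 (cid (sub u1)).
have hP u1 : j (h u1) = j1 u1 by exact: projT2 (cid (sub u1)).
have jI : injective j by apply: fmorph_inj.
have hB : zmod_morphism h by move=> a b; apply: jI; rewrite rmorphB !hP rmorphB.
have hM : monoid_morphism h.
  by split=> [|a b]; apply: jI; rewrite ?rmorph1 ?rmorphM !hP ?rmorph1 ?rmorphM.
have hZ : scalable h.
  move=> a u; apply: jI; rewrite hP -[a *: u]mul1r -scalerAr scalerAl rmorphM j1P.
  by rewrite -[a *: h u]mul1r -scalerAr scalerAl rmorphM jP hP.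
pose h1 := GRing.isZmodMorphism.Build L1 L h hB.
pose h2 := GRing.isMonoidMorphism.Build L1 L h hM.
pose h3 := GRing.isScalable.Build K L1 L *:%R h hZ.
pose hR : {lrmorphism L1 -> L} := HB.pack h h1 h2 h3.
pose f : 'AHom(L1, L) := linfun_ahom hR.
have fE u : f u = h u by rewrite lfunE.
exists [aspace of (f @: {:L1})%VS]; split.
- have [q [/polyOver1P[g ->] sepg [rs gE rsE]]] := (elimT splitting_galoisField gal1).
  apply: (introT (@splitting_galoisField _ _ 1%AS [aspace of (f @: {:L1})%VS])); exists (map_poly (in_alg L) g).
  have Dg : map_poly (in_alg L) g = map_poly f (map_poly (in_alg L1) g).
    by rewrite -map_poly_comp; apply/eq_map_poly => a; apply: jI; rewrite /= fE hP jP j1P.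
  split; first by apply/polyOver1P; exists g.
    by rewrite Dg separable_map.
  exists (map f rs); last first.
    by rewrite -[RHS]/(f @: {:L1})%VS -rsE aimg_adjoin_seq aimg1.
  have e : map_poly f (\prod_(z <- rs) ('X - z%:P)) = \prod_(z <- map f rs) ('X - z%:P).
    by rewrite (eq_map_poly fE) (eq_map fE); apply: (map_poly_roots hR).
  by rewrite Dg -e eqp_map.
- by rewrite limg_dim_eq // (eqP (AHom_lker0 f)) capv0.
- move=> u1 u e; suff -> : u = f u1 by rewrite memv_img ?memvf.
  by apply: jI; rewrite fE hP.
Qed.

Definition galois_p (x : C) := exists (L : splittingFieldType K) (j : {rmorphism L -> C}) n,
  [/\ over_emb iota j, galois 1 {:L}, \dim {:L} = (p ^ n)%N & exists u, j u = x].

Lemma pcore_galois_p (L : splittingFieldType K) (j : {rmorphism L -> C}) u :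
  over_emb iota j -> galois 1 {:L} -> u \in pcore_field p L -> galois_p (j u).
Proof.
move=> jP galL uE; have galE := pcore_galois p galL.
have [n dimE] := pcore_dim p_prime galL.
have [q [/polyOver1P[g ->] sepg spl]] := elimT splitting_galoisField galE.
have [L0 [i [iP L0g dim0 imi]]] := splitting_subvs spl.
exists L0, (j \o i), n; split.
- by move=> a /=; rewrite iP jP.
- apply: (introT (@splitting_galoisField _ _ 1%AS {:L0}%AS)); exists (map_poly (in_alg L0) g); split=> //.
    by apply/polyOver1P; exists g.
  by move: sepg; rewrite !separable_map.
- by rewrite dim0.
- by have [u0 <-] := (imi u).1 uE; exists u0.
Qed.

End Compositum.

(** * Roots of f in finite Galois extensions *)

Section KasPoly.
Variables (p : nat) (p_prime : prime p).

Definition kaspoly (R : comNzRingType) (z : R) : {poly R} := \prod_(i < p) ('X - (qnat z i)%:P).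

Lemma horner_kaspoly (R : comNzRingType) (z y : R) : (kaspoly z).[y] = kas p z y.
Proof. by rewrite horner_prod; apply: eq_bigr => i _; rewrite hornerXsubC. Qed.

Lemma map_kaspoly (R S : comNzRingType) (h : {rmorphism R -> S}) z :
  map_poly h (kaspoly z) = kaspoly (h z).
Proof.
rewrite rmorph_prod; apply: eq_bigr => i _; rewrite rmorphB /= map_polyX map_polyC /= qnat_rmorph //.
Qed.

Lemma monic_kaspoly (R : comNzRingType) (z : R) : kaspoly z \is monic.
Proof. by apply: monic_prod => i _; apply: monicXsubC. Qed.

Lemma size_kaspoly (R : idomainType) (z : R) : size (kaspoly z) = p.+1.
Proof. by rewrite size_prod_XsubC /index_enum -enumT size_enum_ord. Qed.

Variables (K : fieldType) (z : K) (zP : qnat z p = 0).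
Local Notation lam := (z - 1).

Lemma tmul_qnat_inj y i j : 1 + lam * y != 0 -> (i < p)%N -> (j < p)%N ->
  tmul lam y (qnat z i) = tmul lam y (qnat z j) -> i = j.
Proof.
move=> y0; wlog ij : i j / (i <= j)%N => [H|] ip jp e.
  by case/orP: (leq_total i j) => ij; [|symmetry]; apply: H.
have e1 : qnat z i = qnat z j.
  apply/eqP; rewrite -subr_eq0; apply/eqP/(mulIf y0); rewrite mul0r.
  have -> : (qnat z i - qnat z j) * (1 + lam * y) =
    tmul lam y (qnat z i) - tmul lam y (qnat z j) by rewrite /tmul; ring.
  by rewrite e subrr.
move: e1; rewrite -{1}(subnKC ij) qnatD => /eqP; rewrite addrC -subr_eq subrr eq_sym mulf_eq0.
rewrite expf_eq0 (negPf (zeta_neq0 p_prime zP)) andbF /= => q0.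
apply/eqP; rewrite eqn_leq ij -subn_eq0 /=; apply: contraTT q0 => d0.
by apply: (qnat_neq0 p_prime zP); rewrite lt0n d0 (leq_ltn_trans (leq_subr _ _)).
Qed.

(** The translates of y by the [i] for [tmul] are roots by [kas_tmul], and distinct because 1 + lam
    y is nonzero. In particular f - f(y) is separable. *)
Lemma kaspoly_factor y : 1 + lam * y != 0 ->
  kaspoly z - (kas p z y)%:P = \prod_(w <- [seq tmul lam y (qnat z i) | i <- iota 0 p]) ('X - w%:P)
  /\ uniq [seq tmul lam y (qnat z i) | i <- iota 0 p].
Proof.
move=> y0; have U : uniq [seq tmul lam y (qnat z i) | i <- iota 0 p].
  rewrite map_inj_in_uniq ?iota_uniq // => i j; rewrite !mem_iota /= !add0n.
  by move=> ip jp; apply: tmul_qnat_inj.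
split=> //.
have sP : size (kaspoly z - (kas p z y)%:P) = p.+1.
  rewrite size_polyDl size_kaspoly // size_polyN (leq_ltn_trans (size_polyC_leq1 _)) //.
  by rewrite ltnS prime_gt0.
have lP : lead_coef (kaspoly z - (kas p z y)%:P) = 1.
  rewrite lead_coefDl ?(monicP (monic_kaspoly z)) // size_kaspoly size_polyN.
  by rewrite (leq_ltn_trans (size_polyC_leq1 _)) // ltnS prime_gt0.
have := @all_roots_prod_XsubC _ (kaspoly z - (kas p z y)%:P) [seq tmul lam y (qnat z i) | i <- iota 0 p].
rewrite lP scale1r; apply.
- by rewrite sP size_map size_iota.
- apply/allP => _ /mapP[i + ->]; rewrite mem_iota add0n /= => ip.
  rewrite /root hornerD hornerN hornerC horner_kaspoly kas_tmul //.
  by rewrite kas_qnat // tmul0 subrr.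
- by rewrite uniq_rootsE.
Qed.

End KasPoly.

Section Big.
Variables (p : nat) (p_prime : prime p) (K : fieldType).
Variables (C : closedFieldType) (io : {rmorphism K -> C}).
Hypothesis algC : forall x, algebraicOver io x.

Lemma big_splitting (L1 : splittingFieldType K) (j1 : {rmorphism L1 -> C}) (g2 : {poly K}) :
  over_emb io j1 -> galois 1 {:L1} -> g2 != 0 ->
  (forall (L : splittingFieldType K) r, root (map_poly (in_alg L) g2) r -> separable_element 1 r) ->
  exists (L : splittingFieldType K) (j : {rmorphism L -> C}),
    [/\ over_emb io j, galois 1 {:L}, forall u1, exists u, j u = j1 u1 &
        forall x, root (map_poly io g2) x -> exists u, j u = x].
Proof.
move=> j1P gal1 g20 sep2.
have [q1 [/polyOver1P[g1 ->] sep1 [rs1 g1E rs1E]]] := elimT splitting_galoisField gal1.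
have g10 : g1 != 0.
  by apply: contraTneq (separable_poly_neq0 sep1) => ->; rewrite rmorph0 eqxx.
have g0 : g1 * g2 != 0 by rewrite mulf_neq0.
have [L [j [jP spl]]] := splitting_subext algC g0.
have sep1' : separable_poly (map_poly (in_alg L) g1).
  by move: sep1; rewrite !separable_map.
have jim x : root (map_poly io (g1 * g2)) x -> exists u, j u = x.
  case: spl => us gE _; rewrite -(eq_map_poly jP).
  rewrite map_poly_comp; move: gE; rewrite -(eqp_map j) => /eqp_root ->.
  by rewrite map_poly_roots root_prod_XsubC => /mapP[u _ ->]; exists u.
have imr x : root (map_poly io g1) x \/ root (map_poly io g2) x -> exists u, j u = x.
  by move=> H; apply: jim; rewrite rmorphM rootM; apply/orP.
exists L, j; split=> //.
- apply: (galois_of_roots spl); first by apply/polyOver1P; exists (g1 * g2).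
  move=> r; rewrite rmorphM rootM => /orP[r1|]; last exact: sep2.
  apply/separable_elementP; exists (map_poly (in_alg L) g1); split=> //.
  by apply/polyOver1P; exists g1.
- move=> u1; apply: (sub_image (rs := rs1) j1P jP); last by rewrite rs1E memvf.
  move=> r rrs; apply: imr; left; rewrite -(eq_map_poly j1P) map_poly_comp fmorph_root.
  by rewrite (eqp_root g1E) root_prod_XsubC.
- by move=> x gx; apply: imr; right.
Qed.

Lemma galois_common (L1 L2 : splittingFieldType K) (j1 : {rmorphism L1 -> C})
    (j2 : {rmorphism L2 -> C}) :
  over_emb io j1 -> galois 1 {:L1} -> over_emb io j2 -> galois 1 {:L2} ->
  exists (L : splittingFieldType K) (j : {rmorphism L -> C}),
    [/\ over_emb io j, galois 1 {:L}, forall u1, exists u, j u = j1 u1 &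
        forall u1, exists u, j u = j2 u1].
Proof.
move=> j1P gal1 j2P gal2.
have [q2 [/polyOver1P[g2 ->] sep2 [rs2 g2E rs2E]]] := elimT splitting_galoisField gal2.
have g20 : g2 != 0.
  by apply: contraTneq (separable_poly_neq0 sep2) => ->; rewrite rmorph0 eqxx.
have [|L [j [jP galL sub1 im2]]] := big_splitting j1P gal1 g20.
  move=> L r rr; apply/separable_elementP; exists (map_poly (in_alg L) g2).
  split=> //; first by apply/polyOver1P; exists g2.
  by move: sep2; rewrite !separable_map.
exists L, j; split=> // u1; apply: (sub_image (rs := rs2) j2P jP); last by rewrite rs2E memvf.
move=> r rrs; apply: im2; rewrite -(eq_map_poly j2P) map_poly_comp fmorph_root.
by rewrite (eqp_root g2E) root_prod_XsubC.
Qed.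

Variables (z : K) (zP : qnat z p = 0).
Local Notation lam := (z - 1).

(** The polynomial to be split is h(f(X)), with h the minimal polynomial of u1 over K. Its roots r
    are separable: f(r) is a root of h, and f(X) - f(r) is separable as soon as 1 + lam r is
    nonzero. *)
Lemma galois_kas (L1 : splittingFieldType K) (j1 : {rmorphism L1 -> C}) u1 y :
  over_emb io j1 -> galois 1 {:L1} -> kas p (io z) y = j1 u1 ->
  1 + (io z - 1) * y != 0 ->
  exists (L : splittingFieldType K) (j : {rmorphism L -> C}),
    [/\ over_emb io j, galois 1 {:L}, forall u1, exists u, j u = j1 u1 & exists u, j u = y].
Proof.
move=> j1P gal1 fy y0; have [/polyOver1P[h hE] hmon] := (minPolyOver 1 u1, monic_minPoly 1 u1).
have hmon0 : h \is monic by move: hmon; rewrite hE map_monic.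
have ioP : qnat (io z) p = 0 by rewrite -qnat_rmorph zP rmorph0.
have seph : separable_poly h.
  have /and3P[_ /separableP sep _] := gal1.
  by have := sep u1 (memvf u1); rewrite /separable_element hE separable_map.
have g20 : h \Po kaspoly p z != 0.
  rewrite -lead_coef_eq0 lead_coef_comp ?size_kaspoly ?ltnS ?prime_gt0 //.
  rewrite (monicP (monic_kaspoly p z)) (monicP hmon0) expr1n mul1r oner_eq0 //.
have [|L [j [jP galL sub1 im2]]] := big_splitting j1P gal1 g20; last first.
  exists L, j; split=> //; apply: im2; rewrite map_comp_poly map_kaspoly /root horner_comp.
  rewrite horner_kaspoly fy -(eq_map_poly j1P) map_poly_comp horner_map -hE.
  by have /rootP -> := root_minPoly 1 u1; rewrite rmorph0.
move=> L r; rewrite map_comp_poly map_kaspoly /root horner_comp horner_kaspoly.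
set zL := in_alg L z; set r' := kas p zL r => hr'.
have zLP : qnat zL p = 0 by rewrite -qnat_rmorph zP rmorph0.
(* Otherwise f(r) = -1/lam^p lies in K; it is a root of the irreducible h, so u1 is this constant
   and 1 + lam y = 0 too. *)
have r0 : 1 + (zL - 1) * r != 0.
  apply: contra_neqN y0 => r0.
  have l0 : lam != 0.
    apply: contraTneq r0 => l0.
    have -> : zL - 1 = in_alg L (z - 1) by rewrite rmorphB rmorph1.
    by rewrite l0 rmorph0 mul0r addr0 oner_eq0.
  have lE : 1 + (in_alg L (lam ^+ p)) * r' = 0.
    rewrite rmorphXn rmorphB rmorph1 -/zL kasE // (eqP r0) expr0n.
    by case: (p) p_prime.
  pose c := - (lam ^+ p)^-1.
  have lp : lam ^+ p != 0 by rewrite expf_neq0.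
  have r'E : r' = in_alg L c.
    apply: (mulfI (_ : in_alg L (lam ^+ p) != 0)); first by rewrite fmorph_eq0.
    by apply: (addrI 1); rewrite lE -rmorphM mulrN mulfV // rmorphN1 subrr.
  have hc : root h c by move: hr'; rewrite r'E horner_map fmorph_eq0.
  have u1c : u1 = in_alg L1 c.
    have d : ('X - (in_alg L1 c)%:P) %| minPoly 1 u1.
      by rewrite hE -map_polyXsubC dvdp_map -root_factor_theorem.
    have po : 'X - (in_alg L1 c)%:P \is a polyOver 1%VS.
      by rewrite polyOverXsubC rpredZ // mem1v.
    case/orP: (minPoly_irr po d) => [/eqp_root e|].
      by apply/eqP; rewrite -root_XsubC e root_minPoly.
    by move/eqp_size; rewrite size_XsubC size_poly1.
  have : 1 + (io lam) ^+ p * kas p (io z) y = 0.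
    rewrite fy u1c [j1 _]j1P -rmorphXn -rmorphM mulrN mulfV // rmorphN1 subrr //.
  rewrite rmorphB rmorph1 kasE // => /eqP; rewrite expf_eq0 => /andP[_ /eqP //].
have sepr' : separable_element 1 r'.
  apply/separable_elementP; exists (map_poly (in_alg L) h); split=> //.
    by apply/polyOver1P; exists h.
  by rewrite separable_map.
apply: (adjoin_separable sepr'); apply/separable_elementP.
exists (kaspoly p zL - r'%:P); split.
- rewrite rpredB ?polyOverC ?memv_adjoin // -map_kaspoly.
  apply: (polyOverS (subvP (subv_adjoin 1 r'))).
  by apply/polyOver1P; exists (kaspoly p z).
- by rewrite /root hornerD hornerN hornerC horner_kaspoly subrr.
- have [-> U] := kaspoly_factor p_prime zLP r0.
  by rewrite separable_prod_XsubC.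
Qed.

End Big.

Section PExt.
Variables (p : nat) (p_prime : prime p) (K : fieldType).
Local Notation C := (alg_closure K).
Local Notation io := (closure_emb C).
Let algC x : algebraicOver io x := closure_alg x.

Lemma galois_p_in x : galois_p p io x -> in_p_extension p x.
Proof. by move=> [L [j [n [jP galL dimL [u <-]]]]] F _ FL; apply: (FL L j n). Qed.

Lemma galois_p_base a : galois_p p io (io a).
Proof.
exists (K^o : splittingFieldType K), io, 0%N; split.
- by move=> b; rewrite /GRing.scale /= mulr1.
- apply/splitting_galoisField; exists 1; split; first exact: rpred1.
    by rewrite unlock coprime1p.
  exists [::]; first by rewrite big_nil eqpxx.
  by rewrite Fadjoin_nil; apply: (esym (regular_fullv K)).
- by rewrite dimvf.
- by exists a.
Qed.

Lemma galois_p_core (L1 L : splittingFieldType K) (j1 : {rmorphism L1 -> C})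
    (j : {rmorphism L -> C}) n :
  over_emb io j1 -> galois 1 {:L1} -> \dim {:L1} = (p ^ n)%N ->
  over_emb io j -> galois 1 {:L} -> (forall u1, exists u, j u = j1 u1) ->
  forall u u1, j u = j1 u1 -> u \in pcore_field p L.
Proof.
move=> j1P gal1 dim1 jP galL sub u u1 e.
have [E [galE dimE EP]] := transfer_image j1P jP gal1 sub.
by apply: (core_fix (n := n) galL galE); rewrite ?dimE //; apply: EP e.
Qed.

(** Two elements of Galois p-extensions lie in the p-core of a common Galois extension, so such
    elements already form a field. *)
Lemma in_galois_p x : in_p_extension p x -> galois_p p io x.
Proof.
pose F : {pred C} := fun x => `[< galois_p p io x >].
suff FC : divring_closed F.
  move=> /(_ F FC) h; apply/asboolP; apply: h => L j n jP galL dimL y.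
  by apply/asboolP; exists L, j, n; split=> //; exists y.
have comb x1 x2 : galois_p p io x1 -> galois_p p io x2 ->
    exists (L : splittingFieldType K) (j : {rmorphism L -> C}) u1 u2,
    [/\ over_emb io j, galois 1 {:L}, j u1 = x1 /\ j u2 = x2 &
      u1 \in pcore_field p L /\ u2 \in pcore_field p L].
  move=> [L1 [j1 [n1 [j1P gal1 dim1 [u1 <-]]]]] [L2 [j2 [n2 [j2P gal2 dim2 [u2 <-]]]]].
  have [L [j [jP galL sub1 sub2]]] := galois_common algC j1P gal1 j2P gal2.
  have [[v1 e1] [v2 e2]] := (sub1 u1, sub2 u2).
  exists L, j, v1, v2; split=> //; split.
    exact: (galois_p_core j1P gal1 dim1 jP galL sub1 e1).
  exact: (galois_p_core j2P gal2 dim2 jP galL sub2 e2).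
split.
- by apply/asboolP; rewrite -(rmorph1 io); apply: galois_p_base.
- move=> a b /asboolP aP /asboolP bP; apply/asboolP.
  have [L [j [u1 [u2 [jP galL [<- <-] [h1 h2]]]]]] := comb _ _ aP bP.
  by rewrite -rmorphB; apply: pcore_galois_p => //; apply: rpredB.
- move=> a b /asboolP aP /asboolP bP; apply/asboolP.
  have [L [j [u1 [u2 [jP galL [<- <-] [h1 h2]]]]]] := comb _ _ aP bP.
  rewrite -fmorph_div; apply: pcore_galois_p => //.
  by apply: rpredM => //; rewrite memvV.
Qed.

Variables (z : K) (zP : qnat z p = 0).
Local Notation lam := (z - 1).
Let ioP : qnat (io z) p = 0. Proof. by rewrite -qnat_rmorph zP rmorph0. Qed.

(** An automorphism s of order prime to p fixes f(v), hence translates v by some [i]. Then s^p fixes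
    v, and s is a power of s^p. *)
Lemma in_p_extension_kas y : in_p_extension p (kas p (io z) y) -> in_p_extension p y.
Proof.
have [y0 _|y0] := eqVneq (1 + (io z - 1) * y) 0.
  have l0 : lam != 0.
    apply: contraTneq (oner_neq0 C) => l0; rewrite -y0.
    have -> : io z - 1 = io lam by rewrite rmorphB rmorph1.
    by rewrite l0 rmorph0 mul0r addr0 eqxx.
  have -> : y = io (- lam^-1).
    have l1 : io lam != 0 by rewrite fmorph_eq0.
    apply: (mulfI l1); apply: (addrI 1); rewrite -rmorphM mulrN mulfV // rmorphN1 subrr.
    by rewrite rmorphB rmorph1.
  exact/galois_p_in/galois_p_base.
move=> /in_galois_p[L1 [j1 [n1 [j1P gal1 dim1 [u1 u1E]]]]].
have [L [j [jP galL sub1 [v vE]]]] := galois_kas p_prime algC zP j1P gal1 (esym u1E) y0.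
apply: galois_p_in; rewrite -vE; apply: pcore_galois_p => //.
pose zL := in_alg L z; have jz : j zL = io z by apply: jP.
have zLP : qnat zL p = 0 by rewrite -qnat_rmorph zP rmorph0.
have kE : j (kas p zL v) = j1 u1 by rewrite kas_rmorph jz vE u1E.
have kc := galois_p_core j1P gal1 dim1 jP galL sub1 kE.
apply/pcore_fieldP => s sG cs.
have sz : s zL = zL by apply: (fixed_gal (sub1v _) sG); rewrite rpredZ // mem1v.
have sk : kas p zL (s v) = kas p zL v.
  by move/pcore_fieldP/(_ s sG cs): kc => e; rewrite -[RHS]e kas_rmorph /= sz.
have v0 : 1 + (zL - 1) * v != 0.
  rewrite -(fmorph_eq0 j) rmorphD rmorphM rmorphB rmorph1 jz vE //.
have [i ip si] := kas_inj p_prime zLP v0 (esym sk).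
have sq n : s (qnat zL n) = qnat zL n by rewrite qnat_rmorph /= sz.
have st a b : s (tmul (zL - 1) a b) = tmul (zL - 1) (s a) (s b).
  by rewrite /tmul !rmorphD !rmorphM rmorphB rmorph1 /= sz.
have sX k : (s ^+ k)%g v = tmul (zL - 1) v (qnat zL (i * k)).
  elim: k => [|k IH]; first by rewrite muln0 qnat0 tmul0 expg0 gal_id.
  rewrite expgSr galM ?memvf // IH st si sq tmulA; congr tmul.
  by rewrite mulnS qnat_tmul.
have sp : (s ^+ p)%g v = v.
  by rewrite sX -(add0n (i * p)%N) qnatDp // qnat0 tmul0.
have spk k : ((s ^+ p) ^+ k)%g v = v.
  by elim: k => [|k IH]; [rewrite gal_id|rewrite expgSr galM ?memvf // IH sp].
case: (egcdnP #[s]%g (prime_gt0 p_prime)) => km kn e _.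
have g1 : gcdn p #[s]%g = 1%N by rewrite gcdnC; apply/eqP.
have <- : ((s ^+ p) ^+ km = s)%g.
  by rewrite -expgM mulnC e g1 addn1 expgSr mulnC expgM expg_order expg1n mul1g.
exact: spk.
Qed.

End PExt.

(** * Characters of p-groups and Lagrange resolvents *)

Section Character.
Variables (p : nat) (p_prime : prime p) (gT : finGroupType) (H Z : {group gT}).
Hypotheses (pH : (p.-group H)%g) (ZH : (Z \proper H)%g).

(** A maximal subgroup of a p-group is normal of index p. The value chi g is the exponent of g in
    the cyclic quotient by such a subgroup containing Z. *)
Lemma p_character : exists chi : gT -> nat,
  [/\ {in H &, forall g h, chi (g * h)%g = chi g + chi h %[mod p]},
      forall g, g \in Z -> chi g = 0 %[mod p] &
      exists2 s, s \in H & (chi s != 0 %[mod p])%N].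
Proof.
have [N maxN ZN] := @maxgroup_exists _ (fun M : {group gT} => (M \proper H)%g) Z ZH.
have nN := p_maximal_normal pH maxN; have iN := p_maximal_index pH maxN.
have [sNH nNH] := andP nN.
have NH : (N \proper H)%g by case/maxgroupP: maxN.
have [s sH sN] : exists2 s, s \in H & s \notin N.
  by case/properP: NH => _ [s sH sN]; exists s.
have oQ : #|(H / N)%g| = p by rewrite card_quotient.
have cyc : <[coset N s]>%g = (H / N)%g.
  apply/eqP; rewrite eqEcard cycle_subG mem_quotient //= oQ.
  have d : (#[coset N s]%g %| p)%N by rewrite -oQ order_dvdG // mem_quotient.
  have /orP[|/eqP e] := (primeP p_prime).2 _ d; last by rewrite -[X in (X <= _)%N]e.
  rewrite order_eq1 => /eqP c1; case/negP: sN.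
  by apply: coset_idr => //; apply: (subsetP nNH).
have os : #[coset N s]%g = p by rewrite -oQ -cyc.
have ex g : exists k, g \in H -> coset N g = (coset N s ^+ k)%g.
  have [gH|gH] := boolP (g \in H); last by exists 0%N.
  have : coset N g \in <[coset N s]>%g by rewrite cyc mem_quotient.
  by case/cycleP => k ->; exists k.
pose chi g := projT1 (cid (ex g)).
have chiP g : g \in H -> coset N g = (coset N s ^+ chi g)%g := projT2 (cid (ex g)).
have nH g : g \in H -> g \in 'N(N)%g := subsetP nNH g.
exists chi; split.
- move=> g h gH hH; apply/eqP; rewrite -os -eq_expg_mod_order.
  by rewrite expgD -!chiP ?groupM // morphM ?nH.
- move=> g /(subsetP ZN) gN; apply/eqP; rewrite -os -eq_expg_mod_order.
  by rewrite expg0 -chiP ?(subsetP sNH) // coset_id.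
- exists s => //; apply/negP; rewrite -os -eq_expg_mod_order -chiP // expg0.
  move/eqP => c1; case/negP: sN.
  by apply: coset_idr => //; apply: nH.
Qed.

End Character.

Lemma mulr_sumlr (R : comNzRingType) (I : finType) (X : {set I}) (a b : R) (F : I -> R) :
  a * (\sum_(i in X) F i) * b = \sum_(i in X) a * F i * b.
Proof. by rewrite mulr_sumr mulr_suml. Qed.

Section Resolvent.
Variables (p : nat) (p_prime : prime p) (K : fieldType) (L : splittingFieldType K).
Variables (z : K) (zP : qnat z p = 0).
Let zL := in_alg L z.
Local Notation lam := (zL - 1).
Let zLP : qnat zL p = 0. Proof. by rewrite -qnat_rmorph zP rmorph0. Qed.

Variables (H Z : {group gal_of {:L}}) (chi : gal_of {:L} -> nat).
Hypothesis chiM : {in H &, forall g h, chi (g * h)%g = chi g + chi h %[mod p]}.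
Hypothesis chiZ : forall g, g \in Z -> chi g = 0 %[mod p].
Hypothesis ZH : Z \subset H.
Hypothesis HK : H \subset 'Gal({:L} / 1)%g.

Variables (I : finType) (X : {set I}) (rp : I -> gal_of {:L})
  (act : gal_of {:L} -> I -> I).
Hypothesis rpH : forall i, i \in X -> rp i \in H.
Hypothesis actX : forall h i, h \in H -> i \in X -> act h i \in X.
Hypothesis actI : forall h, h \in H -> {in X &, injective (act h)}.
Hypothesis actP : forall h i, h \in H -> i \in X ->
  exists2 t, t \in Z & (rp (act h i) = t * rp i * h)%g.

Variables (w : L) (wZ : forall s, s \in Z -> s w = w).

Definition rtrace := \sum_(i in X) rp i w.
Definition rcoef (g : gal_of {:L}) := qnat zL (chi g^-1%g).
(** By [resolventE], 1 + lam y is the Lagrange resolvent of chi divided by the trace; for lam = 0, y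
    is the solution of additive Hilbert 90. The index set represents cosets of Z: all of H with Z =
    1 to produce a root of f(y) = a, and the cosets of a stabilizer to prove uniqueness of
    valuations. *)
Definition resolvent := \sum_(i in X) rcoef (rp i) * rp i w / rtrace.

Let galz h : h \in H -> h zL = zL.
Proof. by move=> hH; apply: (fixed_gal (sub1v _) (subsetP HK _ hH)); rewrite rpredZ // mem1v. Qed.

Let galq h n : h \in H -> h (qnat zL n) = qnat zL n.
Proof. by move=> hH; rewrite qnat_rmorph /= galz. Qed.

Let rp_act h i : h \in H -> i \in X -> h (rp i w) = rp (act h i) w.
Proof.
move=> hH iX; have [t tZ ->] := actP hH iX.
by rewrite !galM ?memvf // (wZ tZ).
Qed.

Let reindex_act (F : I -> L) h : h \in H -> \sum_(i in X) F (act h i) = \sum_(i in X) F i.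
Proof.
move=> hH; have XE : act h @: X = X.
  apply/eqP; rewrite eqEcard card_in_imset ?leqnn ?andbT; last exact: actI.
  by apply/subsetP => _ /imsetP[i iX ->]; apply: actX.
by rewrite -[in RHS]XE big_imset //=; apply: actI.
Qed.

Lemma rtrace_gal h : h \in H -> h rtrace = rtrace.
Proof.
move=> hH; rewrite /rtrace rmorph_sum /= -[RHS](reindex_act _ hH).
by apply: eq_bigr => i iX; apply: rp_act.
Qed.

Lemma rcoef_act h i : h \in H -> i \in X ->
  rcoef (rp i) = tmul lam (rcoef (rp (act h i))) (qnat zL (chi h)).
Proof.
move=> hH iX; rewrite /rcoef -qnat_tmul; apply: (qnat_mod zLP).
have [t tZ e] := actP hH iX.
rewrite e !invMg.
have tH := subsetP ZH _ tZ; have iH := rpH iX.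
have e1 : chi (rp i)^-1%g = chi (h * (h^-1 * ((rp i)^-1 * t^-1)) * t)%g.
  by rewrite !mulgA mulgV mul1g mulgKV.
rewrite e1 chiM ?groupM ?groupV // -modnDm (chiZ tZ) mod0n addn0 modn_mod.
by rewrite chiM ?groupM ?groupV // addnC.
Qed.

Lemma resolvent_gal h : h \in H -> rtrace != 0 ->
  h resolvent = tmul lam resolvent (qnat zL (chi h)).
Proof.
move=> hH T0; rewrite /resolvent rmorph_sum /=.
rewrite -[in RHS](reindex_act _ hH) /tmul.
set q := qnat zL (chi h).
have -> : \sum_(i in X) rcoef (rp (act h i)) * rp (act h i) w / rtrace + q +
    lam * (\sum_(i in X) rcoef (rp (act h i)) * rp (act h i) w / rtrace) * q =
   \sum_(i in X) (rcoef (rp (act h i)) * rp (act h i) w / rtrace + q * (rp (act h i) w / rtrace)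
     + lam * (rcoef (rp (act h i)) * rp (act h i) w / rtrace) * q).
  (* The normalized terms sum to 1, which distributes the constant q over the sum. *)
  have reE : \sum_(i in X) rp (act h i) w / rtrace = 1.
    by rewrite (reindex_act (fun i => rp i w / rtrace) hH) -mulr_suml divff.
  rewrite !big_split /= -[X in _ = _ + X + _]mulr_sumr reE mulr1.
  by congr (_ + _); apply: mulr_sumlr.
apply: eq_bigr => i iX.
rewrite (rcoef_act hH iX) -/q fmorph_div rmorphM /= rtrace_gal // rp_act // -/q.
rewrite /tmul !rmorphD !rmorphM rmorphB rmorph1 /= galz // /q galq // /rcoef galq //.
by ring.
Qed.

Lemma resolvent_kas h : h \in H -> rtrace != 0 -> h (kas p zL resolvent) = kas p zL resolvent.
Proof.
move=> hH T0; rewrite kas_rmorph /= galz // resolvent_gal // kas_tmul //.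
suff -> : kas p zL (qnat zL (chi h)) = 0 by rewrite tmul0.
by rewrite -(qnat_mod zLP (modn_mod _ p)) kas_qnat // ltn_mod prime_gt0.
Qed.

Lemma resolvent_moved h : h \in H -> rtrace != 0 -> 1 + lam * resolvent != 0 ->
  (chi h != 0 %[mod p])%N -> h resolvent != resolvent.
Proof.
move=> hH T0 y0 h0; rewrite resolvent_gal // -subr_eq0.
have -> : tmul lam resolvent (qnat zL (chi h)) - resolvent =
  (1 + lam * resolvent) * qnat zL (chi h) by rewrite /tmul; ring.
rewrite mulf_neq0 // -(qnat_mod zLP (modn_mod _ p)).
apply: (qnat_neq0 p_prime zLP); move: h0; rewrite mod0n lt0n => -> /=.
by rewrite ltn_mod prime_gt0.
Qed.

Lemma resolventE : rtrace != 0 ->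
  1 + lam * resolvent = (\sum_(i in X) zL ^+ chi (rp i)^-1%g * rp i w) / rtrace.
Proof.
move=> T0; rewrite -{1}(divff T0) {1}/rtrace /resolvent !mulr_suml mulr_sumr -big_split /=.
apply: eq_bigr => i _; rewrite /rcoef -(subrK 1 (zL ^+ _)) -qnatE; ring.
Qed.

End Resolvent.

Section ResolventExists.
Variables (p : nat) (p_prime : prime p) (K : fieldType) (L : splittingFieldType K).
Variables (z : K) (zP : qnat z p = 0).
Let zL := in_alg L z.
Local Notation lam := (zL - 1).
Let zLP : qnat zL p = 0. Proof. by rewrite -qnat_rmorph zP rmorph0. Qed.
Variable H : {group gal_of {:L}}.
Hypotheses (HK : (H \subset 'Gal({:L} / 1))%g) (pH : (p.-group H)%g) (H1 : (H != 1 :> {set _})%g).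

(** Automorphisms are independent, so each sum is nonzero at some w; if neither of these two
    elements serves both sums, their sum does. *)
Lemma trace_twist (c : gal_of {:L} -> L) : (forall g, c g != 0) ->
  exists w, \sum_(g in H) g w != 0 /\ \sum_(g in H) c g * g w != 0.
Proof.
move=> c0.
have nz (d : gal_of {:L} -> L) : (forall g, d g != 0) -> exists w, \sum_(g in H) d g * g w != 0.
  move=> d0; apply: contrapT => /forallNP h.
  have := @gal_independent _ L {:L}%AS (mem H) d _ 1%g.
  have hh a : a \in {:L}%AS -> \sum_(x | (mem H) x) d x * x a = 0.
    by move=> _; apply/eqP/negPn/negP; apply: h.
  by move=> /(_ hh (group1 H)) /eqP; rewrite (negPf (d0 _)).
have [w1 w1P] := nz (fun=> 1) (fun=> oner_neq0 L).
have {w1P} w1P : \sum_(g in H) g w1 != 0.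
  by move: w1P; under eq_bigr do rewrite mul1r.
have [w2 w2P] := nz c c0.
have [w10|w10] := eqVneq (\sum_(g in H) c g * g w1) 0; last by exists w1.
have [w20|w20] := eqVneq (\sum_(g in H) g w2) 0; last by exists w2.
exists (w1 + w2); split.
  under eq_bigr do rewrite rmorphD.
  by rewrite big_split /= w20 addr0.
under eq_bigr do rewrite rmorphD mulrDr.
by rewrite big_split /= w10 add0r.
Qed.

(** All that is used of Kummer and Artin-Schreier theory: a nontrivial p-group moves some root of an
    equation f(y) = a with a fixed. *)
Lemma resolvent_exists : exists y : L,
  [/\ forall h, h \in H -> h (kas p zL y) = kas p zL y, 1 + lam * y != 0 &
      exists2 h, h \in H & h y != y].
Proof.
have ZH : ((1%G : {group gal_of {:L}}) \proper H)%g by rewrite properEneq eq_sym H1 sub1G.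
have [chi [chiM chiZ [s sH s0]]] := p_character p_prime pH ZH.
have z0 : zL != 0 := zeta_neq0 p_prime zLP.
have [w [T0 S0]] := trace_twist (fun g => expf_neq0 (chi g^-1%g) z0).
pose act (h g : gal_of {:L}) := (g * h)%g.
have rpH g : g \in H -> g \in H by [].
have actX h g : h \in H -> g \in H -> act h g \in H by move=> hH gH; apply: groupM.
have actI h : h \in H -> {in H &, injective (act h)} by move=> _ a b _ _ /mulIg.
have actP h i : h \in H -> i \in H -> exists2 t, t \in (1%G : {group gal_of {:L}}) & act h i = (t * i * h)%g.
  by move=> hH iH; exists 1%g; [apply: group1|rewrite mul1g].
have wZ t : t \in (1%G : {group gal_of {:L}}) -> t w = w by move/set1gP=> ->; rewrite gal_id.
have y0 : 1 + lam * resolvent z chi H id w != 0.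
  by rewrite resolventE // mulf_neq0 ?invr_eq0.
exists (resolvent z chi H id w); split=> //.
- move=> h hH; apply: (resolvent_kas p_prime zP chiM chiZ _ HK rpH actX actI actP wZ hH T0).
  exact: sub1G.
- exists s => //; apply: (resolvent_moved p_prime zP chiM chiZ _ HK rpH actX actI actP wZ sH T0 y0 s0).
  exact: sub1G.
Qed.

End ResolventExists.

Lemma galois_scalar (K : fieldType) (L : splittingFieldType K) (u : L) :
  galois 1 {:L} -> (forall h, h \in 'Gal({:L} / 1)%g -> h u = u) -> exists a, u = a%:A.
Proof.
move=> galL h; have : u \in fixedField 'Gal({:L} / 1)%g by apply/fixedFieldP; rewrite ?memvf.
by rewrite (elimT galois_fixedField galL) => /vlineP[a ->]; exists a.
Qed.

Lemma galois_pgroup (p : nat) (K : fieldType) (L : splittingFieldType K) n :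
  prime p -> galois 1 {:L} -> \dim {:L} = (p ^ n)%N -> (p.-group 'Gal({:L} / 1))%g.
Proof.
move=> pp galL dimL; rewrite /pgroup; have := galois_dim galL.
by rewrite dimv1 divn1 dimL => <-; rewrite pnatX pnat_id.
Qed.

(** By [kas_inj], c is a translate of y by some [i], and [i] is fixed. In use y is a resolvent moved
    by h and c a solution in the base field, a contradiction. *)
Lemma kas_fixed (p : nat) (E : fieldType) (z y c : E) (h : {rmorphism E -> E}) :
  prime p -> qnat z p = 0 -> h z = z -> 1 + (z - 1) * y != 0 ->
  kas p z y = kas p z c -> h c = c -> h y = y.
Proof.
move=> pp zP hz y0 e hc; have [i ip ci] := kas_inj pp zP y0 e.
move: hc; rewrite ci /tmul !rmorphD !rmorphM rmorphB rmorph1 /= qnat_rmorph hz => e2.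
have zi : 1 + (z - 1) * qnat z i != 0.
  by rewrite qnatE addrC subrK expf_neq0 // (zeta_neq0 pp zP).
apply/eqP; rewrite -subr_eq0; apply/eqP/(mulIf zi); rewrite mul0r.
have -> : (h y - y) * (1 + (z - 1) * qnat z i) =
    (h y + qnat z i + (z - 1) * h y * qnat z i) -
    (y + qnat z i + (z - 1) * y * qnat z i) by ring.
by rewrite e2 subrr.
Qed.

Section PClosed.
Variables (p : nat) (p_prime : prime p) (K : fieldType) (z : K) (zP : qnat z p = 0).
Local Notation C := (alg_closure K).
Local Notation io := (closure_emb C).

Lemma kas_root (a : C) : exists y : C, kas p (io z) y = a.
Proof.
have : size (kaspoly p (io z) - a%:P) != 1%N.
  rewrite size_polyDl size_kaspoly ?eqSS -?lt0n ?prime_gt0 //.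
  by rewrite size_polyN (leq_ltn_trans (size_polyC_leq1 _)) // ltnS prime_gt0.
case/closed_rootP => y; rewrite /root hornerD hornerN hornerC horner_kaspoly subr_eq0.
by move/eqP; exists y.
Qed.

Lemma p_ext_root (a : p_extension p K) :
  exists y : p_extension p K, kas p (p_extension_emb p z) y = a.
Proof.
have [y yE] := kas_root (val a).
have yin : in_p_extension p y.
  by apply: (in_p_extension_kas p_prime zP); rewrite yE; apply/asboolP; apply: (valP a).
have yP : y \in @p_extension_pred p K by apply/asboolP.
exists (Sub y yP); apply: val_inj.
have -> : val (kas p (p_extension_emb p z) (Sub y yP)) = kas p (io z) y.
  by rewrite (kas_rmorph p (val : {rmorphism p_extension p K -> C})) /=.
exact: yE.
Qed.

(** If S is everything, a resolvent y of a nontrivial Galois p-group has f(y) in K, hence f(y) =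
    f(b) with b in K, and [kas_fixed] shows that y is not moved. *)
Lemma p_closedP : p_closed p K <-> forall a : K, inS p z a.
Proof.
split=> [pc a|surj y].
  have [y yE] := p_ext_root (p_extension_emb p a).
  have [b bE] := pc y; exists b; apply: (fmorph_inj (@p_extension_emb p K)).
  by rewrite kas_rmorph /= bE.
have yP : in_p_extension p (val y) by apply/asboolP; apply: (valP y).
have [L [j [n [jP galL dimL [u uE]]]]] := in_galois_p p_prime yP.
suff [a ua] : exists a, u = a%:A by exists a; apply: val_inj; rewrite /= -uE ua jP.
have [G1|G1] := eqVneq ('Gal({:L} / 1)%g : {set _}) 1%g.
  by apply: galois_scalar => // h; rewrite G1 => /set1gP ->; rewrite gal_id.
have pG := galois_pgroup p_prime galL dimL.
have [y' [fix1 y'0 [h hG hy]]] := resolvent_exists p_prime zP (subxx _) pG G1.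
have [a aE] := galois_scalar galL fix1.
have [b bE] := surj a; set zL := in_alg L z in y'0 aE.
have zLP : qnat zL p = 0 by rewrite -qnat_rmorph zP rmorph0.
have e : kas p zL y' = kas p zL (in_alg L b) by rewrite aE -kas_rmorph bE.
have hfix c : h (in_alg L c) = in_alg L c.
  by apply: (fixed_gal (sub1v _) hG); rewrite rpredZ // mem1v.
case/eqP: hy; exact: (kas_fixed p_prime zLP (hfix z) y'0 e (hfix b)).
Qed.

End PClosed.

(** * An elementary characterization of Euclidean fields *)

Record eucl (F : fieldType) : Prop := Eucl {
  eucl2 : 2%:R != 0 :> F;
  euclN1 : forall x : F, x ^+ 2 <> -1;
  euclT : forall x : F, exists y, x = y ^+ 2 \/ x = - y ^+ 2;
  euclD : forall x y : F, exists w, x ^+ 2 + y ^+ 2 = w ^+ 2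
}.

Section Kas2.
Variable R : comNzRingType.
(** For p = 2, z = -1 serves in every characteristic, with lambda = -2, f(y) = y^2 - y and 1 + 4
    f(y) = (1 - 2 y)^2. *)
Lemma qnat_N1_2 : qnat (-1 : R) 2 = 0.
Proof. by rewrite /qnat !big_ord_recl big_ord0 /= expr0 expr1 addr0 subrr. Qed.
Lemma kas_N1_2 (y : R) : kas 2 (-1) y = y ^+ 2 - y.
Proof.
rewrite /kas !big_ord_recl big_ord0 /= qnat0 qnat1; ring.
Qed.
End Kas2.

Section Dim2.
Variables (F E : fieldType) (i : {rmorphism F -> E}).
Hypothesis dim2 : extension_degree i 2.

(** Cramer's rule in the basis b: the determinant of the coordinates of 1 and r vanishes only if r
    comes from F. *)
Lemma degree2_decomp r : (forall a, i a != r) -> forall y, exists u w, y = i u + i w * r.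
Proof.
move=> rF y; have [b bP] := dim2.
have sumE (c : 'rV[F]_2) : \sum_(k < 2) i (c 0 k) * b k = i (c 0 0) * b 0 + i (c 0 1) * b 1.
  by rewrite !big_ord_recl big_ord0 addr0; congr (_ + i (c _ _) * b _); apply: val_inj.
have [c1 [+ _]] := bP 1; have [cr [+ _]] := bP r; have [cy [+ _]] := bP y.
rewrite !sumE.
set y0 := cy 0 0; set y1 := cy 0 1; set r0 := cr 0 0; set r1 := cr 0 1.
set a0 := c1 0 0; set a1 := c1 0 1 => Ey Er E1.
have D0 : a0 * r1 - a1 * r0 != 0.
  apply/eqP => D0.
  have [a00|a00] := eqVneq a0 0; last first.
    case/eqP: (rF (r0 / a0)); rewrite -[LHS]mulr1 {1}E1 Er.
    have e : r1 = r0 / a0 * a1.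
      by apply: (mulfI a00); rewrite mulrA mulrCA divff // mulr1; apply/eqP; rewrite -subr_eq0 -D0 (mulrC a1).
    have e0 : i r0 = i (r0 / a0) * i a0 by rewrite -rmorphM divfK.
    rewrite e [i (_ * a1)]rmorphM [in RHS]e0; ring.
  have a10 : a1 != 0.
    by apply: contraTneq (oner_neq0 E) => a10; rewrite E1 a00 a10 rmorph0 !mul0r addr0 eqxx.
  case/eqP: (rF (r1 / a1)); rewrite -[LHS]mulr1 {1}E1 Er a00 rmorph0 mul0r add0r.
  have r00 : r0 = 0.
    by apply/eqP; move/eqP: D0; rewrite a00 mul0r sub0r oppr_eq0 mulf_eq0 (negPf a10).
  by rewrite r00 rmorph0 mul0r add0r mulrA -rmorphM divfK.
exists ((y0 * r1 - y1 * r0) / (a0 * r1 - a1 * r0)), ((a0 * y1 - a1 * y0) / (a0 * r1 - a1 * r0)).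
have iD0 : i (a0 * r1 - a1 * r0) != 0 by rewrite fmorph_eq0.
apply: (mulIf iD0).
set N1 := y0 * r1 - y1 * r0; set N2 := a0 * y1 - a1 * y0.
have h c : i (c / (a0 * r1 - a1 * r0)) * i (a0 * r1 - a1 * r0) = i c.
  by rewrite -rmorphM divfK.
rewrite mulrDl h mulrAC h.
have -> : i N1 + i N2 * r =
    i N1 * (i a0 * b 0 + i a1 * b 1) + i N2 * (i r0 * b 0 + i r1 * b 1).
  by rewrite -E1 -Er mulr1.
by rewrite Ey /N1 /N2 !rmorphB !rmorphM; ring.
Qed.

Lemma degree2_proper : exists y, forall a, i a != y.
Proof.
apply: contrapT => /forallNP h; have [b bP] := dim2.
have im y : exists a, i a = y.
  by have /existsNP[a /negP/negPn/eqP] := h y; exists a.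
have [[b0 e0] [b1 e1]] := (im (b 0), im (b 1)).
have sumE (c : 'rV[F]_2) : \sum_(k < 2) i (c 0 k) * b k = i (c 0 0) * b 0 + i (c 0 1) * b 1.
  by rewrite !big_ord_recl big_ord0 addr0; congr (_ + i (c _ _) * b _); apply: val_inj.
have [c [_ uniq_c]] := bP 0.
pose v : 'rV[F]_2 := \row_k (if k == 0 then b1 else - b0).
have cv : c = v.
  by apply: uniq_c; rewrite sumE -e0 -e1 -!rmorphM -rmorphD !mxE /= mulNr mulrC subrr rmorph0.
have c0 : c = 0.
  by apply: uniq_c; rewrite sumE !mxE rmorph0 !mul0r addr0.
have b10 : b1 = 0 by have := congr1 (fun m : 'rV[F]_2 => m 0 0) cv; rewrite c0 !mxE.
have b00 : b0 = 0.
  have := congr1 (fun m : 'rV[F]_2 => m 0 1) cv; rewrite c0 !mxE /= => /esym/eqP.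
  by rewrite oppr_eq0 => /eqP.
have [c1 [+ _]] := bP 1; rewrite sumE -e0 -e1 b00 b10 !rmorph0 !mulr0 addr0 => /eqP.
by rewrite oner_eq0.
Qed.

End Dim2.

Section Euclidean.
Variable F : fieldType.
Local Notation E := (p_extension 2 F).
Local Notation i := (@p_extension_emb 2 F).
Let p2 : prime 2 := isT.
Let zP : qnat (-1 : F) 2 = 0 := qnat_N1_2 F.

Let rootE (e : E) : exists y, y ^+ 2 - y = e.
Proof. by have [y <-] := p_ext_root p2 zP e; exists y; rewrite rmorphN1 kas_N1_2. Qed.

Let sqrtE (e : E) : 2%:R != 0 :> F -> exists v, v ^+ 2 = e.
Proof.
move=> n2; have n2E : 2%:R != 0 :> E by rewrite -(rmorph_nat i) fmorph_eq0.
have [y yE] := rootE ((e - 1) / 4%:R); exists (1 - 2%:R * y).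
have -> : (1 - 2%:R * y) ^+ 2 = 1 + 4%:R * (y ^+ 2 - y) by ring.
rewrite yE [4%:R * _]mulrC divfK; first by rewrite addrC subrK.
by rewrite (_ : 4%:R = 2%:R * 2%:R) ?mulf_neq0 // -natrM.
Qed.

(** F(2) contains all roots of y^2 - y = e, hence square roots once 2 is nonzero; the axioms result
    from comparing coordinates of such roots over F. *)
Lemma euclidean_eucl : euclidean F -> eucl F.
Proof.
move=> dim2; have dec := degree2_decomp dim2.
have indep r u w u' w' : (forall a, i a != r) -> i u + i w * r = i u' + i w' * r -> u = u' /\ w = w'.
  move=> rF e; suff ww : w = w'.
    by split=> //; move: e; rewrite ww => /addIr/fmorph_inj.
  apply/eqP; apply: contraT => ww; case/eqP: (rF ((u' - u) / (w - w'))).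
  have d0 : i (w - w') != 0 by rewrite fmorph_eq0 subr_eq0.
  apply: (mulIf d0); rewrite -rmorphM divfK ?subr_eq0 // mulrC !rmorphB mulrBl.
  by apply/eqP; rewrite subr_eq addrAC eq_sym subr_eq addrC -e addrC.
have [a aS] : exists a : F, ~ inS 2 (-1) a.
  apply/existsNP => surj; have [y yF] := degree2_proper dim2.
  have [b bE] := (p_closedP p2 zP).2 surj y.
  by have := yF b; rewrite /= bE eqxx.
have [y0 y0E] := rootE (i a).
have y0F b : i b != y0.
  apply/eqP => b0; apply: aS; exists b; rewrite kas_N1_2.
  by apply: (fmorph_inj i); rewrite rmorphB rmorphXn /= b0.
have n2 : 2%:R != 0 :> F.
  (* In characteristic 2, the coefficient of y0 in v^2 - v = a y0 yields a root of w^2 - w = a in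
     F. *)
  apply/eqP => two0; have twoE : 2%:R = 0 :> E by rewrite -(rmorph_nat i) two0 rmorph0.
  have [v vE] := rootE (i a * y0); have [u [w vuw]] := dec _ y0F v.
  have y2 : y0 ^+ 2 = y0 + i a by rewrite -y0E addrC subrK.
  have e : i (u ^+ 2 + w ^+ 2 * a - u) + i (w ^+ 2 - w) * y0 = i 0 + i a * y0.
    rewrite rmorph0 add0r -vE vuw !rmorphB !rmorphD !rmorphM ?rmorphXn /=.
    have -> : (i u + i w * y0) ^+ 2 - (i u + i w * y0) =
      i u ^+ 2 + i w ^+ 2 * y0 ^+ 2 + 2%:R * (i u * i w * y0) - i u - i w * y0 by ring.
    by rewrite y2 twoE; ring.
  have [_ wa] := indep _ _ _ _ _ y0F e.
  by apply: aS; exists w; rewrite kas_N1_2.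
have n2E : 2%:R != 0 :> E by rewrite -(rmorph_nat i) fmorph_eq0.
pose rho := 1 - 2%:R * y0.
have [d dD] : exists d, d = 1 + 4%:R * a by exists (1 + 4%:R * a).
have rho2 : rho ^+ 2 = i d.
  rewrite dD rmorphD rmorphM rmorph1 rmorph_nat /= -y0E /rho; ring.
have rhoF b : i b != rho.
  apply/eqP => b0; case/eqP: (y0F ((1 - b) / 2%:R)).
  apply: (mulIf n2E); rewrite rmorphM fmorphV rmorph_nat divfK // rmorphB rmorph1 /= b0 /rho; ring.
(* The coordinates of v^2 = rho give d = -(u/w)^2. As d is not a square in F, neither is -1, and a
   root of -1 can replace rho. *)
have [v v2] := sqrtE rho n2; have [u [w vuw]] := dec _ rhoF v.
have [uw0 uw1] : u ^+ 2 + w ^+ 2 * d = 0 /\ 2%:R * (u * w) = 1.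
  apply: (indep _ _ _ _ _ rhoF); rewrite rmorph0 add0r rmorph1 mul1r -[RHS]v2 vuw.
  rewrite rmorphD !rmorphM ?rmorphXn /= -rho2 rmorph_nat; ring.
have w0 : w != 0.
  by apply: contraTneq (oner_neq0 F) => w0; rewrite -uw1 w0 !mulr0 eqxx.
have dE : d = - (u / w) ^+ 2.
  apply/eqP; rewrite -subr_eq0 opprK; apply/eqP/(mulIf (expf_neq0 2 w0)).
  rewrite mul0r -{}uw0; by field.
have sq_rho s : s ^+ 2 <> d.
  move=> s2; have : (rho - i s) * (rho + i s) = 0.
    by rewrite -subr_sqr rho2 -rmorphXn s2 subrr.
  move/eqP; rewrite mulf_eq0 subr_eq0 addr_eq0 => /orP[/eqP e|/eqP e].
    by have := rhoF s; rewrite e eqxx.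
  by have := rhoF (- s); rewrite e rmorphN eqxx.
have N1 (x : F) : x ^+ 2 <> -1.
  by move=> x2; apply: (sq_rho (x * (u / w))); rewrite exprMn x2 mulN1r dE.
have [im im2] := sqrtE (-1) n2.
have imF b : i b != im.
  by apply/eqP => b0; apply: (N1 b); apply: (fmorph_inj i); rewrite rmorphXn /= b0 im2 rmorphN1.
have sqim a1 a2 : (i a1 + i a2 * im) ^+ 2 =
    i a1 ^+ 2 + i a2 ^+ 2 * im ^+ 2 + 2%:R * (i a1 * i a2) * im by ring.
split=> //.
- move=> x; have [s s2] := sqrtE (i x) n2; have [c [k scd]] := dec _ imF s.
  have [e1 e2] : c ^+ 2 - k ^+ 2 = x /\ 2%:R * (c * k) = 0.
    apply: (indep _ _ _ _ _ imF); rewrite rmorph0 mul0r addr0 -[RHS]s2 scd.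
    rewrite sqim im2 rmorphB !rmorphM ?rmorphXn /= rmorph_nat; ring.
  move/eqP: e2; rewrite !mulf_eq0 (negPf n2) /= => /orP[]/eqP e0.
    by exists k; right; rewrite -e1 e0 expr0n sub0r.
  by exists c; left; rewrite -e1 e0 expr0n subr0.
- move=> x y; have [s s2] := sqrtE (i x + i y * im) n2; have [c [k scd]] := dec _ imF s.
  have [e1 e2] : c ^+ 2 - k ^+ 2 = x /\ 2%:R * (c * k) = y.
    apply: (indep _ _ _ _ _ imF); rewrite -[RHS]s2 scd.
    rewrite sqim im2 rmorphB !rmorphM ?rmorphXn /= rmorph_nat; ring.
  by exists (c ^+ 2 + k ^+ 2); rewrite -e1 -e2; ring.
Qed.

Section Converse.
Hypothesis eF : eucl F.
Local Notation C := (alg_closure F).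
Local Notation io := (closure_emb C).

Let n2 : 2%:R != 0 :> F := eucl2 eF.

Let n4 : 4%:R != 0 :> F.
Proof. by rewrite (_ : 4%:R = 2%:R * 2%:R) ?mulf_neq0 // -natrM. Qed.

(** The formula for the square root of x + i y, with w the absolute value up to sign. One of (x +
    w)/2 and (x - w)/2 is a square: if both were negatives of squares, their product -(y/2)^2 would
    be a square, and so would -1. *)
Lemma eucl_sqrt_complex (x y : F) :
  exists r s, r ^+ 2 - s ^+ 2 = x /\ 2%:R * (r * s) = y.
Proof.
have [y0|y0] := eqVneq y 0.
  have [c [xc|xc]] := euclT eF x; rewrite y0.
    by exists c, 0; rewrite expr0n subr0 !mulr0.
  by exists 0, c; rewrite expr0n sub0r mul0r mulr0.
have [w wE] := euclD eF x y.
have key w' : x ^+ 2 + y ^+ 2 = w' ^+ 2 -> (exists r, (x + w') / 2%:R = r ^+ 2) ->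
    exists r s, r ^+ 2 - s ^+ 2 = x /\ 2%:R * (r * s) = y.
  move=> w'E [r rE].
  have prod : (x + w') / 2%:R * ((w' - x) / 2%:R) = (y / 2%:R) ^+ 2.
    have -> : (x + w') / 2%:R * ((w' - x) / 2%:R) = (w' ^+ 2 - x ^+ 2) / 2%:R ^+ 2 by field; rewrite ?n4 ?n2.
    by rewrite -w'E expr_div_n; congr (_ / _); ring.
  have r0 : r != 0.
    apply: contraTneq y0 => r0; move: prod; rewrite rE r0 expr0n mul0r => /esym/eqP.
    by rewrite expf_eq0 /= mulf_eq0 invr_eq0 (negPf n2) orbF negbK.
  exists r, (y / 2%:R / r); split; last by field; rewrite ?r0 ?n4 ?n2.
  have -> : (y / 2%:R / r) ^+ 2 = (w' - x) / 2%:R.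
    rewrite expr_div_n -prod rE mulrAC divff ?mul1r // expf_neq0 //.
  by rewrite -rE; field; rewrite ?n4 ?n2.
have [c [hc|hc]] := euclT eF ((x + w) / 2%:R); first by apply: (key w) => //; exists c.
apply: (key (- w)); first by rewrite sqrrN.
have [d [hd|hd]] := euclT eF ((x - w) / 2%:R); first by exists d.
case: (euclN1 eF (x := y / 2%:R / (c * d))).
have prod : (x + w) / 2%:R * ((x - w) / 2%:R) = - (y / 2%:R) ^+ 2.
  have -> : (x + w) / 2%:R * ((x - w) / 2%:R) = - ((w ^+ 2 - x ^+ 2) / 2%:R ^+ 2) by field; rewrite ?n4 ?n2.
  by rewrite -wE expr_div_n; congr (- (_ / _)); ring.
have cd0 : c * d != 0.
  apply: contraTneq y0 => cd0; move: prod; rewrite hc hd mulrNN -exprMn cd0 expr0n.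
  move/esym/eqP; rewrite oppr_eq0 expf_eq0 /= mulf_eq0 invr_eq0 (negPf n2) orbF.
  by rewrite negbK.
rewrite expr_div_n; apply: (mulIf (expf_neq0 2 cd0)); rewrite divfK ?expf_neq0 //.
apply: oppr_inj; rewrite -prod hc hd; ring.
Qed.

(** A resolvent over F produces a square root of -1. By [eucl_sqrt_complex] all elements of F(i) are
    squares, so there is no resolvent over F(i), and L = F(i). *)
Lemma galois_eucl (L : splittingFieldType F) n (u : L) :
  galois 1 {:L} -> \dim {:L} = (2 ^ n)%N ->
  (exists a, u = a%:A) \/ exists a b im, im ^+ 2 = -1 /\ u = a%:A + b%:A * im.
Proof.
move=> galL dimL.
have [G1|G1] := eqVneq ('Gal({:L} / 1)%g : {set _}) 1%g.
  by left; apply: galois_scalar => // h; rewrite G1 => /set1gP ->; rewrite gal_id.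
have pG := galois_pgroup p2 galL dimL; right.
pose io1 : {rmorphism F -> L} := in_alg L; have n2L : 2%:R != 0 :> L by rewrite -(rmorph_nat io1) fmorph_eq0.
have ioN1 : io1 (-1) = -1 by rewrite rmorphN1.
have ioP : qnat (-1 : L) 2 = 0 := qnat_N1_2 L.
have hfix h c : h \in 'Gal({:L} / 1)%g -> h (io1 c) = io1 c.
  by move=> hG; apply: (fixed_gal (sub1v _) hG); rewrite rpredZ // mem1v.
have kasL y : kas 2 (io1 (-1)) y = y ^+ 2 - y by rewrite ioN1 kas_N1_2.
have sqk (y : L) : (1 - 2%:R * y) ^+ 2 = 1 + 4%:R * (y ^+ 2 - y) by ring.
have [im im2] : exists im : L, im ^+ 2 = -1.
  have [y [fix1 y'0 [h hG hy]]] := resolvent_exists p2 zP (subxx _) pG G1.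
  have [a] := galois_scalar galL fix1; rewrite -/io1 kasL => aE.
  have dE : (1 - 2%:R * y) ^+ 2 = io1 (1 + 4%:R * a).
    by rewrite sqk aE rmorphD rmorphM rmorph1 rmorph_nat.
  have nsq s : 1 + 4%:R * a <> s ^+ 2.
    move=> s2; case/eqP: hy.
    have : (1 - 2%:R * y - io1 s) * (1 - 2%:R * y + io1 s) = 0.
      by rewrite -subr_sqr dE s2 rmorphXn subrr.
    have hE t : 1 - 2%:R * y = io1 t -> h y = y.
      move=> e; have -> : y = io1 ((1 - t) / 2%:R).
        apply: (mulIf n2L); rewrite fmorph_div rmorph_nat divfK // rmorphB rmorph1 -e; ring.
      exact: hfix.
    move/eqP; rewrite mulf_eq0 subr_eq0 addr_eq0 => /orP[/eqP|/eqP]; first exact: hE.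
    by rewrite -rmorphN; apply: hE.
  have [s [//|ds]] := euclT eF (1 + 4%:R * a); first by move/nsq.
  have s0 : s != 0 by apply/eqP => s0; apply: (nsq 0); rewrite ds s0 expr0n oppr0.
  exists ((1 - 2%:R * y) / io1 s); rewrite expr_div_n dE ds rmorphN rmorphXn mulNr divff //.
  by rewrite expf_neq0 // fmorph_eq0.
pose E1 := <<1; im>>%AS.
have formE v : v \in E1 -> exists a b, v = io1 a + io1 b * im.
  case/Fadjoin_polyP => q /polyOverP q1 ->; rewrite horner_coef.
  elim/big_ind: _ => [|_ _ [a [b ->]] [c [d ->]]|k _].
  - by exists 0, 0; rewrite rmorph0 mul0r addr0.
  - by exists (a + c), (b + d); rewrite !rmorphD; ring.
  have [c cE] := vlineP _ _ (q1 k).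
  have {cE}-> : q`_k = io1 c by rewrite cE.
  have [a [b ->]] : exists a b, im ^+ k = io1 a + io1 b * im.
    elim: (nat_of_ord k) => [|l [a [b IH]]]; first by exists 1, 0; rewrite rmorph1 rmorph0 mul0r addr0.
    exists (- b), a; rewrite exprS IH rmorphN.
    have -> : im * (io1 a + io1 b * im) = io1 a * im + io1 b * im ^+ 2 by ring.
    by rewrite im2; ring.
  by exists (c * a), (c * b); rewrite !rmorphM; ring.
have galE1 : galois E1 {:L}.
  by apply: (@galoisS _ _ 1%AS E1 {:L}%AS); rewrite ?sub1v ?subvf.
have [H1|H1] := eqVneq ('Gal({:L} / E1)%g : {set _}) 1%g.
  have : u \in E1.
    rewrite -(elimT galois_fixedField galE1); apply/fixedFieldP; rewrite ?memvf // => h.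
    by rewrite H1 => /set1gP ->; rewrite gal_id.
  by move/formE => [a [b ->]]; exists a, b, im.
have HG : ('Gal({:L} / E1) \subset 'Gal({:L} / 1))%g by apply: galS; apply: sub1v.
have [y [fix1 y0 [h hH hy]]] := resolvent_exists p2 zP HG (pgroupS HG pG) H1.
have : kas 2 (io1 (-1)) y \in E1.
  by rewrite -(elimT galois_fixedField galE1); apply/fixedFieldP; rewrite ?memvf.
move/formE => [a [b abE]].
have [r [s [rs1 rs2]]] := eucl_sqrt_complex (1 + 4%:R * a) (4%:R * b).
have sq : (io1 r + io1 s * im) ^+ 2 = 1 + 4%:R * (io1 a + io1 b * im).
  have -> : (io1 r + io1 s * im) ^+ 2 = io1 (r ^+ 2) + io1 (s ^+ 2) * im ^+ 2 + io1 (2%:R * (r * s)) * im.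
    by rewrite !rmorphM ?rmorphXn rmorph_nat; ring.
  rewrite im2 rs2 mulrN1 -rmorphB rs1 rmorphD !rmorphM rmorph1 !rmorph_nat; ring.
pose c := (1 - (io1 r + io1 s * im)) / 2%:R.
have c2 : 1 - 2%:R * c = io1 r + io1 s * im by rewrite /c mulrC divfK //; ring.
have n4L : 4%:R != 0 :> L by rewrite (_ : 4%:R = 2%:R * 2%:R) ?mulf_neq0 // -natrM.
have kc : kas 2 (io1 (-1)) c = kas 2 (io1 (-1)) y.
  rewrite abE kasL; apply: (mulfI n4L); apply: (addrI 1).
  by rewrite -sqk c2 sq.
have hG := subsetP HG _ hH.
have him : h im = im by apply: (fixed_gal (subvf E1) hH); apply: memv_adjoin.
have hc : h c = c.
  by rewrite /c fmorph_div rmorphB rmorph1 rmorphD rmorphM /= him !(hfix h) // rmorph_nat.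
case/eqP: hy; apply: (kas_fixed p2 _ (hfix _ _ hG) y0 (esym kc) hc).
by rewrite ioN1.
Qed.

Lemma eucl_euclidean : euclidean F.
Proof.
have [im im2] := sqrtE (-1) n2.
have imF b : i b <> im.
  move=> b0; apply: (euclN1 eF (x := b)); apply: (fmorph_inj i).
  by rewrite rmorphXn /= b0 im2 rmorphN1.
pose b (k : 'I_2) := if k == 0 then 1 else im.
have sumE (c : 'rV[F]_2) : \sum_(k < 2) i (c 0 k) * b k = i (c 0 0) + i (c 0 1) * im.
  rewrite !big_ord_recl big_ord0 addr0 /b /= mulr1; congr (_ + i (c _ _) * _).
  exact: val_inj.
have dec (y : E) : exists a c, y = i a + i c * im.
  have yP : in_p_extension 2 (val y) by apply/asboolP; apply: (valP y).
  have [L [j [n [jP galL dimL [u uE]]]]] := in_galois_p p2 yP.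
  have [[a ua]|[a [c [im' [im'2 ua]]]]] := galois_eucl u galL dimL.
    by exists a, 0; rewrite rmorph0 mul0r addr0; apply: val_inj; rewrite /= -uE ua jP.
  have : (j im' - val im) * (j im' + val im) = 0.
    rewrite -subr_sqr -rmorphXn im'2 rmorphN1.
    by rewrite -(rmorphXn (val : {rmorphism E -> C})) im2 rmorphN1 subrr.
  have vE c' : val (i a + i c' * im) = io a + io c' * val im by [].
  move/eqP; rewrite mulf_eq0 subr_eq0 addr_eq0 => /orP[/eqP e|/eqP e].
    by exists a, c; apply: val_inj; rewrite vE -uE ua rmorphD rmorphM !jP e.
  exists a, (- c); apply: val_inj; rewrite vE -uE ua rmorphD rmorphM !jP e rmorphN; ring.
exists b => y; have [a [c yE]] := dec y.
exists (\row_k (if k == 0 then a else c)); split; first by rewrite sumE !mxE.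
move=> d; rewrite sumE yE => e.
have dc : c = d 0 1.
  apply/eqP; apply: contraT => cd; case: (imF ((d 0 0 - a) / (c - d 0 1))).
  have d0 : i (c - d 0 1) != 0 by rewrite fmorph_eq0 subr_eq0.
  apply: (mulIf d0); rewrite -rmorphM divfK ?subr_eq0 // mulrC !rmorphB mulrBl.
  by apply/eqP; rewrite subr_eq addrAC eq_sym subr_eq addrC e addrC.
have ac : a = d 0 0 by move: e; rewrite dc => /addIr/fmorph_inj.
apply/rowP => k; rewrite mxE; case: eqVneq => [->|k0]; first exact: ac.
rewrite dc; congr (d 0 _); apply: val_inj; case: k k0 => [[|[|k]] lt] //.
Qed.

End Converse.

Lemma euclideanP : euclidean F <-> eucl F.
Proof. by split; [apply: euclidean_eucl|apply: eucl_euclidean]. Qed.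

End Euclidean.

(** * Henselian valuations *)

Section Approximation.
Variables (L : fieldType) (I : finType) (h0 : I) (R : I -> L -> Prop).
Hypothesis vR : forall h, valring (R h).

(* Engler-Prestel, Lemma 3.2.6: the exponent is 1 modulo the orders and the residue characteristics. *)
Lemma approx_unit (x : L) : exists s, s != 0 /\ forall h, R h s /\
  (R h x -> R h s^-1) /\ (~ R h x -> mxi (R h) s).
Proof.
have exc h : exists c, (0 < c)%N /\ ((exists2 k, (0 < k)%N & mxi (R h) (x ^+ k - 1)) ->
    mxi (R h) (x ^+ c - 1)).
  have [[k k0 xk]|nk] := pselect (exists2 k, (0 < k)%N & mxi (R h) (x ^+ k - 1)).
    by exists k.
  by exists 1%N.
have exd h : exists d, (0 < d)%N /\ ((exists2 k, (0 < k)%N & mxi (R h) k%:R) -> mxi (R h) d%:R).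
  have [[k k0 xk]|nk] := pselect (exists2 k, (0 < k)%N & mxi (R h) k%:R).
    by exists k.
  by exists 1%N.
pose c h := projT1 (cid (exc h)); pose d h := projT1 (cid (exd h)).
have cP h := projT2 (cid (exc h)); have dP h := projT2 (cid (exd h)).
pose M := (\prod_h (c h * d h))%N.
have M0 : (0 < M)%N.
  by apply: prodn_gt0 => h; rewrite muln_gt0 (cP h).1 (dP h).1.
have cM h : exists k, M = (c h * k)%N.
  by rewrite /M (bigD1 h) //= -mulnA; eexists.
have dM h : exists k, M = (d h * k)%N.
  by rewrite /M (bigD1 h) //= -mulnA mulnCA; eexists.
pose D := \sum_(i < M.+1) x ^+ i.
have DE : (x - 1) * D = x ^+ M.+1 - 1 by rewrite subrX1.
have DR h : R h x -> R h D /\ ~ mxi (R h) D.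
  move=> Rx; have vh := vR h; have RD : R h D by apply: vr_sum => // i _; apply: vrX.
  (* If D is in m, then x^(M+1) = 1 mod m. By the choice of [c], also x^M = 1, so x = 1 and D = M +
     1 mod m; by the choice of [d], M is in m as well, hence 1 is. *)
  split=> // mD; have mn : mxi (R h) (x ^+ M.+1 - 1).
    by rewrite -DE; apply: mxM => //; apply: (vrB vh) => //; apply: (vr1 vh).
  have mM : mxi (R h) (x ^+ M - 1).
    have [k ->] := cM h; rewrite exprM.
    have -> : (x ^+ c h) ^+ k - 1 = (x ^+ c h - 1) * \sum_(i < k) (x ^+ c h) ^+ i by rewrite subrX1.
    apply: mxMr => //; first by apply: vr_sum => // i _; apply: vrX => //; apply: vrX.
    by apply: (cP h).2; exists M.+1.
  have mx : mxi (R h) (x - 1).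
    have -> : x - 1 = (x ^+ M.+1 - 1) - x * (x ^+ M - 1) by rewrite exprS; ring.
    by apply: mxB => //; apply: mxM.
  have mnat : mxi (R h) M.+1%:R.
    have -> : M.+1%:R = D - \sum_(i < M.+1) (x ^+ i - 1).
      by rewrite sumrB sumr_const card_ord /D opprB addrC subrK.
    apply: mxB => //; apply: mx_sum => // i _; rewrite subrX1; apply: mxMr => //.
    by apply: vr_sum => // j _; apply: vrX.
  have mMn : mxi (R h) M%:R.
    have [k ->] := dM h; rewrite natrM; apply: mxMr => //; first exact: vr_nat.
    by apply: (dP h).2; exists M.+1.
  by apply: (mx1 vh); have := mxB vh mnat mMn; rewrite -natr1 addrAC subrr add0r.
have Dn h : ~ R h x -> mxi (R h) D^-1 /\ D != 0.
  move=> nx; have vh := vR h; have x0 := nvr_neq0 vh nx.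
  pose t := x^-1; have mt : mxi (R h) t by apply: nvr_mx.
  pose U := \sum_(i < M) t ^+ i.+1.
  have mU : mxi (R h) U by apply: mx_sum => // i _; apply: mxXn.
  have [U0 UV] := mx_1D vh mU.
  have DU : D = x ^+ M * (1 + U).
    rewrite /D (reindex_inj rev_ord_inj) /= big_ord_recl /= subn1 /= mulrDr mulr1; congr (_ + _).
    rewrite /U mulr_sumr; apply: eq_bigr => i _; rewrite /t exprVn.
    rewrite /bump /= add1n subSS; have iM : (i.+1 <= M)%N by [].
    by apply: (mulIf (expf_neq0 i.+1 x0)); rewrite divfK ?expf_neq0 // -exprD subnK.
  split; last by rewrite DU mulf_neq0 ?expf_neq0.
  by rewrite DU invfM mulrC; apply: mxM => //; rewrite -exprVn; apply: mxXn.
have D0 : D != 0.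
  have [Rx|nx] := pselect (R h0 x); last by have [] := Dn h0 nx.
  by have [_ /nmx_neq0] := DR h0 Rx.
exists D^-1; split; first by rewrite invr_eq0.
move=> h; have [Rx|nx] := pselect (R h x).
  have [RD nD] := DR h Rx; split; first exact: nmx_vr nD.
  by rewrite invrK; split.
have [mD _] := Dn h nx; split; [exact: mx_sub mD|by split].
Qed.

End Approximation.

Lemma gal_prod (K : fieldType) (L : splittingFieldType K) (h : gal_of {:L})
    (I : finType) (P : pred I) (F : I -> L) :
  h (\prod_(i | P i) F i) = \prod_(i | P i) h (F i).
Proof. by apply: (big_morph h); [move=> x y; apply: rmorphM|apply: rmorph1]. Qed.

(** * Uniqueness of extensions to Galois p-extensions when m is contained in S *)

Section Uniqueness.
Variables (p : nat) (p_prime : prime p) (K : fieldType) (z : K) (zP : qnat z p = 0).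
Variables (Ov : K -> Prop) (vOv : valring Ov).
Hypothesis hens : forall x, mxi Ov x -> inS p z x.
Variables (L : splittingFieldType K) (n : nat).
Hypotheses (galL : galois 1 {:L}) (dimL : \dim {:L} = (p ^ n)%N).
Local Notation G := ('Gal({:L} / 1)%g).
Let zL := in_alg L z.
Local Notation lam := (zL - 1).
Let zLP : qnat zL p = 0. Proof. by rewrite -qnat_rmorph zP rmorph0. Qed.

Definition lies_over (O : L -> Prop) := forall a : K, O a%:A <-> Ov a.

Lemma lies_over_mxi (O : L -> Prop) a : lies_over O -> mxi O a%:A <-> mxi Ov a.
Proof.
move=> ov; have e : (a%:A)^-1 = (a^-1)%:A :> L by rewrite -[RHS]/(in_alg L a^-1) fmorphV.
have e0 : a%:A = 0 :> L <-> a = 0.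
  split=> [/eqP|->]; last by rewrite scale0r.
  by rewrite -[a%:A]/(in_alg L a) fmorph_eq0 => /eqP.
by rewrite /mxi e e0 ov.
Qed.

Let G1 : (1 : gal_of {:L})%g \in G := group1 _.

Section Conj.
Variables (O : L -> Prop) (vO : valring O).

Lemma conj_valring (h : gal_of {:L}) : valring (fun u => O (h u)).
Proof.
split=> /=.
- by rewrite rmorph1; apply: (vr1 vO).
- by move=> x y Ox Oy; rewrite rmorphB; apply: (vrB vO).
- by move=> x y Ox Oy; rewrite rmorphM; apply: (vrM vO).
- by move=> x; rewrite fmorphV; apply: (vrV vO).
Qed.

Lemma mxi_conj (h : gal_of {:L}) u : mxi (fun u => O (h u)) u <-> mxi O (h u).
Proof.
rewrite /mxi fmorphV; split=> -[e|H]; [left|right|left|right] => //.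
- by rewrite e rmorph0.
- by apply/eqP; move/eqP: e; rewrite fmorph_eq0.
Qed.

Definition stab : {set gal_of {:L}} := [set g in G | `[< forall u, O u <-> O (g u) >]].

Lemma stabP g : reflect (g \in G /\ forall u, O u <-> O (g u)) (g \in stab).
Proof.
rewrite inE; apply: (iffP andP) => -[gG /asboolP H]; split=> //; exact/asboolP.
Qed.

Fact stab_group_set : group_set stab.
Proof.
apply/group_setP; split.
  by apply/stabP; split; [exact: group1|move=> u; rewrite gal_id].
move=> g h /stabP[gG gO] /stabP[hG hO]; apply/stabP; split; first exact: groupM.
by move=> u; rewrite galM ?memvf // -hO.
Qed.
Canonical stab_group := Group stab_group_set.

(** As g has finite order, an inclusion between conjugates of O is an equality. *)
Lemma stab_sub g : g \in G -> (forall u, O u -> O (g u)) -> g \in stab.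
Proof.
move=> gG H; apply/stabP; split=> // u; split; first exact: H.
have HX k v : O v -> O ((g ^+ k)%g v).
  by elim: k => [|k IH] Ov'; [rewrite gal_id|rewrite expgSr galM ?memvf //; apply/H/IH].
move=> /(HX #[g]%g.-1).
by rewrite -galM ?memvf // -expgS prednK ?order_gt0 // expg_order gal_id.
Qed.

Hypothesis ovO : lies_over O.

Lemma conj_lam g : g \in G -> g zL = zL.
Proof. by move=> gG; apply: (fixed_gal (sub1v _) gG); rewrite rpredZ // mem1v. Qed.

(** [approx_unit] separates O from one other conjugate; the product over all g outside of the
    stabilizer separates it from all of them at once. *)
Lemma conj_approx : exists e, [/\ forall h : gal_of {:L}, O (h e), O e^-1, e != 0 &
  forall g, g \in G -> g \notin stab -> mxi O (g e)].
Proof.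
have exs g : exists s : L, g \in G -> g \notin stab ->
    [/\ s != 0, forall h : gal_of {:L}, O (h s), O s^-1 & mxi O (g s)].
  have [gG|] := boolP (g \in G); last by exists 0.
  have [|gZ] := boolP (g \in stab); first by exists 0.
  have [x Ox nx] : exists2 x, O x & ~ O (g x).
    apply: contrapT => /forall2NP H; case/negP: gZ; apply: stab_sub => // u Ou.
    by have [//|/contrapT] := H u.
  have [s [s0 sP]] := approx_unit (1%g : gal_of {:L}) conj_valring x.
  exists s => _ _; split=> //.
  - by move=> h; have [] := sP h.
  - by have [_ [+ _]] := sP 1%g; rewrite !gal_id; apply.
  - by have [_ [_ +]] := sP g => /(_ nx)/mxi_conj.
pose s g := projT1 (cid (exs g)).
have sP g : g \in G -> g \notin stab ->
  [/\ s g != 0, forall h : gal_of {:L}, O (h (s g)), O (s g)^-1 & mxi O (g (s g))] := projT2 (cid (exs g)).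
pose P g := (g \in G) && (g \notin stab).
exists (\prod_(g | P g) s g); split.
- move=> h; rewrite gal_prod; apply: vr_prod => // g /andP[gG gZ].
  by have [_ + _ _] := sP g gG gZ; apply.
- rewrite -prodfV; apply: vr_prod => // g /andP[gG gZ].
  by have [_ _ + _] := sP g gG gZ.
- by apply/prodf_neq0 => g /andP[gG gZ]; have [+ _ _ _] := sP g gG gZ.
- move=> g gG gZ; rewrite gal_prod; apply: (@mx_prod _ _ vO _ _ g); first by rewrite /P gG.
    by have [_ _ _] := sP g gG gZ.
  by move=> h /andP[hG hZ]; have [_ + _ _] := sP h hG hZ; apply.
Qed.

(** If the stabilizer is proper, take a nonzero character trivial on it and the resolvent y over its
    cosets. As w is a unit for O and small for the other conjugates, the trace is a unit, and y is
    in the maximal ideal because the trivial coset has coefficient [0] = 0. So f(y) is in m, hence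
    in S, and [kas_fixed] contradicts that y is moved. *)
Lemma conj_invariant : stab = G.
Proof.
apply/eqP; apply: contraT => ZG.
have ZsG : stab \subset G by apply/subsetP => g /stabP[].
have ZpG : (stab_group \proper G)%g by rewrite properEneq ZG ZsG.
have pG := galois_pgroup p_prime galL dimL.
have [chi [chiM chiZ [s sG s0]]] := p_character p_prime pG ZpG.
have [e [eO eV e0 em]] := conj_approx.
(* Multiplying over the stabilizer makes w invariant under it and keeps both properties of e. *)
pose w := \prod_(h in stab) h e.
have wZ g : g \in stab_group -> g w = w.
  move=> gZ; rewrite /w gal_prod [RHS](reindex_inj (mulIg g)) /=.
  apply: eq_big => [h|h _]; first by rewrite (groupMr h gZ).
  by rewrite galM ?memvf.
have wm g : g \in G -> g \notin stab -> mxi O (g w).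
  move=> gG gZ; rewrite /w gal_prod; apply: (@mx_prod _ _ vO _ _ 1%g); first exact: (group1 stab_group).
    by rewrite gal_id; apply: em.
  by move=> h hZ; rewrite -galM ?memvf.
have wU : ~ mxi O w.
  rewrite /w; elim/big_ind: _ => [|x y|h hZ]; [exact: (mx1 vO)|exact: nmxM|].
  have [hG hO] := stabP _ hZ; apply: mx_unit => //; last by rewrite fmorph_eq0.
  by rewrite -fmorphV; apply: (hO _).1.
pose X := rcosets stab_group G.
pose act (h : gal_of {:L}) (C : {set gal_of {:L}}) := (C :* h)%g.
have XP C : C \in X -> exists2 g, g \in G & C = (stab_group :* g)%g by move/rcosetsP.
have rpC g : exists2 t, t \in stab_group & repr (stab_group :* g)%g = (t * g)%g.
  by apply/rcosetP; apply: mem_repr_rcoset.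
have rpH C : C \in X -> repr C \in G.
  by case/XP => g gG ->; have [t /(subsetP ZsG) tG ->] := rpC g; rewrite groupM.
have actX h C : h \in G -> C \in X -> act h C \in X.
  by move=> hG /XP[g gG ->]; rewrite /act -rcosetM; apply/rcosetsP; exists (g * h)%g; rewrite ?groupM.
have actI h : h \in G -> {in X &, injective (act h)}.
  move=> hG C1 C2 _ _ /(congr1 (fun C => C :* h^-1)%g).
  by rewrite /act -!rcosetM mulgV !rcoset1.
have actP h C : h \in G -> C \in X -> exists2 t, t \in stab_group & repr (act h C) = (t * repr C * h)%g.
  move=> hG /XP[g gG ->]; rewrite /act -rcosetM.
  have [t tZ ->] := rpC (g * h)%g; have [t' t'Z ->] := rpC g.
  exists (t * t'^-1)%g; first by rewrite groupM ?groupV.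
  by rewrite !mulgA mulgKV.
have XZ : (stab_group : {set _}) \in X by apply/rcosetsP; exists 1%g; rewrite ?rcoset1 ?group1.
have rZ : repr (stab_group : {set _}) \in stab_group by apply: mem_repr (group1 _).
have rm C : C \in X -> C != stab_group -> mxi O (repr C w).
  move=> CX CZ; have [g gG Cg] := XP C CX; apply: wm; first exact: rpH.
  apply: contraNN CZ => rC; have [t tZ e1] := rpC g.
  have gZ : g \in stab_group by rewrite -(groupMl g tZ) -e1 -Cg.
  by rewrite Cg rcoset_id.
have T1 : rtrace X repr w = w + \sum_(C in X | C != stab_group) repr C w.
  by rewrite /rtrace (bigD1 (stab_group : {set _})) //= wZ.
have TU : ~ mxi O (rtrace X repr w).
  rewrite T1 => mT; apply: wU.
  have mS : mxi O (\sum_(C in X | C != stab_group) repr C w).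
    by apply: mx_sum => // C /andP[CX CZ]; apply: rm.
  by have := mxB vO mT mS; rewrite addrK.
have T0 := nmx_neq0 TU.
pose y := resolvent z chi X repr w.
have Oz : O zL by apply/ovO; apply: contrapT => nz; apply: (mx1 vOv);
  rewrite -(expr1n K p) -(mulVf (zeta_neq0 p_prime zP)) exprMn (zetaX zP) mulr1; apply: mxXn => //;
  [exact: prime_gt0|exact: nvr_mx].
have Oq k : O (qnat zL k) by apply: vr_sum => // i _; apply: vrX.
have my : mxi O y.
  rewrite /y /resolvent (bigD1 (stab_group : {set _})) //=; apply: mxD => //.
    rewrite /rcoef (qnat_mod zLP (n := 0%N)); last by apply: chiZ; rewrite groupV.
    by rewrite qnat0 !mul0r; left.
  apply: mx_sum => // C /andP[CX CZ]; rewrite -mulrA; apply: mxM => //; first exact: Oq.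
  by apply: mxMr => //; [apply: nmx_vr TU|apply: rm].
have y0 : 1 + lam * y != 0.
  have [] // := mx_1D vO (_ : mxi O (lam * y)).
  by apply: mxM => //; apply: (vrB vO) => //; apply: (vr1 vO).
have fixk h : h \in G -> h (kas p zL y) = kas p zL y.
  by move=> hG; apply: (resolvent_kas p_prime zP chiM chiZ ZsG (subxx _) rpH actX actI actP wZ hG T0).
have mk : mxi O (kas p zL y).
  apply: (@mx_prod _ _ vO _ _ (Ordinal (prime_gt0 p_prime)) predT) => //=.
    by rewrite qnat0 subr0.
  by move=> i _; apply: (vrB vO) => //; apply: mx_sub my.
have [a aE] := galois_scalar galL fixk.
have [b bE] : inS p z a by apply: hens; rewrite -(lies_over_mxi a ovO) -aE.
have := resolvent_moved p_prime zP chiM chiZ ZsG (subxx _) rpH actX actI actP wZ sG T0 y0 s0.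
case/eqP; apply: (kas_fixed (c := in_alg L b) p_prime zLP (conj_lam sG) y0).
  by rewrite aE -kas_rmorph bE.
by apply: (fixed_gal (sub1v _) sG); rewrite rpredZ // mem1v.
Qed.

End Conj.

(** Both rings are invariant under the Galois group. If u is in O1 but not in O2, its norm to K is
    in O1 and the inverse of this norm is in the maximal ideal of O2. *)
Lemma lies_over_sub (O1 O2 : L -> Prop) : valring O1 -> valring O2 ->
  lies_over O1 -> lies_over O2 -> forall u, O1 u -> O2 u.
Proof.
move=> v1 v2 ov1 ov2 u O1u; apply: contrapT => n2.
have inv1 h : h \in G -> forall u, O1 u <-> O1 (h u).
  by rewrite -(conj_invariant v1 ov1) => /stabP[].
have inv2 h : h \in G -> forall u, O2 u <-> O2 (h u).
  by rewrite -(conj_invariant v2 ov2) => /stabP[].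
have u0 := nvr_neq0 v2 n2.
pose N := \prod_(h in G) h u.
have Nfix g : g \in G -> g N = N.
  move=> gG; rewrite /N gal_prod [RHS](reindex_inj (mulIg g)) /=.
  apply: eq_big => [h|h _]; first by rewrite (groupMr h gG).
  by rewrite galM ?memvf.
have [a aE] := galois_scalar galL Nfix.
have O1N : O1 N by apply: vr_prod => // h hG; apply: (inv1 h hG u).1.
have m2N : mxi O2 N^-1.
  rewrite /N -prodfV; apply: (@mx_prod _ _ v2 _ _ 1%g) => //.
    by rewrite gal_id; apply: nvr_mx.
  move=> h hG; apply: mx_sub => //; apply: nvr_mx => //.
  by move=> /(inv2 h hG u).2.
have N0 : N^-1 != 0 by rewrite invr_eq0; apply/prodf_neq0 => h _; rewrite fmorph_eq0.
have Ova : Ov a by apply/ov1; rewrite -aE.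
by apply: (mx_vr N0 m2N); rewrite invrK aE; apply/ov2.
Qed.

End Uniqueness.

From mathcomp Require Import classical_sets filter.

Record subring_prop (E : fieldType) (R : E -> Prop) : Prop := SubringProp {
  sp1 : R 1;
  spB : forall x y, R x -> R y -> R (x - y);
  spM : forall x y, R x -> R y -> R (x * y)
}.

(** * Chevalley's extension theorem *)

Section Chevalley.
Variables (E : fieldType) (A I : E -> Prop).
Hypothesis sA : subring_prop A.
Hypotheses (IA : forall x, I x -> A x) (I0 : I 0)
  (ID : forall x y, I x -> I y -> I (x + y))
  (IM : forall a x, A a -> I x -> I (a * x)) (I1 : ~ I 1).

(** For a ring R containing A this is the ideal I R. *)
Inductive gen (R : E -> Prop) : E -> Prop :=
| gen0 : gen R 0
| genS i r x : I i -> R r -> gen R x -> gen R (i * r + x).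

Let gen_sub (R R' : E -> Prop) : (forall x, R x -> R' x) -> forall x, gen R x -> gen R' x.
Proof. by move=> h x; elim=> [|i r y Ii Rr _ IH]; [apply: gen0|apply: genS => //; apply: h]. Qed.

Let genD R x y : gen R x -> gen R y -> gen R (x + y).
Proof.
move=> gx gy; elim: gx => [|i r w Ii Rr _ IH]; first by rewrite add0r.
by rewrite -addrA; apply: genS.
Qed.

Section Sub.
Variables (R : E -> Prop) (sR : subring_prop R) (AR : forall x, A x -> R x).

Let R0 : R 0. Proof. by rewrite -(subrr 1); apply: (spB sR); apply: (sp1 sR). Qed.
Let RN x : R x -> R (- x).
Proof. by move=> h; rewrite -sub0r; apply: (spB sR). Qed.
Let RD x y : R x -> R y -> R (x + y).
Proof. by move=> h h'; rewrite -[y]opprK; apply: (spB sR) => //; apply: RN. Qed.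
Let RX x n : R x -> R (x ^+ n).
Proof. by move=> h; elim: n => [|n IH]; rewrite ?expr0 ?exprS; [apply: (sp1 sR)|apply: (spM sR)]. Qed.

Let genM a x : R a -> gen R x -> gen R (a * x).
Proof.
move=> Ra; elim=> [|i r w Ii Rr _ IH]; first by rewrite mulr0; apply: gen0.
by rewrite mulrDr mulrCA; apply: genS => //; apply: (spM sR).
Qed.

Let gen_R x : gen R x -> R x.
Proof.
by elim=> // i r y Ii Rr _ Ry; apply: RD => //; apply: (spM sR) => //; apply/AR/IA.
Qed.

Let genI x : I x -> gen R x.
Proof. by move=> Ix; rewrite -[x]mulr1 -[_ * _]addr0; apply: genS => //; [apply: (sp1 sR)|apply: gen0]. Qed.

Definition adj (t x : E) := exists n (a : nat -> E), (forall k, R (a k)) /\ x = \sum_(k < n) a k * t ^+ k.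

Let trunc n (a : nat -> E) k := if (k < n)%N then a k else 0.

Let truncE n N (a : nat -> E) t : (n <= N)%N ->
  \sum_(k < n) a k * t ^+ k = \sum_(k < N) trunc n a k * t ^+ k.
Proof.
move=> nN; rewrite (big_ord_widen N (fun k => a k * t ^+ k) nN) big_mkcond.
by apply: eq_bigr => i _; rewrite /trunc; case: ifP => // _; rewrite mul0r.
Qed.

Lemma adj_sub t x : R x -> adj t x.
Proof.
move=> Rx; exists 1%N, (fun=> x); split=> //.
by rewrite big_ord1 expr0 mulr1.
Qed.

Lemma adjt t : adj t t.
Proof.
exists 2%N, (fun k => if k == 1%N then 1 else 0); split.
  by move=> k; case: ifP => _ //; apply: (sp1 sR).
by rewrite !big_ord_recl big_ord0 /= mul0r mul1r add0r addr0 expr1.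
Qed.

Lemma adj_subring t : subring_prop (adj t).
Proof.
split.
- exact/adj_sub/(sp1 sR).
- move=> x y [n [a [Ra ->]]] [k [b [Rb ->]]].
  pose N := maxn n k.
  rewrite (truncE _ _ (leq_maxl n k)) (truncE _ _ (leq_maxr n k)) -sumrB.
  exists N, (fun i => trunc n a i - trunc k b i); split.
    by move=> i; apply: (spB sR); rewrite /trunc; case: ifP.
  by apply: eq_bigr => i _; rewrite mulrBl.
- move=> x y [n [a [Ra ->]]] [k [b [Rb ->]]].
  pose P := \poly_(i < n) a i; pose Q := \poly_(i < k) b i.
  exists (size (P * Q)), (fun i => (P * Q)`_i); split.
    move=> i; rewrite coefM; elim/big_ind: _ => // j _.
    by apply: (spM sR); rewrite coef_poly; case: ifP.
  by rewrite -horner_coef hornerM !horner_poly.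
Qed.

Let gen_adj t x : gen (adj t) x ->
  exists n (a : nat -> E), (forall k, gen R (a k)) /\ x = \sum_(k < n) a k * t ^+ k.
Proof.
elim=> [|i r y Ii [n [a [Ra ->]]] _ [k [b [Rb ->]]]].
  by exists 0%N, (fun=> 0); split; [move=> ?; apply: gen0|rewrite big_ord0].
pose N := maxn n k.
rewrite (truncE _ _ (leq_maxl n k)) (truncE _ _ (leq_maxr n k)) mulr_sumr -big_split.
exists N, (fun j => i * trunc n a j + trunc k b j); split.
  move=> j; apply: genS => //; rewrite /trunc; case: ifP => // _; exact: gen0.
by apply: eq_bigr => j _ /=; rewrite mulrDl mulrA.
Qed.

Hypothesis g1 : ~ gen R 1.
Hypothesis Rmax : forall t, ~ R t -> gen (adj t) 1.

(** If the inverse is missing, maximality puts 1 in the ideal extended to R[1/(1 - c)]. Clearing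
    denominators, (1 - c)^n is in I R; but it is 1 modulo I R. *)
Let unit_1B c : gen R c -> 1 - c != 0 /\ R (1 - c)^-1.
Proof.
move=> gc; have c1 : 1 - c != 0.
  by rewrite subr_eq0; apply/eqP => e; apply: g1; rewrite e.
split=> //; apply: contrapT => nR; have [n [a [ga e]]] := gen_adj (Rmax nR).
have gX k : gen R (1 - (1 - c) ^+ k).
  elim: k => [|k IH]; first by rewrite expr0 subrr; apply: gen0.
  have -> : 1 - (1 - c) ^+ k.+1 = (1 - c) * (1 - (1 - c) ^+ k) + c.
    by rewrite exprS; ring.
  by apply: genD => //; apply: genM => //; apply: (spB sR); [apply: (sp1 sR)|apply: gen_R].
apply: g1; rewrite -(subrK ((1 - c) ^+ n) 1); apply: genD => //.
have -> : (1 - c) ^+ n = \sum_(k < n) (1 - c) ^+ n * (a k * (1 - c)^-1 ^+ k).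
  by rewrite -mulr_sumr -e mulr1.
elim/big_ind: _ => [|x y|i _].
- exact: gen0.
- exact: genD.
rewrite mulrCA exprVn -[X in _ ^+ X / _](subnK (ltnW (ltn_ord i))) exprD -mulrA mulfV ?expf_neq0 //.
rewrite mulr1 mulrC; apply: genM => //; apply: RX; apply: (spB sR); first exact: (sp1 sR).
exact: gen_R.
Qed.

Let pw t n := exists a : nat -> E, (forall k, gen R (a k)) /\ 1 = \sum_(k < n) a k * t ^+ k.

(** Multiplied by the top power of x, the relation for x^-1 expresses this power by lower ones,
    since 1 - b_0 is a unit; substituting shortens the relation for x. *)
Let reduce x n m : x != 0 -> (0 < m <= n)%N -> pw x n -> pw x^-1 m -> exists2 n', (n' < n)%N & pw x n'.
Proof.
move=> x0 /andP[m0 mn] [a [ga ea]] [b [gb eb]].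
case: n mn ea => [|n] mn ea; first by rewrite leqNgt m0 in mn.
have [u0 Ru] := unit_1B (gb 0%N); set u := (1 - b 0%N)^-1 in Ru.
pose q := trunc m b.
have gq k : gen R (q k) by rewrite /q /trunc; case: ifP => // _; apply: gen0.
have q0 : q 0%N = b 0%N by rewrite /q /trunc m0.
have eq : 1 - b 0%N = \sum_(k < n) q k.+1 * x^-1 ^+ k.+1.
  rewrite [X in X - _]eb (truncE _ _ mn) -/q big_ord_recl /= expr0 mulr1 q0 addrC addKr.
  by apply: eq_bigr => i _; rewrite -lift0.
exists n => //; exists (fun k => a k + u * a n * q (n - k)%N); split.
  move=> k; apply: genD => //; rewrite -mulrA; apply: genM => //; apply: genM => //.
  exact: gen_R.
under eq_bigr do rewrite mulrDl.
rewrite big_split /= ea big_ord_recr /=; congr (_ + _).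
rewrite (eq_bigr (fun i : 'I_n => u * a n * (q (n - i)%N * x ^+ i))); last first.
  by move=> i _; rewrite mulrA.
rewrite -mulr_sumr.
suff -> : \sum_(i < n) q (n - i)%N * x ^+ i = (1 - b 0%N) * x ^+ n.
  by rewrite mulrA [_ * (1 - _)]mulrAC /u mulVf // mul1r.
rewrite eq mulr_suml [RHS](reindex_inj rev_ord_inj) /=; apply: eq_bigr => i _.
rewrite -mulrA subnSK // exprVn; congr (_ * _).
rewrite -[X in _ = _ * _ ^+ X](subnK (ltnW (ltn_ord i))) exprD mulKf // expf_neq0 //.
Qed.

Lemma max_valring : valring R.
Proof.
split; [exact: (sp1 sR)|exact: (spB sR)|exact: (spM sR)|move=> x].
have [->|x0] := eqVneq x 0; first by left.
apply: contrapT => /not_orP[nx nVx].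
have pwx t : ~ R t -> exists n, `[< pw t n >].
  by move=> /Rmax/gen_adj[n [a [? ?]]]; exists n; apply/asboolP; exists a.
have [n /asboolP pn nmin] := ex_minnP (pwx _ nx).
have [m /asboolP pm mmin] := ex_minnP (pwx _ nVx).
have pos t k : pw t k -> (0 < k)%N.
  by case: k => // -[a [_ /eqP]]; rewrite big_ord0 oner_eq0.
have [mn|nm] := leqP m n.
  have [|n' lt /asboolP/nmin] := reduce x0 _ pn pm; first by rewrite (pos _ _ pm).
  by rewrite leqNgt lt.
have pn' : pw x^-1^-1 n by rewrite invrK.
have [||m' lt /asboolP/mmin] := reduce _ _ pm pn'; rewrite ?invr_eq0 //.
  by rewrite (pos _ _ pn) ltnW.
by rewrite leqNgt lt.
Qed.

Lemma max_mxi x : I x -> mxi R x.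
Proof.
move=> Ix; have [->|x0] := eqVneq x 0; [by left|right=> RV; apply: g1].
by rewrite -(mulVf x0); apply: genM => //; apply: genI.
Qed.

End Sub.

Local Open Scope classical_set_scope.

Lemma chevalley : exists O : E -> Prop,
  [/\ valring O, forall x, A x -> O x & forall x, I x -> mxi O x].
Proof.
pose good (R : set E) := subring_prop R /\ ~ gen R 1.
(* The union with A lets the empty union, which occurs for the empty chain, satisfy P. *)
pose P (R : set E) := good (A `|` R).
have gA x : gen A x -> I x.
  by elim=> // i r y Ii Ar _ Iy; apply: ID => //; rewrite mulrC; apply: IM.
have [F FP totF|R [gR Rmax]] := @Zorn_bigcup E P.
  have [[X0 FX0]|nX] := pselect (exists X, F X); last first.
    have -> : \bigcup_(X in F) X = set0.
      by rewrite -subset0 => x [X FX _]; apply: nX; exists X.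
    by rewrite /P setU0; split=> // /gA.
  have dir x y : (A `|` \bigcup_(X in F) X) x -> (A `|` \bigcup_(X in F) X) y ->
      exists2 X, F X & (A `|` X) x /\ (A `|` X) y.
    case=> [Ax|[X FX Xx]]; case=> [Ay|[Y FY Yy]].
    - by exists X0 => //; split; left.
    - by exists Y => //; split; [left|right].
    - by exists X => //; split; [right|left].
    - have [XY|YX] := totF _ _ FX FY.
        by exists Y => //; split; right=> //; apply: XY.
      by exists X => //; split; right=> //; apply: YX.
  have sub X : F X -> forall x, (A `|` X) x -> (A `|` \bigcup_(X in F) X) x.
    by move=> FX x [Ax|Xx]; [left|right; exists X].
  split; first split.
  - by left; apply: (sp1 sA).
  - move=> x y Ux Uy; have [X FX [Xx Xy]] := dir _ _ Ux Uy.
    by apply: (sub X FX); apply: (spB (FP _ FX).1).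
  - move=> x y Ux Uy; have [X FX [Xx Xy]] := dir _ _ Ux Uy.
    by apply: (sub X FX); apply: (spM (FP _ FX).1).
  suff h x : gen (A `|` \bigcup_(X in F) X) x -> exists2 X, F X & gen (A `|` X) x.
    by move=> /h[X FX]; apply: (FP _ FX).2.
  elim=> [|i r y Ii Ur _ [Y FY gy]]; first by exists X0 => //; apply: gen0.
  have [X FX [Xr _]] := dir _ _ Ur Ur; have [XY|YX] := totF _ _ FX FY.
    exists Y => //; apply: genS => //; case: Xr => [?|/XY ?]; by [left|right].
  exists X => //; apply: genS => //; apply: gen_sub gy => w [?|/YX ?]; by [left|right].
have [sR g1] := gR.
have AR x : A x -> (A `|` R) x by left.
have Rm t : ~ (A `|` R) t -> gen (adj (A `|` R) t) 1.
  move=> nt; apply: contrapT => ng; apply: (Rmax (adj (A `|` R) t)).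
    split; first by move=> x Rx; apply: adj_sub; right.
    move=> h; apply: nt; right; apply: h; exact: (adjt sR).
  have e : A `|` adj (A `|` R) t = adj (A `|` R) t.
    by apply/setUidPr => x Ax; apply: adj_sub => //; left.
  rewrite /P /good e; split=> //; exact: (adj_subring sR).
exists (A `|` R); split=> //.
- exact: max_valring AR g1 Rm.
- exact: max_mxi.
Qed.

End Chevalley.

(** * The criterion for p-henselianity in terms of S *)

Section Henselian.
Variables (p : nat) (p_prime : prime p) (K : fieldType) (z : K) (zP : qnat z p = 0).
Variable v : valuation K.
Local Notation Ov := (ring_of v).
Local Notation E := (p_extension p K).
Local Notation i := (@p_extension_emb p K : {rmorphism K -> E}).
Let vOv : valring Ov := ring_of_valring v.
Let iz := i z.
Local Notation lam := (iz - 1).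
Let izP : qnat iz p = 0. Proof. by rewrite -qnat_rmorph zP rmorph0. Qed.

Lemma zeta_unit (F : fieldType) (O : F -> Prop) (y : F) : valring O -> qnat y p = 0 -> O y.
Proof.
move=> vO yP; apply: contrapT => nz; have y0 := zeta_neq0 p_prime yP.
have e : y^-1 ^+ p = 1 by rewrite exprVn (zetaX yP) invr1.
apply: (mx1 vO); rewrite -e; apply: mxXn => //; [exact: prime_gt0|exact: nvr_mx].
Qed.

Lemma extendsP (w : valuation E) : extends i w v <-> forall a, ring_of w (i a) <-> Ov a.
Proof.
split=> H a; first by rewrite /ring_of -(H a).
by apply/idP/idP => h; apply/H.
Qed.

Lemma extends_mxi (w : valuation E) a : extends i w v -> mxi (ring_of w) (i a) <-> mxi Ov a.
Proof.
move=> /extendsP ov; rewrite /mxi -fmorphV ov.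
suff -> : (i a = 0) = (a = 0) by [].
by apply/propext; split=> [/eqP|->]; rewrite ?rmorph0 // fmorph_eq0 => /eqP.
Qed.

Section Other.
Variables (w : valuation E) (ext : extends i w v).
Local Notation Ow := (ring_of w).
Let vOw : valring Ow := ring_of_valring w.
Variables (a : K) (ma : mxi Ov a) (aS : ~ inS p z a).

Let Oq k : Ow (qnat iz k).
Proof. by apply: vr_sum => // l _; apply: vrX => //; apply: zeta_unit. Qed.

Let OvE b : Ow (i b) <-> Ov b. Proof. exact: (extendsP w).1 ext b. Qed.

(** Some root of f(y) = a has a factor y - [k] in the maximal ideal; its translate by [p - k] equals
    this factor up to a power of z. *)
Lemma root_in_max : exists2 y, mxi Ow y & kas p iz y = i a.
Proof.
have [y yE] := p_ext_root p_prime zP (i a).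
have : mxi Ow (kas p iz y) by rewrite /iz /= yE; apply/(extends_mxi a ext).
move=> /(mx_prime vOw)[k mk]; exists (tmul lam y (qnat iz (p - k))).
  have e : y - qnat iz k = iz ^+ k * tmul lam y (qnat iz (p - k)).
    have -> : tmul lam y (qnat iz (p - k)) = y * (1 + lam * qnat iz (p - k)) + qnat iz (p - k).
      by rewrite /tmul; ring.
    have -> : 1 + lam * qnat iz (p - k) = iz ^+ (p - k) by rewrite qnatE addrC subrK.
    rewrite mulrDr mulrCA -exprD subnKC ?(ltnW (ltn_ord k)) // (zetaX izP) mulr1.
    congr (_ + _); apply/eqP; rewrite eq_sym -addr_eq0 addrC -qnatD.
    by rewrite subnKC ?izP ?(ltnW (ltn_ord k)).
  have -> : tmul lam y (qnat iz (p - k)) = iz ^+ (p - k) * (y - qnat iz k).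
    rewrite e mulrA -exprD subnK ?(ltnW (ltn_ord k)) // (zetaX izP) mul1r //.
  by apply: mxM => //; apply: vrX => //; apply: zeta_unit.
rewrite kas_tmul // -[RHS]yE; have [k0|k0] := posnP k.
  rewrite k0 subn0; have -> : qnat iz p = qnat iz 0 by rewrite izP qnat0.
  by rewrite qnat0 kas0 // tmul0.
by rewrite kas_qnat ?tmul0 // ltn_subrL k0 prime_gt0.
Qed.

Lemma minimal_poly (y : E) : (exists2 q : {poly K}, q != 0 & root (map_poly i q) y) ->
  exists g : {poly K}, [/\ g \is monic, root (map_poly i g) y &
    forall q, q != 0 -> root (map_poly i q) y -> (size g <= size q)%N].
Proof.
move=> [q0 q00 q0y].
pose P n := `[< exists q : {poly K}, [/\ size q = n, q != 0 & root (map_poly i q) y] >].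
have exP : exists n, P n by exists (size q0); apply/asboolP; exists q0.
have [n /asboolP[q [sq q_0 qy]] qmin] := ex_minnP exP.
exists ((lead_coef q)^-1 *: q); have l0 : (lead_coef q)^-1 != 0 by rewrite invr_eq0 lead_coef_eq0.
split.
- by rewrite monicE lead_coefZ mulVf // lead_coef_eq0.
- by rewrite map_polyZ rootZ // fmorph_eq0.
- by move=> r r0 ry; rewrite size_scale // sq; apply: qmin; apply/asboolP; exists r.
Qed.

Lemma minimal_dvd (y : E) (g q : {poly K}) : g \is monic ->
  (forall q, q != 0 -> root (map_poly i q) y -> (size g <= size q)%N) ->
  root (map_poly i g) y -> root (map_poly i q) y -> g %| q.
Proof.
move=> gm gmin gy qy; rewrite /dvdp; apply: contraT => r0.
have ry : root (map_poly i (q %% g)) y.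
  have : root (map_poly i (q %/ g * g + q %% g)) y by rewrite -divp_eq.
  by rewrite /root rmorphD rmorphM hornerD hornerM (rootP gy) mulr0 add0r.
have := gmin _ r0 ry; rewrite leqNgt ltn_modp.
by rewrite monic_neq0.
Qed.

(** As a is not in S, y is not in K, and its minimal polynomial g has a second root, the translate
    of y by some [j]. This root is congruent to [j], so g([j]) is in m. *)
Lemma other_conjugate y : mxi Ow y -> kas p iz y = i a ->
  exists (g : {poly K}) (j : nat), (0 < j < p)%N /\ [/\ g \is monic, forall k, Ov g`_k,
    root (map_poly i g) y,
    forall q, q != 0 -> root (map_poly i q) y -> (size g <= size q)%N
    & mxi Ov g.[qnat z j]].
Proof.
move=> my yE; have mly : mxi Ow (lam * y).
  by apply: mxM => //; apply: (vrB vOw); [apply: zeta_unit|apply: (vr1 vOw)].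
have [y0 _] := mx_1D vOw mly.
have fE : map_poly i (kaspoly p z - a%:P) = kaspoly p iz - (kas p iz y)%:P.
  by rewrite rmorphB /= map_polyC map_kaspoly yE.
have fy : root (map_poly i (kaspoly p z - a%:P)) y.
  by rewrite fE /root hornerD hornerN hornerC horner_kaspoly subrr.
have f0 : kaspoly p z - a%:P != 0.
  rewrite -size_poly_eq0 size_polyDl size_kaspoly //.
  by rewrite size_polyN (leq_ltn_trans (size_polyC_leq1 _)) // ltnS prime_gt0.
have [|g [gm gy gmin]] := @minimal_poly y; first by exists (kaspoly p z - a%:P).
have [fac U] := kaspoly_factor p_prime izP y0.
have : map_poly i g %| \prod_(w <- [seq tmul lam y (qnat iz i0) | i0 <- iota 0 p]) ('X - w%:P).
  by rewrite -fac -fE dvdp_map; apply: minimal_dvd gmin gy fy.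
case/dvdp_prod_XsubC => mk.
rewrite eqp_monic ?monic_map ?monic_prod_XsubC //; move/eqP => gE.
set s := mask _ _ in gE.
have Us : uniq s by apply: mask_uniq.
have ss w' : w' \in s -> exists2 k, (k < p)%N & w' = tmul lam y (qnat iz k).
  by move=> /mem_mask/mapP[k]; rewrite mem_iota add0n /= => kp ->; exists k.
have ys : y \in s by rewrite -root_prod_XsubC -gE.
have [w' ws wy] : exists2 w', w' \in s & w' != y.
  apply: contrapT => /forall2NP H.
  have s1 : s =i [:: y].
    move=> u; rewrite inE; apply/idP/eqP => [us|->] //.
    by have [|/negP/negPn/eqP] := H u.
  have sz : size s = 1%N by rewrite (perm_size (uniq_perm Us _ s1)).
  have sg : size g = 2%N by rewrite -(size_map_poly i) gE size_prod_XsubC sz.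
  case: aS; have [c gE1] : exists c, g = 'X - c%:P.
    exists (- g`_0); apply/polyP => k; rewrite polyCN opprK coefD coefX coefC.
    case: k => [|[|k]] /=; rewrite ?add0r ?addr0 //.
      by have := monicP gm; rewrite lead_coefE sg.
    by rewrite nth_default // sg.
  have yc : y = i c.
    by apply/eqP; move: gy; rewrite gE1 map_polyXsubC root_XsubC.
  by exists c; apply: (fmorph_inj i); rewrite kas_rmorph -yE yc.
have [j jp wE] := ss _ ws.
have j0 : (0 < j)%N.
  by rewrite lt0n; apply: contraNneq wy => j0; rewrite wE j0 qnat0 tmul0.
have Os w0 : w0 \in s -> Ow w0.
  move=> /ss[k _ ->]; have Oy := mx_sub vOw my; have Ol : Ow lam.
    by apply: (vrB vOw); [apply: zeta_unit|apply: (vr1 vOw)].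
  by rewrite /tmul; apply: vrD => //; [apply: vrD|apply: (vrM vOw) => //; apply: (vrM vOw)].
exists g, j; rewrite j0 jp; split=> //; split=> //.
  move=> k; apply/OvE; rewrite -coef_map gE.
  have : forall k, Ow (\prod_(z <- s) ('X - z%:P))`_k.
    elim: (s) Os => [|u t IH] Ot k'.
      by rewrite big_nil coef1; case: eqP => _; [apply: (vr1 vOw)|apply: vr0].
    rewrite big_cons mulrBl coefB coefXM coefCM; apply: (vrB vOw).
      by case: ifP => _; [apply: vr0|apply: IH => w0 w0t; apply: Ot; rewrite inE w0t orbT].
    apply: (vrM vOw); first by apply: Ot; rewrite inE eqxx.
    by apply: IH => w0 w0t; apply: Ot; rewrite inE w0t orbT.
  exact.
apply: (extends_mxi _ ext).1.
have -> : i g.[qnat z j] = (\prod_(z <- s) ('X - z%:P)).[qnat iz j].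
  by rewrite -gE -(qnat_rmorph i) horner_map.
rewrite (big_rem w' ws) /= hornerM hornerXsubC horner_prod; apply: (mxMr vOw).
  rewrite big_seq; apply: vr_prod => // w0 w0s; rewrite hornerXsubC; apply: (vrB vOw) => //.
  exact/Os/(mem_rem w0s).
have -> : qnat iz j - w' = - (y * (1 + lam * qnat iz j)) by rewrite wE /tmul; ring.
apply: mxN => //; apply: mxMr => //; rewrite qnatE addrC subrK.
by apply: vrX => //; apply: zeta_unit.
Qed.

(** Dividing by the monic g keeps the coefficients in the valuation ring. As P vanishes at y, it is
    a multiple of g over this ring, and g(c) is in m. *)
Lemma minimal_max (g : {poly K}) (c : K) y : g \is monic -> (forall k, Ov g`_k) ->
  (forall q, q != 0 -> root (map_poly i q) y -> (size g <= size q)%N) ->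
  root (map_poly i g) y -> Ov c -> mxi Ov g.[c] ->
  forall P : {poly K}, (forall k, Ov P`_k) -> root (map_poly i P) y -> mxi Ov P.[c].
Proof.
move=> gm gO gmin gy Oc gc P; move: {2}(size P) (leqnn (size P)) => n.
elim: n P => [|n IH] P sP PO Py.
  by move: sP; rewrite size_poly_leq0 => /eqP ->; rewrite horner0; left.
have [->|P0] := eqVneq P 0; first by rewrite horner0; left.
have gP := gmin _ P0 Py; pose k := (size P - size g)%N.
pose Q := P - lead_coef P *: ('X^k * g).
have sg : (0 < size g)%N by rewrite size_poly_gt0 monic_neq0.
have sQ : (size Q <= n)%N.
  apply/leq_sizeP => m nm; rewrite coefB coefZ coefXnM.
  have m1 : ((size P).-1 <= m)%N by rewrite -ltnS prednK ?size_poly_gt0 // (leq_trans sP).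
  have kP : (k <= (size P).-1)%N by rewrite -ltnS prednK ?size_poly_gt0 // ltn_subrL sg size_poly_gt0.
  rewrite ltnNge (leq_trans kP m1) /=.
  have sPE : ((size P).-1 - k = (size g).-1)%N.
    by rewrite /k -subn1 subnAC subKn // subn1.
  move: m1; rewrite leq_eqVlt => /orP[/eqP <-|m1].
    by rewrite sPE -!lead_coefE (monicP gm) mulr1 subrr.
  have m2 : (size g <= m - k)%N.
    by rewrite -(prednK sg) -sPE ltn_sub2r // (leq_ltn_trans kP m1).
  by rewrite !nth_default ?mulr0 ?subrr // -(prednK (n := size P)) ?size_poly_gt0.
have QO m : Ov Q`_m.
  rewrite coefB coefZ coefXnM; apply: (vrB vOv) => //; apply: (vrM vOv); first exact: PO.
  by case: ifP => // _; apply: vr0.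
have Qy : root (map_poly i Q) y.
  by rewrite /root rmorphB /= map_polyZ rmorphM hornerD hornerN hornerZ hornerM (rootP Py) (rootP gy) !mulr0 subrr.
have -> : P.[c] = Q.[c] + lead_coef P * c ^+ k * g.[c].
  by rewrite /Q hornerD hornerN hornerZ hornerM hornerXn mulrA subrK.
apply: (mxD vOv); first exact: IH.
by apply: mxM => //; apply: (vrM vOv); [apply: PO|apply: vrX].
Qed.

End Other.

Lemma extends_of_ring (O : E -> Prop) (vO : valring O) :
  (forall a, Ov a -> O (i a)) -> (forall a, mxi Ov a -> mxi O (i a)) ->
  extends i (valuation_of_ring vO) v.
Proof.
move=> OvO mm; apply/extendsP => a; rewrite ring_of_valuation_of_ring.
split=> [Oa|/OvO //]; apply: contrapT => na.
have a0 : i a^-1 != 0 by rewrite fmorph_eq0 invr_eq0 (nvr_neq0 vOv na).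
by have := mx_vr a0 (mm _ (nvr_mx na)); rewrite fmorphV invrK.
Qed.

Let Oz k : Ov (qnat z k).
Proof. by apply: vr_sum => // l _; apply: vrX => //; apply: zeta_unit. Qed.

(** For a in m outside of S there are two extensions: w, with a root y of f(y) = a in its maximal
    ideal, and one where y is congruent to the unit [j]. Instead of an automorphism of K(p), the
    second is obtained from Chevalley's theorem for the ring of the P(y) and the ideal of those with
    P([j]) in m; it is proper by [minimal_max]. *)
Lemma p_henselian_max : p_henselian p v -> forall a, mxi Ov a -> inS p z a.
Proof.
move=> [w [ext uniqw]] a ma; apply: contrapT => aS.
have [y my yE] := root_in_max ext ma.
have [g [j [jp [gm gO gy gmin gj]]]] := other_conjugate ext aS my yE.
have gP := minimal_max gm gO gmin gy (Oz j) gj.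
pose A e := exists P : {poly K}, (forall k, Ov P`_k) /\ e = (map_poly i P).[y].
pose I e := exists P : {poly K}, [/\ forall k, Ov P`_k, mxi Ov P.[qnat z j] & e = (map_poly i P).[y]].
have cM (P Q : {poly K}) : (forall k, Ov P`_k) -> (forall k, Ov Q`_k) -> forall k, Ov (P * Q)`_k.
  by move=> PO QO k; rewrite coefM; apply: vr_sum => // l _; apply: (vrM vOv).
have cC (c : K) : Ov c -> forall k, Ov (c%:P)`_k.
  by move=> Oc k; rewrite coefC; case: eqP => // _; apply: vr0.
have [||||||O [vO AO IO]] := @chevalley E A I.
- split.
  + exists 1; split; last by rewrite rmorph1 hornerC.
    by rewrite -polyC1; apply: cC; apply: (vr1 vOv).
  + move=> _ _ [P [PO ->]] [Q [QO ->]]; exists (P - Q); split; last by rewrite rmorphB hornerD hornerN.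
    by move=> k; rewrite coefB; apply: (vrB vOv).
  + move=> _ _ [P [PO ->]] [Q [QO ->]]; exists (P * Q); split; last by rewrite rmorphM hornerM.
    exact: cM.
- by move=> _ [P [PO _ ->]]; exists P.
- exists 0; split; [|by rewrite horner0; left|by rewrite rmorph0 horner0].
  by move=> k; rewrite coef0; apply: vr0.
- move=> _ _ [P [PO Pj ->]] [Q [QO Qj ->]]; exists (P + Q); split.
  + by move=> k; rewrite coefD; apply: vrD.
  + by rewrite hornerD; apply: mxD.
  + by rewrite rmorphD hornerD.
- move=> _ _ [P [PO ->]] [Q [QO Qj ->]]; exists (P * Q); split.
  + exact: cM.
  + rewrite hornerM; apply: mxM => //; rewrite horner_coef; apply: vr_sum => // k _.
    by apply: (vrM vOv) => //; apply: vrX.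
  + by rewrite rmorphM hornerM.
- move=> [P [PO Pj e]]; apply: (mx1 vOv).
  have: mxi Ov (P - 1).[qnat z j].
    apply: gP; first by move=> k; rewrite coefB; apply: (vrB vOv) => //; rewrite -polyC1; apply: cC; apply: (vr1 vOv).
    by rewrite /root rmorphB rmorph1 hornerD hornerN hornerC -e subrr.
  by rewrite hornerD hornerN hornerC => /(mxB vOv Pj); rewrite subKr.
have ext' : extends i (valuation_of_ring vO) v.
  apply: extends_of_ring => b Ob.
    by apply: AO; exists b%:P; split; [exact: cC|rewrite map_polyC hornerC].
  apply: IO; exists b%:P; split; [|by rewrite hornerC|].
    by apply: cC; apply: mx_sub.
  by rewrite map_polyC hornerC.
have OE e : O e <-> ring_of w e.
  have u := uniqw _ ext' e.
  by rewrite -(ring_of_valuation_of_ring vO) /ring_of u.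
have mOy : mxi O y by case: my => [->|ny]; [left|right=> /OE].
have myj : mxi O (y - qnat iz j).
  apply: IO; exists ('X - (qnat z j)%:P); split.
  - move=> k; rewrite coefB; apply: (vrB vOv); last exact: cC.
    by rewrite coefX; case: eqP => _; [apply: (vr1 vOv)|apply: vr0].
  - by rewrite hornerXsubC subrr; left.
  - by rewrite map_polyXsubC hornerXsubC qnat_rmorph.
have mj : mxi O (qnat iz j) by have := mxB vO mOy myj; rewrite subKr.
have [k jk] := qnat_inv p_prime izP jp.
apply: (mx1 vO); rewrite -jk; apply: mxMr => //; apply: vr_sum => // l _.
by rewrite -exprM; apply: vrX => //; apply: zeta_unit.
Qed.

(** Existence is Chevalley's theorem. Uniqueness is checked element by element, in a finite Galois
    p-extension, where [lies_over_sub] applies. *)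
Lemma max_p_henselian : (forall a, mxi Ov a -> inS p z a) -> p_henselian p v.
Proof.
move=> hens.
have sub (w w' : valuation E) : extends i w v -> extends i w' v ->
    forall x, ring_of w x -> ring_of w' x.
  move=> ext ext' x wx.
  have xC : in_p_extension p (val x) by apply/asboolP; apply: (valP x).
  have [L [j [n [jP galL dimL [u ux]]]]] := in_galois_p p_prime xC.
  have jin t : j t \in @p_extension_pred p K.
    by apply/asboolP/galois_p_in; exists L, j, n; split=> //; exists t.
  pose jE t : E := Sub (j t) (jin t).
  have jA a : jE a%:A = i a by apply: val_inj; rewrite /= jP.
  have vr (w0 : valuation E) : valring (fun t => ring_of w0 (jE t)).
    have vw := ring_of_valring w0; split.
    - have -> : jE 1 = 1 by apply: val_inj; rewrite /= rmorph1.
      exact: (vr1 vw).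
    - move=> s t; have -> : jE (s - t) = jE s - jE t by apply: val_inj; rewrite /= rmorphB.
      exact: (vrB vw).
    - move=> s t; have -> : jE (s * t) = jE s * jE t by apply: val_inj; rewrite /= rmorphM.
      exact: (vrM vw).
    - move=> s; have -> : jE s^-1 = (jE s)^-1 by apply: val_inj; rewrite /= fmorphV.
      exact: (vrV vw).
  have lo (w0 : valuation E) : extends i w0 v -> lies_over Ov (fun t => ring_of w0 (jE t)).
    by move=> /extendsP e a; rewrite jA.
  have xE : x = jE u by apply: val_inj; rewrite /= ux.
  rewrite xE; apply: (lies_over_sub p_prime zP vOv hens galL dimL (vr w) (vr w') (lo w ext) (lo w' ext')).
  by rewrite -xE.
pose A e := exists2 b, Ov b & e = i b.
pose I e := exists2 b, mxi Ov b & e = i b.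
have [||||||O [vO AO IO]] := @chevalley E A I.
- split.
  + by exists 1; [apply: (vr1 vOv)|rewrite rmorph1].
  + by move=> _ _ [b Ob ->] [c Oc ->]; exists (b - c); [apply: (vrB vOv)|rewrite rmorphB].
  + by move=> _ _ [b Ob ->] [c Oc ->]; exists (b * c); [apply: (vrM vOv)|rewrite rmorphM].
- by move=> _ [b Ob ->]; exists b => //; apply: mx_sub.
- by exists 0; [left|rewrite rmorph0].
- by move=> _ _ [b Ob ->] [c Oc ->]; exists (b + c); [apply: mxD|rewrite rmorphD].
- by move=> _ _ [b Ob ->] [c Oc ->]; exists (b * c); [apply: mxM|rewrite rmorphM].
- move=> [b mb e]; apply: (mx1 vOv); suff -> : 1 = b by [].
  by apply: (fmorph_inj i); rewrite rmorph1.
have ext : extends i (valuation_of_ring vO) v.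
  by apply: extends_of_ring => b Ob; [apply: AO|apply: IO]; exists b.
exists (valuation_of_ring vO); split=> // w' ext' x.
by apply/idP/idP; apply: sub.
Qed.

Lemma p_henselianP : p_henselian p v <-> forall a, mxi Ov a -> inS p z a.
Proof. by split; [apply: p_henselian_max|apply: max_p_henselian]. Qed.

End Henselian.

(** * The canonical valuation ring *)

Section Classes.
Variables (p : nat) (p_prime : prime p).

(** With [scls], a restatement of the notions in terms of elements of the ring: K(p) and the residue
    field no longer occur, so that a formula can express them. *)
Definition phens (K : fieldType) (z : K) (O : K -> Prop) :=
  valring O /\ forall x, mxi O x -> inS p z x.

Definition scls (K : fieldType) (z : K) (O : K -> Prop) :=
  phens z O /\ forall x, O x -> ~ mxi O (1 + (z - 1) ^+ p * x) -> inS p z x.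

Section OnField.
Variables (K : fieldType) (z : K) (zP : qnat z p = 0).
Local Notation lp := ((z - 1) ^+ p).
Local Notation S := (inS p z).
Local Notation phens := (phens z).
Local Notation scls := (scls z).

Section Basics.
Variables (O : K -> Prop) (vO : valring O).

Lemma vr_zeta : O z. Proof. exact: (zeta_unit p_prime). Qed.
Lemma vr_lam : O (z - 1). Proof. by apply: (vrB vO); [exact: vr_zeta|exact: (vr1 vO)]. Qed.
Lemma vr_lp : O lp. Proof. by apply: vrX => //; apply: vr_lam. Qed.
Lemma vr_qnat k : O (qnat z k).
Proof. by apply: vr_sum => // l _; apply: vrX => //; apply: vr_zeta. Qed.
Lemma vr_kas y : O y -> O (kas p z y).
Proof. by move=> Oy; apply: vr_prod => // i _; apply: (vrB vO) => //; apply: vr_qnat. Qed.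
Lemma vr_kas_inv y : O (kas p z y) -> O y.
Proof.
move=> Of; apply: contrapT => ny.
have nX i : ~ O (y - qnat z i).
  by move=> h; apply: ny; rewrite -(subrK (qnat z i) y); apply: vrD => //; apply: vr_qnat.
have m1 i : mxi O (y - qnat z i)^-1 by apply: nvr_mx.
have m2 : mxi O (kas p z y)^-1.
  rewrite /kas -prodfV; apply: (@mx_prod _ _ vO _ _ (Ordinal (prime_gt0 p_prime))) => //.
  by move=> i _; apply: mx_sub.
have k0 : kas p z y != 0 by apply/prodf_neq0 => i _; exact: nvr_neq0 (nX i).
by have := mx_vr _ m2; rewrite invrK invr_eq0 => /(_ k0).
Qed.

Lemma phens_lift_S x y : phens O -> ~ mxi O (1 + lp * kas p z y) ->
  mxi O (x - kas p z y) -> S x.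
Proof.
move=> [_ mS] u mx; apply: (inS_div p_prime zP (a := kas p z y)).
- by exists y.
- exact: nmx_neq0 u.
- by apply: mS; apply: mxMr => //; apply: nmx_vr.
Qed.
End Basics.

Section Product.
Variables (O1 O2 : K -> Prop) (h1 : phens O1) (h2 : phens O2).
Let v1 := h1.1.
Let v2 := h2.1.

(** For valuation rings, single products already form the ring generated by O1 and O2, their finest
    common coarsening. *)
Definition vprod x := exists a b, [/\ O1 a, O2 b & x = a * b].

Lemma vprodl x : O1 x -> vprod x.
Proof. by exists x, 1; rewrite mulr1; split=> //; apply: (vr1 v2). Qed.
Lemma vprodr x : O2 x -> vprod x.
Proof. by exists 1, x; rewrite mul1r; split=> //; apply: (vr1 v1). Qed.

Lemma vprod_valring : valring vprod.
Proof.
split.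
- exact/vprodl/(vr1 v1).
- move=> _ _ [a [b [Oa Ob ->]]] [a' [b' [Oa' Ob' ->]]].
  have [->|b0] := eqVneq b 0.
    by exists (- a'), b'; rewrite mulr0 sub0r mulNr; split=> //; apply: vrN.
  have [->|b'0] := eqVneq b' 0.
    by exists a, b; rewrite mulr0 subr0.
  case: (vrV v1 (b / b')) => h.
    exists (a * (b / b') - a'), b'; split=> //; last by field.
    by apply: (vrB v1) => //; apply: (vrM v1).
  exists (a - a' * (b / b')^-1), b; split=> //; last by field; rewrite b0 b'0.
  by apply: (vrB v1) => //; apply: (vrM v1).
- move=> _ _ [a [b [Oa Ob ->]]] [a' [b' [Oa' Ob' ->]]].
  by exists (a * a'), (b * b'); split; [apply: (vrM v1)|apply: (vrM v2)|rewrite mulrACA].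
- by move=> x; case: (vrV v1 x) => h; [left|right]; apply: vprodl.
Qed.

Lemma vprod_max x : mxi vprod x -> mxi O1 x.
Proof. by apply: vr_mxS; apply: vprodl. Qed.

(* e is close to 0 for O1 and to 1 for O2: x is split as the product, for tmul, of x e and a small
   element of O2. *)
Lemma vprod_scls : ~ (forall x, O1 x -> O2 x) -> ~ (forall x, O2 x -> O1 x) -> scls vprod.
Proof.
move=> /existsNP[u /not_implyP[u1 u2]] /existsNP[w /not_implyP[w2 w1]].
split; first by split; [exact: vprod_valring|move=> x /vprod_max/h1.2].
have [q1 q2] : mxi O1 (u / w) /\ mxi O2 (w / u).
  by split; apply: mxM => //; apply: nvr_mx.
have u0 := nvr_neq0 v2 u2; have w0 := nvr_neq0 v1 w1.
move=> x Px t; set T := 1 + lp * x in t.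
have T0 := nmx_neq0 t.
have PT : vprod (x / T) by apply: (vrM vprod_valring) => //; apply: nmx_vr.
have [a1 [b1 [Oa1 b1V b10 xE]]] : exists a1 b1, [/\ O1 a1, O2 b1 /\ O1 b1^-1, b1 != 0 & x = a1 * b1].
  have [a [b [Oa Ob ->]]] := Px; have [Ob1|nb] := pselect (O1 b).
    exists (a * b), 1; rewrite mulr1 invr1 oner_neq0; split=> //; first exact: (vrM v1).
    by split; [apply: (vr1 v2)|apply: (vr1 v1)].
  by exists a, b; split=> //; [split=> //; apply: nvr_vr|apply: nvr_neq0 nb].
have [a2 [b2 [a2V Ob2 a20 xTE]]] :
    exists a2 b2, [/\ O1 a2 /\ O2 a2^-1, O2 b2, a2 != 0 & x / T = a2 * b2].
  have [a [b [Oa Ob ->]]] := PT; have [Oa2|na] := pselect (O2 a).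
    exists 1, (a * b); rewrite mul1r invr1 oner_neq0; split=> //; last exact: (vrM v2).
    by split; [apply: (vr1 v1)|apply: (vr1 v2)].
  by exists a, b; split=> //; [split=> //; apply: nvr_vr|apply: nvr_neq0 na].
(* The factor w / u is small for O2 and its inverse is small for O1; b1 / a2 compensates the part b1
   of x outside of O1 and the part a2 of x / T outside of O2. *)
pose g := (w / u) * (b1 / a2).
have g0 : g != 0 by rewrite !mulf_neq0 ?invr_eq0.
have gVE : g^-1 = (u / w) * (a2 * b1^-1) by rewrite /g; field; rewrite u0 w0 a20 b10.
have mgV : mxi O1 g^-1 by rewrite gVE; apply: mxMr => //; apply: (vrM v1) => //; case: b1V; case: a2V.
have mg : mxi O2 g by apply: mxMr => //; apply: (vrM v2) => //; case: b1V; case: a2V.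
have [gV1 gVO] := mx_1D v1 mgV; have [g1 gO] := mx_1D v2 mg.
pose e := (1 + g)^-1.
have m1 : mxi O1 (x * e).
  have -> : x * e = a1 * ((u / w) * a2) * (1 + g^-1)^-1.
    have -> : (u / w) * a2 = b1 * g^-1 by rewrite gVE; field; rewrite w0 b10.
    by rewrite xE /e; field; rewrite g0 [g + 1]addrC g1.
  by apply: mxMr => //; apply: mxM => //; apply: mxMr => //; case: a2V.
have m2 : mxi O2 (x / T * (1 - e)).
  have -> : x / T * (1 - e) = (w / u) * b1 * b2 * (1 + g)^-1.
    have -> : (w / u) * b1 = a2 * g by rewrite /g; field; rewrite a20 u0.
    by rewrite xTE /e; field; rewrite ?[g + 1]addrC.
  by do 2!apply: mxMr => //; apply: mxMr => //; case: b1V.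
have mL : mxi O2 (- (lp * (x / T * (1 - e)))) by apply: mxN => //; apply: mxM => //; apply: vr_lp.
have [D0 DV] := mx_1D v2 mL.
have TE : 1 + lp * (x * e) = T * (1 + - (lp * (x / T * (1 - e)))).
  by rewrite /T; field.
apply: (inS_div p_prime zP (a := x * e)).
- exact: h1.2.
- by rewrite TE mulf_neq0.
- apply: h2.2; rewrite TE.
  have -> : (x - x * e) / (T * (1 + - (lp * (x / T * (1 - e))))) =
    (x / T * (1 - e)) * (1 + - (lp * (x / T * (1 - e))))^-1.
    by rewrite invfM; ring.
  exact: mxMr.
Qed.

End Product.

Definition pcanon (O : K -> Prop) :=
  ((exists O', scls O') -> scls O /\ forall O', scls O' -> forall x, O' x -> O x) /\
  (~ (exists O', scls O') -> phens O /\ forall O', phens O' -> forall x, O x -> O' x).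

Lemma phens_chain O1 O2 : ~ (exists O', scls O') -> phens O1 -> phens O2 ->
  (forall x, O1 x -> O2 x) \/ (forall x, O2 x -> O1 x).
Proof.
move=> nS h1 h2; apply: contrapT => /not_orP[n1 n2]; apply: nS.
by exists (vprod O1 O2); apply: vprod_scls.
Qed.

Lemma scls_directed O1 O2 : scls O1 -> scls O2 -> exists2 O, scls O &
  (forall x, O1 x -> O x) /\ (forall x, O2 x -> O x).
Proof.
move=> h1 h2; have [s12|n12] := pselect (forall x, O1 x -> O2 x); first by exists O2.
have [s21|n21] := pselect (forall x, O2 x -> O1 x); first by exists O1.
exists (vprod O1 O2); first by apply: vprod_scls => //; [apply: h1.1|apply: h2.1].
by split=> x; [apply: vprodl h2.1 _|apply: vprodr h1.1 _].
Qed.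

(** The union of a directed family in one case and the intersection of a chain in the other. In the
    union, a unit 1 + lp x and x itself are caught in a common member together with the inverse. *)
Lemma pcanon_exists : exists O, pcanon O.
Proof.
have [[O0 s0]|nS] := pselect (exists O, scls O).
  pose U x := exists2 O, scls O & O x.
  exists U; split; last by case; exists O0.
  move=> _; split; last by move=> O' s' x Ox; exists O'.
  have dir x y : U x -> U y -> exists2 O, scls O & O x /\ O y.
    move=> [O1 s1 O1x] [O2 s2 O2y]; have [O s [i1 i2]] := scls_directed s1 s2.
    by exists O => //; split; [apply: i1|apply: i2].
  have sub O : scls O -> forall x, O x -> U x by move=> s x Ox; exists O.
  split; first split; first split.
  - by exists O0 => //; apply: (vr1 s0.1.1).
  - by move=> x y /dir h /h[O s [Ox Oy]]; exists O => //; apply: (vrB s.1.1).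
  - by move=> x y /dir h /h[O s [Ox Oy]]; exists O => //; apply: (vrM s.1.1).
  - by move=> x; case: (vrV s0.1.1 x) => h; [left|right]; exists O0.
  - by move=> x /(vr_mxS (sub _ s0)); apply: s0.1.2.
  move=> x Ux nm; have t0 := nmx_neq0 nm.
  have UV : U (1 + lp * x)^-1 by apply: contrapT => h; apply: nm; right.
  have [O s [Ox OV]] := dir _ _ Ux UV; apply: (s.2 x Ox); apply: mx_unit => //; exact: s.1.1.
pose I x := forall O, phens O -> O x.
exists I; split; first by move=> /nS.
move=> _; split; last by move=> O h x; apply.
split; first split.
- by move=> O h; apply: (vr1 h.1).
- by move=> x y Ix Iy O h; apply: (vrB h.1); [apply: Ix|apply: Iy].
- by move=> x y Ix Iy O h; apply: (vrM h.1); [apply: Ix|apply: Iy].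
- move=> x; apply: contrapT => /not_orP[/existsNP[O1 /not_implyP[h1 n1]] /existsNP[O2 /not_implyP[h2 n2]]].
  case: (phens_chain nS h1 h2) => s.
    by case: (vrV h1.1 x) => // /s.
  by case: (vrV h2.1 x) => // /s.
- move=> x [->|/existsNP[O /not_implyP[h n]]]; first exact: inS0.
  by apply: h.2; right.
Qed.

Lemma pcanon_phens O : pcanon O -> phens O.
Proof.
move=> [c d]; have [e|ne] := pselect (exists O', scls O'); first by have [[]] := c e.
by have [] := d ne.
Qed.

Lemma scls_ext O O' : (forall x, O x <-> O' x) -> scls O -> scls O'.
Proof.
move=> h; suff -> : O' = O by [].
by apply/funext => x; apply/propext; rewrite h.
Qed.

End OnField.
End Classes.

(** * Reduction modulo m and composition of valuations *)

Section ResMore.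
Variables (K : fieldType) (v : valuation K).
Local Notation O := (ring_of v).
Let vO : valring O := ring_of_valring v.

Lemma res0 : res v 0 = 0.
Proof. by rewrite -(subrr 1) resB ?subrr //; apply: (vr1 vO). Qed.
Lemma resN x : O x -> res v (- x) = - res v x.
Proof. by move=> Ox; rewrite -sub0r resB ?res0 ?sub0r //; apply: vr0. Qed.
Lemma resD x y : O x -> O y -> res v (x + y) = res v x + res v y.
Proof. by move=> Ox Oy; rewrite -[y]opprK resB ?resN ?opprK //; apply: vrN. Qed.
Lemma resX x n : O x -> res v (x ^+ n) = res v x ^+ n.
Proof.
move=> Ox; elim: n => [|n IH]; first by rewrite !expr0 res1.
by rewrite !exprS resM ?IH //; apply: vrX.
Qed.
Lemma res_sum (I : Type) (r : seq I) (F : I -> K) : (forall i, O (F i)) ->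
  res v (\sum_(i <- r) F i) = \sum_(i <- r) res v (F i).
Proof.
move=> OF; elim: r => [|i r IH]; first by rewrite !big_nil res0.
by rewrite !big_cons resD ?IH //; apply: vr_sum.
Qed.
Lemma res_prod (I : Type) (r : seq I) (F : I -> K) : (forall i, O (F i)) ->
  res v (\prod_(i <- r) F i) = \prod_(i <- r) res v (F i).
Proof.
move=> OF; elim: r => [|i r IH]; first by rewrite !big_nil res1.
by rewrite !big_cons resM ?IH //; apply: vr_prod.
Qed.
Lemma res_eq x y : O x -> O y -> res v x = res v y <-> mxi O (x - y).
Proof.
move=> Ox Oy; rewrite -res_eq0; last exact: (vrB vO).
rewrite resB //; split=> [->|/eqP]; first by rewrite subrr.
by rewrite subr_eq0 => /eqP.
Qed.
Lemma resV x : O x -> O x^-1 -> res v x^-1 = (res v x)^-1.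
Proof.
move=> Ox OVx; have [->|x0] := eqVneq x 0; first by rewrite !(invr0, res0).
have e : res v x * res v x^-1 = 1 by rewrite -resM // divff // res1.
have r0 : res v x != 0.
  by apply: contraTneq (oner_neq0 (residue_field v)) => r0; rewrite -e r0 mul0r eqxx.
by apply: (mulfI r0); rewrite e divff.
Qed.
End ResMore.

Section ResidueClasses.
Variables (p : nat) (p_prime : prime p) (K : fieldType) (z : K) (zP : qnat z p = 0).
Local Notation lp := ((z - 1) ^+ p).
Local Notation S := (inS p z).

Section OneValuation.
Variables (v : valuation K).
Local Notation O := (ring_of v).
Let vO : valring O := ring_of_valring v.
Let zb := res v z.

Lemma res_qnat k : res v (qnat z k) = qnat zb k.
Proof.
rewrite res_sum => [|i]; last by apply: vrX => //; apply: (vr_zeta p_prime zP).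
by apply: eq_bigr => i _; rewrite resX //; apply: (vr_zeta p_prime zP).
Qed.

Lemma res_zP : qnat zb p = 0. Proof. by rewrite -res_qnat zP res0. Qed.

Lemma res_kas y : O y -> res v (kas p z y) = kas p zb (res v y).
Proof.
move=> Oy; have Oq k : O (qnat z k) := vr_qnat p_prime zP vO k.
rewrite res_prod => [|i]; last exact: (vrB vO).
by apply: eq_bigr => i _; rewrite resB // res_qnat.
Qed.

Lemma res_lp : res v lp = (zb - 1) ^+ p.
Proof.
have Oz : O z := vr_zeta p_prime zP vO.
by rewrite resX ?resB ?res1 //; [apply: (vr1 vO)|apply: (vrB vO) => //; apply: (vr1 vO)].
Qed.

Lemma res_lpE x : O x -> res v (1 + lp * x) = 1 + (zb - 1) ^+ p * res v x.
Proof.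
move=> Ox; have Ol := vr_lp p_prime zP vO.
by rewrite resD ?resM ?res_lp ?res1 //; [apply: (vr1 vO)|apply: (vrM vO)].
Qed.

Lemma vr_lpE x : O x -> O (1 + lp * x).
Proof. by move=> Ox; apply: vrD => //; [apply: (vr1 vO)|apply: (vrM vO) => //; apply: (vr_lp p_prime zP)]. Qed.

Lemma res_lp_eq0 x : O x -> 1 + (zb - 1) ^+ p * res v x = 0 <-> mxi O (1 + lp * x).
Proof. by move=> Ox; rewrite -res_lpE // res_eq0 //; apply: vr_lpE. Qed.

Lemma res_inS x : O x -> S x -> inS p zb (res v x).
Proof.
move=> Ox [y xE]; exists (res v y); rewrite -res_kas ?xE //.
by apply: (vr_kas_inv p_prime zP vO); rewrite xE.
Qed.

Hypothesis hens : phens p z O.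

(** A root over the residue field lifts to some y with x - f(y) in m, and the quotient of x by f(y)
    for [tmul] is then in m, hence in S. *)
Lemma inS_res x : O x -> ~ mxi O (1 + lp * x) -> inS p zb (res v x) -> S x.
Proof.
move=> Ox u [yb]; have [y Oy <-] := res_surj yb; rewrite -res_kas // => e.
have Of := vr_kas p_prime zP vO Oy.
apply: (phens_lift_S p_prime zP vO (y := y)) => //.
  by rewrite -res_lp_eq0 // e res_lp_eq0.
by apply/res_eq.
Qed.

Lemma scls_resP : scls p z O <-> forall a : residue_field v, inS p zb a.
Proof.
split=> [[_ h] a|h].
  have [x Ox <-] := res_surj a; have [e|ne] := pselect (mxi O (1 + lp * x)).
    (* Here the residue is the element without inverse for [tmul], which is in S anyway. *)
    apply: contrapT => /(notS_neq0 p_prime res_zP)/eqP; apply.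
    by apply/res_lp_eq0.
  by apply: res_inS => //; apply: h.
by split=> // x Ox u; apply: inS_res.
Qed.

Lemma scls_closed : scls p z O <-> p_closed p (residue_field v).
Proof. by rewrite scls_resP; apply: iff_sym; apply: (p_closedP p_prime res_zP). Qed.

Section Pullback.
Variables (Q : residue_field v -> Prop) (hQ : phens p zb Q).

(** The ring of the composite valuation. It is finer than O, and equal to O only if Q is the whole
    residue field; so the residue field of a finest ring has only the trivial p-henselian ring. *)
Definition pullback x := O x /\ Q (res v x).

Lemma pullback_phens : phens p z pullback.
Proof.
have vQ := hQ.1; split; first split.
- by split; [apply: (vr1 vO)|rewrite res1; apply: (vr1 vQ)].
- by move=> x y [Ox Qx] [Oy Qy]; split; [apply: (vrB vO)|rewrite resB //; apply: (vrB vQ)].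
- by move=> x y [Ox Qx] [Oy Qy]; split; [apply: (vrM vO)|rewrite resM //; apply: (vrM vQ)].
- move=> x; have [nx|Ox] := pselect (O x); last first.
    have mx := nvr_mx Ox; right; split; first exact: mx_sub mx.
    by rewrite (res_eq0 (mx_sub vO mx)).2 //; apply: (vr0 vQ).
  have [nv|OV] := pselect (O x^-1); last first.
    have mx : mxi O x by right.
    by left; split=> //; rewrite (res_eq0 nx).2 //; apply: (vr0 vQ).
  by case: (vrV vQ (res v x)) => h; [left|right; split=> //; rewrite resV].
- move=> x mx; have [->|x0] := eqVneq x 0; first exact: inS0.
  case: mx => [/eqP|nx]; first by rewrite (negPf x0).
  have [OV|nV] := pselect (O x^-1); last by apply: hens.2; right.
  have nQ : ~ Q (res v x^-1) by move=> h; apply: nx.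
  have [Ox u] : O x /\ ~ mxi O x^-1.
    have nm : ~ mxi O x^-1 by move=> /(res_eq0 OV) e; apply: nQ; rewrite e; apply: (vr0 vQ).
    by split=> //; have := nmx_vr nm; rewrite invrK.
  have mQ : mxi Q (res v x) by right; rewrite -resV.
  have [n0 _] := mx_1D vQ (mxM vQ (vr_lp p_prime res_zP vQ) mQ).
  apply: inS_res => //; last exact: hQ.2.
  by move=> /(res_lp_eq0 Ox)/eqP; apply/negP.
Qed.

End Pullback.
End OneValuation.

Lemma ring_of_ofE (O : K -> Prop) (vO : valring O) : ring_of (valuation_of_ring vO) = O.
Proof. by apply/funext => x; apply/propext; apply: ring_of_valuation_of_ring. Qed.

Lemma phensP (v : valuation K) : p_henselian p v <-> phens p z (ring_of v).
Proof.
rewrite (p_henselianP p_prime zP); split=> [h|[]] //.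
by split=> //; apply: ring_of_valring.
Qed.

Lemma sclsP (v : valuation K) :
  (p_henselian p v /\ p_closed p (residue_field v)) <-> scls p z (ring_of v).
Proof.
rewrite phensP; split=> [[h c]|s]; first by apply/scls_closed.
by split; [apply: s.1|apply/scls_closed => //; apply: s.1].
Qed.

Lemma is_canonicalP (v : valuation K) : is_canonical p v <-> pcanon p z (ring_of v).
Proof.
have ex : (exists w, p_henselian p w /\ p_closed p (residue_field (w : valuation K))) <-> exists O, scls p z O.
  split=> [[w /sclsP s]|[O s]]; first by exists (ring_of w).
  by exists (valuation_of_ring s.1.1); apply/sclsP; rewrite ring_of_ofE.
split=> -[c d]; split=> e.
- have [s m] := c (ex.2 e); split; first exact/sclsP.
  move=> O sO x Ox; have /m : p_henselian p (valuation_of_ring sO.1.1) /\ p_closed p (residue_field (valuation_of_ring sO.1.1)).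
    by apply/sclsP; rewrite ring_of_ofE.
  by apply; apply/(ring_of_valuation_of_ring sO.1.1).
- have [|s m] := d; first by move/ex.
  split; first exact/phensP.
  move=> O sO x Ox; have /m h : p_henselian p (valuation_of_ring sO.1) by apply/phensP; rewrite ring_of_ofE.
  exact: (ring_of_valuation_of_ring sO.1 x).1 (h x Ox).
- have [s m] := c (ex.1 e); split; first exact/sclsP.
  by move=> w /sclsP sw x; exact: (m _ sw x).
- have [|s m] := d; first by move/ex.
  split; first exact/phensP.
  by move=> w /phensP sw x; exact: (m _ sw x).
Qed.

Lemma canonical_pcanon : pcanon p z (ring_of (canonical_valuation p K)).
Proof.
rewrite /canonical_valuation; case: pselect => [ex|nex]; last first.
  case: nex; have [O cO] := pcanon_exists p_prime zP; have h := pcanon_phens cO.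
  by exists (valuation_of_ring h.1); apply/is_canonicalP; rewrite ring_of_ofE.
by case: (cid ex) => v /= /is_canonicalP.
Qed.

End ResidueClasses.

(** * Defining the coarsest p-henselian ring with p-closed residue field *)

Section Coarsest.
Variables (p : nat) (p_prime : prime p) (K : fieldType) (z : K) (zP : qnat z p = 0).
Local Notation lam := (z - 1).
Local Notation lp := (lam ^+ p).
Local Notation S := (inS p z).
Local Notation f := (kas p z).

Lemma inS_pow y : lam != 0 -> S y <-> exists c, 1 + lp * y = c ^+ p.
Proof.
move=> l0; split=> [[u <-]|[c e]]; first by exists (1 + lam * u); apply: kasE.
exists ((c - 1) / lam); have lp0 : lp != 0 by rewrite expf_neq0.
apply: (mulfI lp0); apply: (addrI 1); rewrite (kasE p_prime zP) e; congr (_ ^+ p).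
by field.
Qed.

(* b x^4 / (b^2 + x^4) is in S; for b outside of O it is small if x is in O, and close to b if x is
   much larger than b. The inverse c of b for tmul takes care of the b in O such that 1 + lp b is
   in m, for then c is not in O. *)
Definition hS b x := exists y, f y * (b ^+ 2 + x ^+ 4) = b * x ^+ 4.

Definition coarseN x := forall b, ~ S b -> forall c, tmul lp b c = 0 -> hS b x \/ hS c x.

Section Overring.
Variables (O : K -> Prop) (vO : valring O).

(** For x outside of O this is O[x], the smallest ring containing O and x: a candidate for a
    strictly coarser ring, to contradict the choice of O. *)
Definition vadj x y := exists n, O (y / x ^+ n).

Section AdjElement.
Variables (x : K) (xO : ~ O x).
Let x0 : x != 0 := nvr_neq0 vO xO.

Lemma vadj_leq y n m : (n <= m)%N -> O (y / x ^+ n) -> O (y / x ^+ m).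
Proof.
move=> nm h; have -> : y / x ^+ m = y / x ^+ n * x^-1 ^+ (m - n).
  by rewrite -mulrA exprVn -invfM -exprD subnKC.
by apply: (vrM vO) => //; apply: vrX => //; apply: nvr_vr.
Qed.

Lemma vadjl y : O y -> vadj x y.
Proof. by exists 0%N; rewrite expr0 divr1. Qed.

Lemma vadj_gen : vadj x x.
Proof. by exists 1%N; rewrite expr1 divff //; apply: (vr1 vO). Qed.

Lemma vadj_valring : valring (vadj x).
Proof.
split.
- exact/vadjl/(vr1 vO).
- move=> a b [n na] [m mb]; exists (maxn n m); rewrite mulrBl; apply: (vrB vO).
    exact: vadj_leq (leq_maxl _ _) na.
  exact: vadj_leq (leq_maxr _ _) mb.
- move=> a b [n na] [m mb]; exists (n + m)%N.
  by rewrite exprD invfM mulrACA; apply: (vrM vO).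
- by move=> a; case: (vrV vO a) => h; [left|right]; apply: vadjl.
Qed.

Lemma vadj_max y : mxi (vadj x) y -> mxi O y.
Proof. by apply: vr_mxS; apply: vadjl. Qed.

Lemma vadj_phens : phens p z O -> phens p z (vadj x).
Proof.
by move=> h; split; [exact: vadj_valring|move=> y /vadj_max/h.2].
Qed.

End AdjElement.

Hypothesis hO : phens p z O.

Section UnitLam.
Variables (x : K) (xO : ~ O x) (ul : ~ mxi O lam).
Hypothesis H : forall b, O (b / x) -> ~ mxi O (1 + lp * b) -> S b.

(** Since lam is invertible, membership of b in S means that 1 + lp b is a p-th power. By hypothesis
    all c in x O outside of m are p-th powers, in particular x; dividing by x repeatedly, this
    extends to O[x]. *)
Lemma unit_lam_scls : scls p z (vadj x).
Proof.
split; first exact: vadj_phens.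
have l0 := nmx_neq0 ul; have lp0 : lp != 0 by rewrite expf_neq0.
have x0 := nvr_neq0 vO xO.
pose T c := exists d : K, c = d ^+ p.
have T1 c : O (c / x) -> ~ mxi O c -> T c.
  move=> cx cm; have e : 1 + lp * ((c - 1) / lp) = c by field.
  have /(inS_pow _ l0)[d] : S ((c - 1) / lp).
    apply: H; last by rewrite e.
    have -> : (c - 1) / lp / x = (lam^-1) ^+ p * (c / x - x^-1) by rewrite exprVn; ring.
    apply: (vrM vO); first by apply: vrX => //; apply: nmx_vr.
    by apply: (vrB vO) => //; apply: nvr_vr.
  by rewrite e; exists d.
have Tx : T x by apply: T1; rewrite ?divff //; [apply: (vr1 vO)|apply: nmx_nvr].
have TM c d : T c -> T d -> T (c * d) by move=> [c' ->] [d' ->]; exists (c' * d'); rewrite exprMn.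
have T2 n c : O (c / x ^+ n) -> ~ mxi O c -> T c.
  elim: n c => [|n IH] c cn cm.
    apply: T1 => //; apply: (vrM vO); last exact: nvr_vr.
    by rewrite expr0 divr1 in cn.
  have [h|h] := pselect (O (c / x)); first exact: T1.
  rewrite -(divfK x0 c); apply: TM => //; apply: IH; last exact: nmx_nvr.
  by rewrite -mulrA -invfM -exprS.
have T3 c : vadj x c -> ~ mxi O c -> T c by move=> [n /T2]; apply.
move=> y Ay u; apply/(inS_pow _ l0); set t := 1 + lp * y in u *.
have vA := vadj_valring xO.
have At : vadj x t.
  apply: vrD => //; [apply: (vr1 vA)|apply: (vrM vA) => //].
  by apply: vadjl; apply: (vr_lp p_prime zP).
(* A unit of O[x] may lie in m, but then its inverse does not. *)
have [mt|] := pselect (mxi O t); last exact: T3.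
have [d e] : T t^-1.
  apply: T3; first exact: nmx_vr u.
  by apply: mx_unit; rewrite ?invrK ?invr_eq0; [exact: mx_sub mt|exact: nmx_neq0 u].
by exists d^-1; rewrite exprVn -e invrK.
Qed.

End UnitLam.

Section SmallLam.
Variables (x : K) (xO : ~ O x) (mx : mxi O (lp * x)).
Hypothesis H : forall b, O (b / x) -> ~ mxi O (1 + lp * b) -> S b.
Let x0 : x != 0 := nvr_neq0 vO xO.
Let Oq k : O (qnat z k). Proof. exact: (vr_qnat p_prime zP). Qed.

Let H' b : O (b / x) -> S b.
Proof.
move=> h; apply: H => //; apply: nmx_1D => //.
have -> : lp * b = b / x * (lp * x) by field.
exact: mxM.
Qed.

(** A p-th power up to a 1-unit: for small lam this is what survives of f(s), which is s^p (1 + r)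
    with r in m for s outside of O. *)
Let T c := exists d r, [/\ mxi O r, d != 0 & c = d ^+ p * (1 + r)].

Let TM c d : T c -> T d -> T (c * d).
Proof.
move=> [c1 [r [mr c10 ->]]] [d1 [q [mq d10 ->]]].
exists (c1 * d1), (r + q + r * q); split; last by rewrite exprMn; ring.
  by apply: (mxD vO); [apply: mxD|apply: mxM => //; apply: mx_sub].
by rewrite mulf_neq0.
Qed.

Let kas_large s : ~ O s -> exists2 r, O (r * s) & f s = s ^+ p * (1 + r).
Proof.
move=> sO; have s0 := nvr_neq0 vO sO; have ms := nvr_mx sO.
have -> : f s = s ^+ p * \prod_(i < p) (1 - qnat z i / s).
  rewrite /kas -[p in s ^+ p]card_ord -prodr_const -big_split /=; apply: eq_bigr => i _.
  by field.
suff [r Or ->] : exists2 r, O (r * s) & \prod_(i < p) (1 - qnat z i / s) = 1 + r by exists r.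
elim/big_ind: _ => [|a b [r Or ->] [q Oq' ->]|i _].
- by exists 0; rewrite ?mul0r ?addr0 //; apply: vr0.
- exists (r + q + r * q); last by ring.
  rewrite !mulrDl; apply: vrD => //; first exact: vrD.
  have -> : r * q * s = (r * s) * (q * s) * s^-1 by field.
  by apply: (vrM vO); [apply: (vrM vO)|apply: mx_sub].
- by exists (- (qnat z i / s)); rewrite // mulNr divfK //; apply: vrN.
Qed.

Let small_mx s r : ~ O s -> O (r * s) -> mxi O r.
Proof.
move=> sO h; have -> : r = r * s * s^-1 by rewrite mulfK // (nvr_neq0 vO sO).
by apply: mxM => //; apply: nvr_mx.
Qed.

Let Tn c : vadj x c -> ~ O c -> T c.
Proof.
have T1 b : O (b / x) -> ~ O b -> T b.
  move=> bx bO; have [s bE] := H' bx; have sO : ~ O s.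
    by move=> h; apply: bO; rewrite -bE; apply: (vr_kas p_prime zP).
  have [r Or fE] := kas_large sO; exists s, r; split; [exact: small_mx Or| |by rewrite -bE].
  exact: nvr_neq0 sO.
have Tx : T x by apply: T1; rewrite ?divff //; apply: (vr1 vO).
move=> [n]; elim: n c => [|n IH] c cn cO.
  by case: cO; rewrite expr0 divr1 in cn.
have [h|h] := pselect (O (c / x)); first exact: T1.
rewrite -(divfK x0 c); apply: TM => //; apply: IH => //.
by rewrite -mulrA -invfM -exprS.
Qed.

(* Successive approximation: f(d s) is close to w, and the error w' is smaller than w by a factor s. *)
Let claimZ w : vadj x w -> mxi O (lp * w) -> S w.
Proof.
have [s0 xE] : S x by apply: H'; rewrite divff //; apply: (vr1 vO).
have s0O : ~ O s0 by move=> h; apply: xO; rewrite -xE; apply: (vr_kas p_prime zP).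
have s00 := nvr_neq0 vO s0O.
have [r0 Or0 x0E] := kas_large s0O; have mr0 := small_mx s0O Or0.
have [r01 r0V] := mx_1D vO mr0.
suff Z n u : O (u / s0 ^+ n) -> vadj x u -> mxi O (lp * u) -> S u.
  move=> Aw mw; have [n wn] := Aw; apply: (Z (p * n)%N) => //.
  have -> : w / s0 ^+ (p * n) = w / x ^+ n * (1 + r0) ^+ n.
    by rewrite -xE x0E exprMn -exprM; field; rewrite !expf_neq0.
  by apply: (vrM vO) => //; apply: vrX => //; apply: vrD => //; [apply: (vr1 vO)|apply: mx_sub].
elim: n u => [|n IH] u un Au mu.
  apply: H'; apply: (vrM vO); last exact: nvr_vr.
  by rewrite expr0 divr1 in un.
have [h|h] := pselect (O (u / x)); first exact: H'.
have vA := vadj_valring xO.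
have [d [r [mr d0 uE]]] : T (u / x).
  apply: Tn => //; apply: (vrM vA) => //; apply: vadjl.
  exact: nvr_vr.
have dO : ~ O d.
  move=> Od; apply: h; rewrite uE; apply: (vrM vO); first exact: vrX.
  by apply: vrD => //; [apply: (vr1 vO)|apply: mx_sub].
pose y := x * (1 + r); have [r1 rV] := mx_1D vO mr.
have uyE : u = d ^+ p * y by rewrite /y mulrCA -uE mulrC divfK.
have [s yE] : S y.
  by apply: H'; rewrite /y mulrAC divff // mul1r; apply: vrD => //; [apply: (vr1 vO)|apply: mx_sub].
have sO : ~ O s.
  move=> Os; apply: xO; have -> : x = y * (1 + r)^-1 by rewrite /y mulfK.
  by apply: (vrM vO) => //; rewrite -yE; apply: (vr_kas p_prime zP).
have s_0 := nvr_neq0 vO sO.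
have dsO : ~ O (d * s).
  move=> h'; apply: sO; rewrite -[s](mulKf d0) ; apply: (vrM vO) => //; exact: nvr_vr.
have [r1' Or1 fsE] := kas_large sO; have [r2 Or2 fdsE] := kas_large dsO.
have mr1 := small_mx sO Or1; have mr2 := small_mx dsO Or2.
have [r11 r1V] := mx_1D vO mr1; have [r21 r2V] := mx_1D vO mr2.
have uE2 : u = (d * s) ^+ p * (1 + r1') by rewrite uyE -yE fsE exprMn mulrA.
have Or2s : O (r2 * s).
  have -> : r2 * s = r2 * (d * s) * d^-1 by rewrite mulrA mulrAC mulfK.
  by apply: (vrM vO) => //; apply: nvr_vr.
have fu : f (d * s) = u * ((1 + r2) * (1 + r1')^-1) by rewrite fdsE uE2; field.
have mfu : mxi O (lp * f (d * s)).
  rewrite fu mulrA; apply: mxMr => //; apply: (vrM vO) => //.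
  by apply: vrD => //; [apply: (vr1 vO)|apply: mx_sub].
have [F0 FV] := mx_1D vO mfu.
apply: (inS_div p_prime zP (a := f (d * s))) => //; first by exists (d * s).
set w' := _ / _.
(* Up to units, s^p is f(s) = y, s0^p is f(s0) = x, and x and y differ by a unit. So the factor s
   gained in the error is a factor s0, the scale of the induction. *)
have s0s : O (s0 / s).
  have : O ((s0 / s) ^+ p).
    have -> : (s0 / s) ^+ p = (1 + r1') * (1 + r)^-1 * (1 + r0)^-1.
      have sp : s ^+ p * (1 + r1') = s0 ^+ p * (1 + r0) * (1 + r) by rewrite -fsE yE /y -x0E xE.
      have sp0 : s ^+ p != 0 by rewrite expf_neq0.
      rewrite expr_div_n; have -> : s0 ^+ p = s ^+ p * (1 + r1') / ((1 + r0) * (1 + r)) by rewrite sp; field; rewrite r01 r1.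
      by field; rewrite r1 r01 sp0.
    apply: (vrM vO) => //; apply: (vrM vO) => //.
    by apply: vrD => //; [apply: (vr1 vO)|apply: mx_sub].
  move=> hp; apply: contrapT => /(nvr_mx)/(mxXn vO (prime_gt0 p_prime)) m1.
  have := mx_vr _ m1; rewrite -exprVn invrK expf_neq0 ?invr_eq0 ?mulf_neq0 ?invr_eq0 //.
  by move/(_ isT).
have w'E : w' = u * ((r1' - r2) * (1 + r1')^-1 * (1 + lp * f (d * s))^-1).
  by rewrite /w' {1}fu; field; rewrite r11 F0.
have Ow' : O ((r1' - r2) * s0).
  have -> : (r1' - r2) * s0 = (r1' * s - r2 * s) * (s0 / s) by field.
  by apply: (vrM vO) => //; apply: (vrB vO).
have mq : mxi O ((r1' - r2) * (1 + r1')^-1 * (1 + lp * f (d * s))^-1).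
  by do 2!apply: mxMr => //; apply: mxB.
apply: IH.
- have -> : w' / s0 ^+ n = u / s0 ^+ n.+1 * ((r1' - r2) * s0) * ((1 + r1')^-1 * (1 + lp * f (d * s))^-1).
    by rewrite w'E exprS; field; rewrite expf_neq0 // s00 r11 F0.
  by apply: (vrM vO); apply: (vrM vO).
- by rewrite w'E; apply: (vrM vA) => //; apply: vadjl; apply: mx_sub.
- by rewrite w'E mulrA; apply: mxMr => //; apply: mx_sub.
Qed.

(** If lam is in the maximal ideal of O[x], [claimZ] applies to all of O[x]. Otherwise lam is a unit
    there, [claimZ] makes the 1-units of O p-th powers, and with [Tn] all elements of O[x] outside
    of O. *)
Lemma small_lam_scls : scls p z (vadj x).
Proof.
split; first exact: vadj_phens.
move=> y Ay u; have vA := vadj_valring xO.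
have [[l0 Al]|nl] := pselect (lam != 0 /\ vadj x lam^-1); last first.
  have mlA : mxi (vadj x) lam.
    have [->|l0] := eqVneq lam 0; first by left.
    by right=> h; apply: nl.
  apply: claimZ => //; apply: (vadj_max (x := x)); apply: mxMr => //.
  exact: (mxXn vA (prime_gt0 p_prime)).
have lp0 : lp != 0 by rewrite expf_neq0.
pose P c := exists d : K, c = d ^+ p.
have PM c d : P c -> P d -> P (c * d) by move=> [c' ->] [d' ->]; exists (c' * d'); rewrite exprMn.
have PV c : P c -> P c^-1 by move=> [d ->]; exists d^-1; rewrite exprVn.
have P1 r : mxi O r -> P (1 + r).
  move=> mr; have /(inS_pow _ l0)[d] : S (r / lp).
    apply: claimZ; last by rewrite mulrC divfK.
    apply: (vrM vA); first by apply: vadjl; apply: mx_sub.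
    by rewrite -exprVn; apply: vrX.
  by rewrite mulrC divfK // => ->; exists d.
have PN c : vadj x c -> ~ O c -> P c.
  by move=> Ac cO; have [d [r [mr _ ->]]] := Tn Ac cO; apply: PM; [exists d|apply: P1].
apply/(inS_pow _ l0); set t := 1 + lp * y in u *.
have At : vadj x t.
  apply: vrD => //; [apply: (vr1 vA)|apply: (vrM vA) => //].
  by apply: vadjl; apply: (vr_lp p_prime zP).
have t0 := nmx_neq0 u; have AtV := nmx_vr u.
have [Ot|] := pselect (O t); last exact: PN.
have [OtV|nV] := pselect (O t^-1); last by rewrite -[t]invrK; apply/PV/PN.
(* A unit t of O is the quotient of t x by x, both outside of O. *)
rewrite -(mulfK x0 t); apply: (PM _ _ _ (PV _ (PN _ (vadj_gen xO) xO))); apply: PN.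
  by apply: (vrM vA) => //; apply: vadj_gen.
by move=> h; apply: xO; rewrite -(mulKf t0 x); apply: (vrM vO).
Qed.

End SmallLam.
End Overring.

Section Perturb.
Variables (O : K -> Prop) (hO : phens p z O).
Let vO := hO.1.

(** For [tmul], b and b - r differ by an element of m, which is in S. *)
Lemma inS_perturb b r : ~ S b -> mxi O (r / (1 + lp * b)) -> ~ S (b - r).
Proof.
move=> nb mr Sr; apply: nb.
have [E|E] := eqVneq (1 + lp * b) 0.
  by apply: contrapT => /(notS_neq0 p_prime zP); rewrite E eqxx.
have m2 : mxi O (- (lp * (r / (1 + lp * b)))).
  by apply: mxN => //; apply: mxM => //; apply: (vr_lp p_prime zP).
have [D0 DV] := mx_1D vO m2.
have e : 1 + lp * (b - r) = (1 + lp * b) * (1 - lp * (r / (1 + lp * b))) by field.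
apply: (inS_div p_prime zP Sr); rewrite e; first exact: mulf_neq0.
apply: hO.2; rewrite subKr invfM mulrA; exact: mxMr.
Qed.

End Perturb.

Section Canonical.
Variables (O : K -> Prop) (sO : scls p z O) (maxO : forall O', scls p z O' -> forall x, O' x -> O x).
Let hO := sO.1.
Let vO := hO.1.

(** Without such b, O[x] would be a strictly coarser ring with p-closed residue field. The two
    lemmas above need lam to be a unit or lp x to be in m; in the remaining case 1/lam takes the
    role of x. *)
Lemma coarse_witness x : ~ O x -> exists b, [/\ ~ S b, O (b / x) & ~ mxi O (1 + lp * b)].
Proof.
move=> xO; apply: contrapT => /forallNP nb.
have H b : O (b / x) -> ~ mxi O (1 + lp * b) -> S b.
  by move=> h1 h2; apply: contrapT => h3; apply: (nb b).
have [ml|ul] := pselect (mxi O lam); last first.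
  by apply: (xO); apply: (maxO (unit_lam_scls vO hO xO ul H)); apply: vadj_gen.
have [mx|nx] := pselect (mxi O (lp * x)).
  by apply: (xO); apply: (maxO (small_lam_scls vO hO xO mx H)); apply: vadj_gen.
have lx0 := nmx_neq0 nx; have lx := nmx_vr nx.
have [lp0 x0] : lp != 0 /\ x != 0 by move: lx0; rewrite mulf_eq0 negb_or => /andP.
have l0 : lam != 0 by apply: contraNneq lp0 => ->; rewrite expr0n; case: (p) p_prime.
have lO : ~ O lam^-1 := mx_vr l0 ml.
have pE : lp = lam * lam ^+ p.-1 by rewrite -exprS prednK // prime_gt0.
have p1 : (0 < p.-1)%N by rewrite -subn1 subn_gt0 prime_gt1.
have Ol := mx_sub vO ml.
(* As 1/(lp x) is in O, everything in O/lam is in x O, so the hypothesis on x is inherited; and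
   lp/lam = lam^(p-1) is in m because p > 1. *)
apply: (lO); apply: (maxO _ (vadj_gen vO lO)); apply: small_lam_scls => //.
  by rewrite pE mulrAC divff // mul1r; apply: mxXn.
move=> b; rewrite invrK => Ob; apply: H.
have -> : b / x = b * lam * lam ^+ p.-1 * (lp * x)^-1.
  by rewrite -[b * lam * _]mulrA -pE; field; rewrite x0 lp0.
by apply: (vrM vO) => //; apply: (vrM vO) => //; apply: vrX.
Qed.

Lemma hS_inS b x : b ^+ 2 + x ^+ 4 != 0 -> hS b x <-> S (b * x ^+ 4 / (b ^+ 2 + x ^+ 4)).
Proof.
by move=> d0; split=> -[y e]; exists y; [rewrite -e mulfK|rewrite e divfK].
Qed.

Lemma hS_large b x : ~ O b -> O x -> hS b x.
Proof.
move=> bO Ox; have b0 := nvr_neq0 vO bO; have mb := nvr_mx bO.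
pose r := (x ^+ 2 / b) ^+ 2.
have mr : mxi O r by apply: (mxXn vO) => //; apply: mxM => //; apply: vrX.
have [r0 rV] := mx_1D vO mr.
have dE : b ^+ 2 + x ^+ 4 = b ^+ 2 * (1 + r) by rewrite /r; field.
apply/hS_inS; first by rewrite dE mulf_neq0 ?expf_neq0.
apply: hO.2; rewrite dE.
have -> : b * x ^+ 4 / (b ^+ 2 * (1 + r)) = (x ^+ 4 * (1 + r)^-1) * b^-1 by field; rewrite b0 r0.
by apply: mxM => //; apply: (vrM vO) => //; apply: vrX.
Qed.

(** The exponents 2 and 4 are made for this: up to a unit, b differs from b x^4 / (b^2 + x^4) by b^3
    / x^4 = (b / x)^3 / x, which is in m for b in x O. *)
Lemma hS_small b x : ~ O x -> ~ S b -> O (b / x) ->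
  mxi O (b * (b ^+ 2 / x ^+ 4) / (1 + lp * b)) -> ~ hS b x.
Proof.
move=> xO nb bx mr.
have x0 := nvr_neq0 vO xO; have mx := nvr_mx xO.
pose r := b ^+ 2 / x ^+ 4.
have mr' : mxi O r.
  have -> : r = (b / x) ^+ 2 * x^-1 ^+ 2 by rewrite /r; field.
  by apply: mxM => //; [apply: vrX|apply: mxXn].
have [r0 rV] := mx_1D vO mr'.
have dE : b ^+ 2 + x ^+ 4 = x ^+ 4 * (1 + r) by rewrite /r; field.
move=> /hS_inS; rewrite dE mulf_neq0 ?expf_neq0 // => /(_ isT).
have -> : b * x ^+ 4 / (x ^+ 4 * (1 + r)) = b - b * r / (1 + r) by field; rewrite x0 r0.
apply: (inS_perturb hO) => //.
have -> : b * r / (1 + r) / (1 + lp * b) = (b * r / (1 + lp * b)) / (1 + r) by rewrite mulrAC.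
exact: mxMr.
Qed.

Lemma coarseNP x : coarseN x <-> O x.
Proof.
split=> [Nx|Ox b nb c bc].
  apply: contrapT => xO; have [b [nb bx u]] := coarse_witness xO.
  have t0 := nmx_neq0 u; have tV := nmx_vr u; have mx := nvr_mx xO.
  have x0 := nvr_neq0 vO xO.
  have r3 a : O a -> mxi O ((b / x) ^+ 3 * a / x).
    by move=> Oa; apply: mxM => //; apply: (vrM vO) => //; apply: vrX.
  pose c := tinv lp b; have cE : tmul lp b c = 0 := tmulV t0.
  have tE : 1 + lp * c = (1 + lp * b)^-1 := tinvE t0.
  have nc : ~ S c.
    move=> Sc; apply: nb; have : 1 + lp * c != 0 by rewrite tE invr_eq0.
    move=> c0; have := inS_tinv p_prime zP Sc c0; rewrite /tinv tE invrK /c /tinv.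
    by rewrite mulNr divfK // opprK.
  case: (Nx b nb c cE).
    apply: hS_small => //.
    have -> : b * (b ^+ 2 / x ^+ 4) / (1 + lp * b) = (b / x) ^+ 3 * (1 + lp * b)^-1 / x by field; rewrite x0 t0.
    exact: r3.
  apply: hS_small => //.
    have -> : c / x = - (b / x * (1 + lp * b)^-1) by rewrite /c /tinv; field; rewrite x0 t0.
    by apply: vrN => //; apply: (vrM vO).
  have -> : c * (c ^+ 2 / x ^+ 4) / (1 + lp * c) = - ((b / x) ^+ 3 * (1 + lp * b)^-1 ^+ 2 / x).
    by rewrite tE invrK /c /tinv; field; rewrite x0 t0.
  by apply: mxN => //; apply: r3; apply: vrX.
have t0 := notS_neq0 p_prime zP nb.
have cE : c = - b / (1 + lp * b).
  by apply: (mulIf t0); rewrite divfK // -[LHS]subr0 -bc /tmul; ring.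
have [Ob|] := pselect (O b); last by left; apply: hS_large.
right; apply: hS_large => // Oc.
have mt : mxi O (1 + lp * b) by apply: contrapT => u; apply: nb; apply: sO.2.
apply: (mx1 vO); have -> : 1 = (1 + lp * b) * (1 + lp * c) by rewrite cE; field.
by apply: mxMr => //; apply: vrD => //; [apply: (vr1 vO)|apply: (vrM vO) => //; apply: vr_lp].
Qed.

End Canonical.
End Coarsest.

(** * The sets that generate the finest p-henselian ring *)

Section Finest.
Variables (p : nat) (p_prime : prime p).

Section Sets.
Variables (K : fieldType) (z b : K).
Local Notation lp := ((z - 1) ^+ p).

Definition inSx a := inS p z a /\ 1 + lp * a != 0.

(* For b as in the header: m is contained in dset, and dset in O, as b x / (1 + x) is close to b for
   large x. The two special elements of xbase are needed to lift xbase from the residue field. *)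
Definition dset x := [/\ inSx x, 1 + x != 0 & exists w, w * (1 + x) = b * x /\ inSx w].

Definition xbase x :=
  dset x \/ (exists y, x * y = 1 /\ ~ dset y) \/ x = - lp \/ x = - (1 + b * lp).

Fixpoint xset n x :=
  if n is n'.+1 then
    exists x1 x2 x3 x4, (xset n' x1 /\ xset n' x2) /\ (xset n' x3 /\ xset n' x4) /\ x = x1 * x2 + x3 * x4
  else xbase x.

Definition xunion x := exists n, xset n x.

Hypothesis zP : qnat z p = 0.

Lemma inSx0 : inSx 0.
Proof. by split; [apply: inS0|rewrite mulr0 addr0 oner_neq0]. Qed.

Lemma dset0 : dset 0.
Proof.
split; rewrite ?addr0 ?oner_neq0 //; first exact: inSx0.
by exists 0; rewrite mulr0 mul0r; split=> //; apply: inSx0.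
Qed.

(** The purpose of the second alternative in [xbase]: of x and its inverse one is always present, so
    the generated ring is a valuation ring. *)
Lemma xbase_inv x : x != 0 -> ~ xbase x -> dset x^-1.
Proof.
move=> x0 nx; apply: contrapT => nd; apply: nx; right; left; exists x^-1.
by rewrite divff.
Qed.

Lemma dset_xbase x : dset x -> xbase x. Proof. by left. Qed.

Lemma xbase1 : xbase 1.
Proof.
apply: contrapT => n; apply: (n); left.
by have := xbase_inv (oner_neq0 K) n; rewrite invr1.
Qed.

Lemma xbaseN1 : xbase (-1).
Proof.
apply: contrapT => n; apply: (n); left.
by have := xbase_inv (_ : -1 != 0) n; rewrite invrN1 oppr_eq0 oner_neq0; apply.
Qed.

Lemma xset_succ n x : xset n x -> xset n.+1 x.
Proof.
have h m : xset m 1 /\ xset m 0 /\ (forall x, xset m x -> xset m.+1 x).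
  elim: m => [|m [X1 [X0 IH]]].
    split; [exact: xbase1|split; [exact/dset_xbase/dset0|]] => y Xy.
    exists y, 1, 0, 1; rewrite mulr1 mul0r addr0; do !split=> //; [exact: xbase1|exact/dset_xbase/dset0|exact: xbase1].
  split; [exact: IH|split; [exact: IH|]] => y Xy.
  by exists y, 1, 0, 1; rewrite mulr1 mul0r addr0; do !split=> //; apply: IH.
exact: (h n).2.2.
Qed.

Lemma xset_leq n m x : (n <= m)%N -> xset n x -> xset m x.
Proof. by move=> /subnKC <-; elim: (m - n)%N => [|k IH] h; rewrite ?addn0 // addnS; apply/xset_succ/IH. Qed.

Lemma xset0 n : xset n 0.
Proof. by apply: (xset_leq (leq0n n)); apply/dset_xbase/dset0. Qed.
Lemma xset1 n : xset n 1.
Proof. by apply: (xset_leq (leq0n n)); apply: xbase1. Qed.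
Lemma xsetN1 n : xset n (-1).
Proof. by apply: (xset_leq (leq0n n)); apply: xbaseN1. Qed.

Lemma xsetM n x y : xset n x -> xset n y -> xset n.+1 (x * y).
Proof. by move=> hx hy; exists x, y, 0, 0; rewrite mulr0 addr0; do !split=> //; apply: xset0. Qed.
Lemma xsetD n x y : xset n x -> xset n y -> xset n.+1 (x + y).
Proof. by move=> hx hy; exists x, 1, y, 1; rewrite !mulr1; do !split=> //; apply: xset1. Qed.

Lemma xunion_valring : valring xunion.
Proof.
split.
- by exists 0%N; apply: xset1.
- move=> x y [n xn] [m ym]; exists (maxn n m).+1.
  exists x, 1, (-1), y; rewrite mulr1 mulN1r; do !split.
  + exact: xset_leq (leq_maxl _ _) xn.
  + exact: xset1.
  + exact: xsetN1.
  + exact: xset_leq (leq_maxr _ _) ym.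
- move=> x y [n xn] [m ym]; exists (maxn n m).+1; apply: xsetM.
  + exact: xset_leq (leq_maxl _ _) xn.
  + exact: xset_leq (leq_maxr _ _) ym.
- move=> x; have [->|x0] := eqVneq x 0; first by left; exists 0%N; apply: xset0.
  have [h|/(xbase_inv x0)/dset_xbase h] := pselect (xbase x); [left|right]; by exists 0%N.
Qed.

Lemma xunion_max x : mxi xunion x -> dset x.
Proof.
case=> [->|n]; first exact: dset0.
have x0 : x^-1 != 0.
  by apply/eqP => e; apply: n; rewrite e; exists 0%N; apply: xset0.
rewrite -[x]invrK; apply: xbase_inv => // h; apply: n; by exists 0%N.
Qed.

(** An element outside of [dset] has its inverse in [xbase], so the maximal ideal lies in [dset],
    hence in S: p-henselianity is built in, for every b. *)
Lemma xunion_phens : phens p z xunion.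
Proof. by split; [exact: xunion_valring|move=> x /xunion_max[[]]]. Qed.

Section InRing.
Variables (O : K -> Prop) (hO : phens p z O).
Let vO := hO.1.

Lemma mxi_inSx x : mxi O x -> inSx x.
Proof.
move=> mx; split; first exact: hO.2.
by have [] := mx_1D vO (mxM vO (vr_lp p_prime zP vO) mx).
Qed.

Definition good := [/\ O b, ~ inS p z b & ~ mxi O (1 + lp * b)].
Hypothesis gb : good.
Let Ob : O b. Proof. by case: gb. Qed.
Let nb : ~ inS p z b. Proof. by case: gb. Qed.
Let ub : ~ mxi O (1 + lp * b). Proof. by case: gb. Qed.

Lemma max_dset x : mxi O x -> dset x.
Proof.
move=> mx; have [x0 xV] := mx_1D vO mx; split=> //; first exact: mxi_inSx.
exists (b * x / (1 + x)); rewrite divfK //; split=> //.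
by apply: mxi_inSx; apply: mxMr => //; apply: mxM.
Qed.

Lemma dset_sub x : dset x -> O x.
Proof.
move=> [_ x1 [w [e [Sw _]]]]; apply: contrapT => xO.
have x0 := nvr_neq0 vO xO; have mx := nvr_mx xO.
have [y0 yV] := mx_1D vO mx.
suff : ~ inS p z (b - b * (x^-1 / (1 + x^-1))).
  apply; suff -> : b - b * (x^-1 / (1 + x^-1)) = w by [].
  by apply: (mulIf x1); rewrite e; field; rewrite x0 addrC x1.
apply: (inS_perturb p_prime zP hO) => //.
by rewrite mulrAC; apply: mxM; [|apply: (vrM vO) => //; apply: nmx_vr|apply: mxMr].
Qed.

Lemma xbase_sub x : xbase x -> O x.
Proof.
have Ol := vr_lp p_prime zP vO.
case=> [/dset_sub//|[[y [e nd]]|[->|->]]].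
- apply: contrapT => xO; apply: nd; apply: max_dset.
  suff -> : y = x^-1 by apply: nvr_mx.
  by apply: (mulfI (nvr_neq0 vO xO)); rewrite e divff // (nvr_neq0 vO xO).
- exact: vrN.
- by apply: vrN => //; apply: vrD => //; [apply: (vr1 vO)|apply: (vrM vO)].
Qed.

Lemma xset_sub n x : xset n x -> O x.
Proof.
elim: n x => [|n IH] x; first exact: xbase_sub.
move=> [x1 [x2 [x3 [x4 [[/IH h1 /IH h2] [[/IH h3 /IH h4] ->]]]]]].
by apply: vrD => //; apply: (vrM vO).
Qed.

End InRing.
End Sets.
End Finest.

(** * Topologies given by balls: bounded and unbounded integers *)

Section VTopology.
Variables (p : nat) (p_prime : prime p) (F : fieldType) (z : F) (zP : qnat z p = 0).
Local Notation lam := (z - 1).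
Local Notation lp := (lam ^+ p).
Local Notation S := (inS p z).
Local Notation f := (kas p z).

Lemma prod_sub_expand (O : F -> Prop) (q : nat -> F) (w : F) n : valring O ->
  (forall i, O (q i)) -> O w ->
  exists2 k, O k & \prod_(i < n) (w - q i) = \prod_(i < n) (- q i) + w * k.
Proof.
move=> vO Oq Ow; elim: n => [|n [k Ok e]].
  by exists 0; rewrite ?big_ord0 ?mulr0 ?addr0 //; apply: vr0.
exists (\prod_(i < n) (- q i) + k * (w - q n)).
  apply: vrD => //; first by apply: vr_prod => // i _; apply: vrN.
  by apply: (vrM vO) => //; apply: (vrB vO).
by rewrite !big_ord_recr /= e; ring.
Qed.

(* f has derivative prod_(0 < i < p) - [i] at 0, which is a unit: a Hensel step. *)
Lemma half_S (O : F -> Prop) (y : F) : valring O -> mxi O y ->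
  (forall v, O v -> S (y ^+ 2 * v)) -> forall v, O v -> S (y * v).
Proof.
move=> vO my Sy v Ov; have Oq k : O (qnat z k) := vr_qnat p_prime zP vO k.
have p0 := prime_gt0 p_prime.
pose eps := \prod_(i < p.-1) (- qnat z i.+1).
have [eps0 epsV] : eps != 0 /\ O eps^-1.
  have u (i : 'I_p.-1) : qnat z i.+1 != 0 /\ O (qnat z i.+1)^-1.
    have ip : (0 < i.+1 < p)%N by rewrite /= -ltn_predRL ltn_ord.
    have q0 := qnat_neq0 p_prime zP ip; have [k e] := qnat_inv p_prime zP ip.
    split=> //; suff -> : (qnat z i.+1)^-1 = qnat (z ^+ i.+1) k.
      by apply: vr_sum => // l _; rewrite -exprM; apply: vrX => //; apply: (vr_zeta p_prime zP).
    by apply: (mulfI q0); rewrite e divff.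
  split; first by apply/prodf_neq0 => i _; rewrite oppr_eq0 (u i).1.
  rewrite -prodfV; apply: vr_prod => // i _; rewrite invrN; apply: vrN => //; exact: (u i).2.
have [h hP] : exists h : F -> F, forall w, O w -> O (h w) /\ f w = w * (eps + w * h w).
  have ex w : exists hw, O w -> O hw /\ f w = w * (eps + w * hw).
    have [Ow|] := pselect (O w); last by exists 0.
    suff [k Ok e] : exists2 k, O k & \prod_(i < p.-1) (w - qnat z i.+1) = eps + w * k.
      exists k => _; split=> //; rewrite /kas -e.
      have {1}-> : w = w - qnat z 0 by rewrite qnat0 subr0.
      by case: (p) p0 => // n _ /=; rewrite big_ord_recl /= qnat0 !subr0.
    by apply: (@prod_sub_expand O (fun i => qnat z i.+1)).
  by exists (fun w => projT1 (cid (ex w))) => w; apply: (projT2 (cid (ex w))).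
pose s := y * v / eps.
have ms : mxi O s by apply: mxMr => //; apply: mxMr.
have [Oh fE] := hP s (mx_sub vO ms); have Oe := vr_kas p_prime zP vO.
have mf : mxi O (f s).
  rewrite fE; apply: mxMr => //; apply: vrD => //; last by apply: (vrM vO) => //; apply: mx_sub.
  by apply: vr_prod => // i _; apply: vrN.
have [F0 FV] := mx_1D vO (mxM vO (vr_lp p_prime zP vO) mf).
apply: (inS_div p_prime zP (a := f s)) => //; first by exists s.
have -> : (y * v - f s) / (1 + lp * f s) =
    y ^+ 2 * (- (v ^+ 2 * eps^-1 ^+ 2 * h s * (1 + lp * f s)^-1)).
  rewrite {1}fE; set A := h s; move: F0; set B := 1 + lp * f s => B0.
  by rewrite /s; field; rewrite eps0 B0.
apply: Sy; apply: vrN => //; apply: (vrM vO) => //; apply: (vrM vO) => //.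
by apply: (vrM vO); apply: vrX.
Qed.

(* ball k is a neighbourhood basis of 0 as k grows; each operation loses one index. *)
Variables (ball : int -> F -> Prop) (d : F).
Hypotheses
  (bM : forall j k x y, ball j x -> ball k y -> ball (j + k - 1) (x * y))
  (bD : forall k x y, ball k x -> ball k y -> ball (k - 1) (x + y))
  (bV : forall k x, x != 0 -> ~ ball k x -> ball (- k) x^-1)
  (bmono : forall j k x, (j <= k)%R -> ball k x -> ball j x)
  (btot : forall x, exists k, ball k x)
  (b0 : forall k, ball k 0)
  (b1 : ball 0 1) (bN1 : ball 0 (-1)) (bn1 : ~ ball 1 1)
  (bS : forall x, ball 1 x -> S x)
  (bd : forall k x, ball k (d * x) <-> ball (k + 1) x).

Lemma bMle i j k x y : ball j x -> ball k y -> (i <= j + k - 1)%R -> ball i (x * y).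
Proof. by move=> hx hy le; apply: bmono le _; apply: bM. Qed.

Lemma bDle i k x y : ball k x -> ball k y -> (i <= k - 1)%R -> ball i (x + y).
Proof. by move=> hx hy le; apply: bmono le _; apply: bD. Qed.

Lemma bN i k x : ball k x -> (i <= k - 1)%R -> ball i (- x).
Proof. by move=> hx le; rewrite -mulN1r; apply: bMle bN1 hx _; lia. Qed.

Lemma bX q u : ball 2 u -> ball (q%:Z + 2) (u ^+ q.+1).
Proof.
move=> bu; elim: q => [|q IH]; first by rewrite expr1.
by rewrite exprS; apply: bMle bu IH _; lia.
Qed.

Lemma b_fin (G : nat -> F) n : exists k, forall i, (i < n)%N -> ball k (G i).
Proof.
elim: n => [|n [k kP]]; first by exists 0.
have [j jP] := btot (G n); exists (- (`|j| + `|k|)) => i; rewrite ltnS leq_eqVlt => /orP[/eqP ->|lt].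
  by apply: bmono jP; lia.
by apply: bmono (kP i lt); lia.
Qed.

Lemma b_eq0 x : (forall k, ball k x) -> x = 0.
Proof.
move=> bx; apply/eqP; apply: contraT => x0; have [k xk] := btot x^-1.
by case: bn1; rewrite -(divff x0); apply: bMle (bx (2 - k)) xk _; lia.
Qed.

(** Splitting the sum in halves costs one index for each doubling of the number of terms. *)
Lemma b_sum k t (G : nat -> F) n : (n <= 2 ^ t)%N -> (forall i, (i < n)%N -> ball k (G i)) ->
  ball (k - t%:Z) (\sum_(i < n) G i).
Proof.
elim: t G n => [|t IH] G n.
  case: n => [|[|n]] // _ h; first by rewrite big_ord0.
  by rewrite big_ord1 /=; apply: bmono (h _ _) => //; lia.
move=> nt h; pose n1 := minn n (2 ^ t); have nE : n = (n1 + (n - n1))%N by rewrite /n1; lia.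
rewrite nE big_split_ord /=; apply: bDle (_ : ball (k - t%:Z) _) (_ : ball (k - t%:Z) _) _; last by lia.
  by apply: IH; [rewrite /n1; lia|move=> i i1; apply: h; rewrite /n1 in i1; lia].
apply: (IH (fun i => G (n1 + i)%N)); last by move=> i i1; apply: h; lia.
by move: nt; rewrite expnS /n1; lia.
Qed.

Lemma b_not_small k x : x != 0 -> ~ ball (- k) x^-1 -> ball k x.
Proof. by move=> x0 /bV; rewrite invrK opprK invr_eq0; apply. Qed.

(** The power-bounded elements; if the integers are bounded, they form a valuation ring. *)
Definition pbd x := exists k, forall n, ball k (x ^+ n).

Lemma pbd0 : pbd 0.
Proof. by exists 0 => -[|n]; rewrite ?expr0 ?exprS ?mul0r. Qed.

Lemma npbd k x : ~ pbd x -> x != 0 /\ exists n, ball k (x^-1 ^+ n.+1).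
Proof.
move=> nx; have x0 : x != 0 by apply/eqP => x0; apply: nx; rewrite x0; apply: pbd0.
split=> //; have /existsNP[n nb] : ~ forall n, ball (- (`|k| + 2)) (x ^+ n).
  by move=> h; apply: nx; eexists; apply: h.
exists n.-1; case: n nb => [|n] nb; first by case: nb; apply: bmono b1; lia.
by rewrite exprVn; apply: bmono (bV (expf_neq0 _ x0) nb); lia.
Qed.

Lemma pbdV x : ~ pbd x -> pbd x^-1.
Proof.
move=> /(npbd 2)[x0 [n bn]]; have [k kP] := b_fin (fun i => x^-1 ^+ i) n.+1.
exists (- (`|k| + 2)) => m; rewrite (divn_eq m n.+1) exprD [(_ * n.+1)%N]mulnC exprM.
have bk := kP _ (ltn_pmod m (ltn0Sn n)).
case: (m %/ n.+1)%N => [|q]; first by rewrite expr0 mul1r; apply: bmono bk; lia.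
by apply: bMle (bX q bn) bk _; lia.
Qed.

Lemma pbdM x y : pbd x -> pbd y -> pbd (x * y).
Proof. by move=> [j hj] [k hk]; exists (j + k - 1) => n; rewrite exprMn; apply: bM. Qed.

Section NonArchimedean.
Hypothesis bZ : exists k, forall n : nat, ball k n%:R.

(* The bounds for the n + 1 terms of the binomial expansion of (1 + x)^n deteriorate logarithmically,
   those for the powers of a large element linearly. *)
Lemma pbd1D x : pbd x -> pbd (1 + x).
Proof.
move=> [k kP]; have [l lP] := bZ; apply: contrapT => /(npbd 2)[x0 [n bn]].
(* Large enough for 2^j to exceed j and all constants below; the exponent N is (n + 1) 2^j. *)
pose j := (absz (k + l)%R + n + 10)%N.
have jP : (j + (absz (k + l)%R + n + 5) <= 2 ^ j)%N.
  have h : (j.-1 < 2 ^ j.-1)%N by apply: ltn_expl.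
  have -> : (2 ^ j = 2 * 2 ^ j.-1)%N by rewrite -expnS prednK // /j; lia.
  by rewrite /j in h *; lia.
pose q := (2 ^ j).-1; have qE : q.+1 = (2 ^ j)%N by rewrite prednK ?expn_gt0.
have := bX q bn; rewrite -exprM qE; set N := (n.+1 * 2 ^ j)%N => bq.
have sN : ball (k + l - 1 - (n.+1 + j)%:Z) ((1 + x) ^+ N).
  rewrite exprDn; have Nle : (N.+1 <= 2 ^ (n.+1 + j))%N.
    rewrite expnD ltn_mul2r expn_gt0 /=; exact: ltn_expl.
  apply: (@b_sum _ _ (fun i => (1 ^+ (N - i) * x ^+ i) *+ 'C(N, i)) _ Nle) => i _.
  by rewrite expr1n mul1r -mulr_natr; apply: bM.
apply: bn1; have -> : 1 = (1 + x) ^+ N * (1 + x)^-1 ^+ N.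
  by rewrite -exprMn divff // expr1n.
apply: bMle sN bq _; have : q.+1 = (2 ^ j)%N by [].
by move: jP; set e := (2 ^ j)%N => jP qE'; lia.
Qed.

Lemma pbd_valring : valring pbd.
Proof.
have N1 : pbd (-1).
  have [k kP] := b_fin (fun i => (-1) ^+ i) 2; exists k => n.
  by rewrite -signr_odd; apply: (kP (odd n)); case: (odd n).
have add x y : pbd x -> pbd y -> pbd (x + y).
  have [->|x0] := eqVneq x 0; first by rewrite add0r.
  have [->|y0] := eqVneq y 0; first by rewrite addr0.
  move=> hx hy; have [h|/pbdV h] := pselect (pbd (x / y)).
    by have -> : x + y = y * (1 + x / y) by [field]; apply: pbdM => //; apply: pbd1D.
  have -> : x + y = x * (1 + (x / y)^-1) by field; rewrite x0 y0.
  by apply: pbdM => //; apply: pbd1D.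
split.
- by exists 0 => n; rewrite expr1n.
- by move=> x y hx hy; apply: add => //; rewrite -mulN1r; apply: pbdM.
- exact: pbdM.
- by move=> x; have [|/pbdV] := pselect (pbd x); [left|right].
Qed.

Lemma pbd_ball x : pbd x -> ball (-2) x.
Proof.
have [->|x0] := eqVneq x 0; first by move=> _; apply: b0.
move=> [k kP]; apply: contrapT => /(bV x0); rewrite opprK => b2.
apply: bn1; have -> : 1 = x^-1 ^+ `|k|.+1 * x ^+ `|k|.+1 by rewrite -exprMn mulVf // expr1n.
by apply: bMle (bX `|k| b2) (kP _) _; lia.
Qed.

(** Some power x^(n+1) is so small that its power-bounded multiples are in S. From there one passes
    to an exponent that is a power of 2, and [half_S] halves it until x is reached. *)
Lemma pbd_phens : phens p z pbd.
Proof.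
have vV := pbd_valring; split=> // x mx.
have [->|x0] := eqVneq x 0; first exact: inS0.
have /(npbd 4)[_ [n]] : ~ pbd x^-1 by apply: mx_vr.
rewrite invrK => bn.
have Sn v : pbd v -> S (x ^+ n.+1 * v).
  by move=> /pbd_ball bv; apply: bS; apply: bMle bn bv _; lia.
have S2 : forall v, pbd v -> S (x ^+ (2 ^ n.+1) * v).
  move=> v hv; have le : (n.+1 <= 2 ^ n.+1)%N by apply/ltnW/ltn_expl.
  rewrite -(subnKC le) exprD -mulrA; apply: Sn; apply: (vrM vV) => //.
  by apply: vrX => //; apply: mx_sub.
suff : forall v, pbd v -> S (x ^+ (2 ^ 0) * v).
  by move/(_ 1 (vr1 vV)); rewrite expn0 expr1 mulr1.
elim: (n.+1) S2 => // m IH Sm; apply: IH; apply: half_S => //.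
  by apply: mxXn => //; rewrite expn_gt0.
by move=> v; rewrite -exprM -expnSr; apply: Sm.
Qed.

(** Multiplication by d shifts the balls, so bounded powers of d would put 1 in arbitrarily small
    balls. *)
Lemma pbd_proper : ~ pbd d.
Proof.
move=> [k kP]; have bk n i : ball i (d ^+ n) <-> ball (i + n%:Z) 1.
  elim: n i => [|n IH] i; first by rewrite expr0 addr0.
  by rewrite exprS bd IH; have -> : i + 1 + n%:Z = i + n.+1%:Z by lia.
by apply: bn1; have := kP `|k|.+1; rewrite bk; apply: bmono; lia.
Qed.

End NonArchimedean.

Section Archimedean.
Hypothesis bZ : forall k, exists n : nat, ~ ball k n%:R.

Lemma nat_neq0 n : (0 < n)%N -> n%:R != 0 :> F.
Proof.
move=> n0; apply/eqP => e; have [k kP] := b_fin (fun i => i%:R) n.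
have [m []] := bZ k; rewrite (divn_eq m n) natrD natrM e mulr0 add0r.
exact/kP/ltn_pmod.
Qed.

Lemma lam_neq0 : lam != 0.
Proof.
apply/eqP => l0; have := lam0_char p_prime zP l0.
by rewrite inE p_prime /= (negPf (nat_neq0 (prime_gt0 p_prime))).
Qed.

Lemma inv_nat_small k : exists2 n, (0 < n)%N & ball k n%:R^-1.
Proof.
have [n nb] := bZ (- k); have n0 : (0 < n)%N by case: n nb => // nb; case: nb; apply: b0.
by exists n => //; rewrite -[k]opprK; apply: bV => //; apply: nat_neq0.
Qed.

Definition Tp c := exists2 e : F, e != 0 & c = e ^+ p.

Lemma TpM c e : Tp c -> Tp e -> Tp (c * e).
Proof. by move=> [x x0 ->] [y y0 ->]; exists (x * y); rewrite ?mulf_neq0 // exprMn. Qed.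
Lemma TpV c : Tp c -> Tp c^-1.
Proof. by move=> [x x0 ->]; exists x^-1; rewrite ?invr_eq0 // exprVn. Qed.
Lemma Tp1 : Tp 1. Proof. by exists 1; rewrite ?oner_neq0 ?expr1n. Qed.
Lemma Tp_neq0 c : Tp c -> c != 0.
Proof. by move=> [x x0 ->]; rewrite expf_neq0. Qed.

Lemma Tp_near : exists N, forall e, ball N e -> Tp (1 + e).
Proof.
have [l lP] := btot lp^-1; exists (`|l| + 3) => e be.
have lp0 : lp != 0 by rewrite expf_neq0 // lam_neq0.
have /(inS_pow p_prime zP _ lam_neq0)[c] : S (e / lp) by apply: bS; apply: bMle be lP _; lia.
rewrite mulrC divfK // => cE; exists c => //; apply/eqP => c0; apply: bn1; have -> : 1 = - e.
  by apply/eqP; rewrite -addr_eq0 cE c0 expr0n; case: (p) p_prime.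
by apply: bN be _; lia.
Qed.

(* Base m expansions bound the fractions j / m ^ t, and these approximate all rationals of [0, 1]. *)
Lemma fraction_bounded : exists k, forall i n, (i <= n)%N -> (0 < n)%N -> ball k (i%:R / n%:R).
Proof.
have [m m0 bm] := inv_nat_small 2; have mn0 := nat_neq0 m0.
have [M MP] := b_fin (fun i => i%:R) m.+1.
have bmt t : ball (t%:Z + 1) (m ^ t.+1)%:R^-1.
  by have := bX t bm; rewrite exprVn -natrX; apply: bmono; lia.
have dig t j : (j <= m ^ t)%N -> ball M (j%:R / (m ^ t)%:R).
  elim: t j => [|t IH] j.
    rewrite expn0 divr1 => j1; apply: MP; exact: leq_ltn_trans j1 _.
  move=> jm; have mt0 := nat_neq0 (n := (m ^ t)%N); rewrite expn_gt0 m0 in mt0.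
  have {mt0} mt0 := mt0 isT.
  have -> : j%:R / (m ^ t.+1)%:R = ((j %/ m ^ t)%:R + (j %% m ^ t)%:R / (m ^ t)%:R) / m%:R :> F.
    have e : j%:R = (j %/ m ^ t)%:R * (m ^ t)%:R + (j %% m ^ t)%:R :> F.
      by rewrite -natrM -natrD -divn_eq.
    rewrite e expnS natrM.
    by field; rewrite mn0 mt0.
  apply: (bMle (j := M - 1)) bm _; last by lia.
  apply: bD; last by apply: IH; apply: ltnW; rewrite ltn_pmod // expn_gt0 m0.
  apply: MP; rewrite ltnS -[leqRHS](mulnK m (_ : 0 < m ^ t)%N) ?expn_gt0 ?m0 //.
  by rewrite -expnS; apply: leq_div2r.
exists (M - 1) => i n le n0; have nn0 := nat_neq0 n0.
have [k kP] := b_fin (fun i => i%:R / n%:R) n.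
pose t := absz (M - k)%R; pose j := ((m ^ t.+1 * i) %/ n)%N.
have mt0 : (m ^ t.+1)%:R != 0 :> F by apply: nat_neq0; rewrite expn_gt0 m0.
have -> : i%:R / n%:R = j%:R / (m ^ t.+1)%:R
    + ((m ^ t.+1 * i) %% n)%:R / n%:R * (m ^ t.+1)%:R^-1 :> F.
  have e : (m ^ t.+1)%:R * i%:R = j%:R * n%:R + ((m ^ t.+1 * i) %% n)%:R :> F.
    by rewrite -!natrM -natrD -divn_eq.
  have -> : ((m ^ t.+1 * i) %% n)%:R = (m ^ t.+1)%:R * i%:R - j%:R * n%:R :> F.
    by rewrite e addrC addKr.
  by field; rewrite mt0 nn0.
apply: bD; first by apply: dig; rewrite /j; apply: (leq_trans (leq_div2r n (leq_mul (leqnn _) le))); rewrite mulnK.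
by apply: bMle (kP _ (ltn_pmod _ n0)) (bmt t) _; rewrite /t; lia.
Qed.

(* Along the segment from 1 to a the ratios of successive points are close to 1. *)
Lemma Tp_path a k :
  (forall i n, (i <= n)%N -> (0 < n)%N ->
    1 + i%:R / n%:R * (a - 1) != 0 /\ ball k (1 + i%:R / n%:R * (a - 1))^-1) -> Tp a.
Proof.
move=> H; have [N NP] := Tp_near; have [l lP] := btot (a - 1).
have [n n0 bn] := inv_nat_small (N + 2 - k - l); have nn0 := nat_neq0 n0.
suff P i : (i <= n)%N -> Tp (1 + i%:R / n%:R * (a - 1)).
  by have := P n (leqnn n); rewrite divff // mul1r addrC subrK.
elim: i => [|i IH] iln; first by rewrite !mul0r addr0; apply: Tp1.
have [g0 bg] := H i n (ltnW iln) n0; set g := 1 + _ in g0 bg *.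
have -> : 1 + i.+1%:R / n%:R * (a - 1) = g * (1 + (a - 1) * n%:R^-1 * g^-1).
  have -> : g * (1 + (a - 1) * n%:R^-1 * g^-1) = g + (a - 1) * n%:R^-1.
    by move: g0; move: (g) => u u0; field; rewrite ?nn0 ?u0.
  by rewrite /g -natr1; field.
apply: TpM; first by apply: IH; apply: ltnW.
by apply: NP; apply: bMle (bM lP bn) bg _; lia.
Qed.

(** The points of the segment from 1 to n are the rationals (m + i (n - 1)) / m, whose inverses are
    fractions in [0, 1] and thus bounded. *)
Lemma Tp_nat n : (0 < n)%N -> Tp n%:R.
Proof.
move=> n0; have [k kP] := fraction_bounded; apply: (@Tp_path _ k) => i m im m0.
have mm0 := nat_neq0 m0.
have -> : 1 + i%:R / m%:R * (n%:R - 1) = (m + i * n.-1)%:R / m%:R :> F.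
  by rewrite -subn1 natrD natrM natrB //; field.
have l0 : (0 < m + i * n.-1)%N by rewrite addn_gt0 m0.
split; first by rewrite mulf_neq0 ?invr_eq0 ?nat_neq0.
by rewrite invf_div; apply: kP => //; apply: leq_addr.
Qed.

Lemma b_neg k x : ~ (x != 0 /\ ball k x^-1) -> ball (- k) x.
Proof.
have [->|x0] := eqVneq x 0; first by move=> _; apply: b0.
by move=> h; apply: b_not_small => // b; apply: h; split=> //; rewrite opprK in b.
Qed.

(** The path from 1 to a fails only if it comes close to 0 at some point e. Then 0 nearly divides
    the segment in the ratio i : n - i, so that -a is the positive rational (n - i) / i up to a
    factor close to 1, and positive rationals are in Tp. *)
Lemma Tp_or a : a != 0 -> Tp a \/ Tp (- a).
Proof.
move=> a0; have [N NP] := Tp_near; have [l lP] := btot (a - 1).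
have [k1 nk1] : exists k1, ~ ball k1 a.
  by apply: contrapT => /forallNP h; case/eqP: a0; apply: b_eq0 => k; apply: contrapT => /h.
pose k0 := - (`|k1| + `|l| + 10).
pose M := `|N| + `|k0| + `|k1| + 10.
have [H|/existsNP[i /existsNP[n /not_implyP[le /not_implyP[n0 /b_neg]]]]] :=
    pselect (forall i n, (i <= n)%N -> (0 < n)%N ->
      1 + i%:R / n%:R * (a - 1) != 0 /\ ball (- M) (1 + i%:R / n%:R * (a - 1))^-1).
  by left; apply: Tp_path H.
rewrite opprK; set e := 1 + _ => be; right.
have nn0 := nat_neq0 n0.
have i0 : (0 < i)%N.
  rewrite lt0n; apply/eqP => i0; apply: bn1; move: be; rewrite /e i0 !mul0r addr0.
  by apply: bmono; rewrite /M; lia.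
pose s' := (n - i)%:R / n%:R : F.
have [s0 bs] : s' != 0 /\ ball k0 s'^-1.
  apply: contrapT => /b_neg bs; apply: nk1.
  have -> : a = e + s' * (a - 1).
    by rewrite /e /s' natrB //; field.
  apply: (bDle (k := `|k1| + 1)); last by lia.
    by apply: bmono be; rewrite /M; lia.
  by apply: bMle bs lP _; rewrite /k0; lia.
have ni0 : (0 < n - i)%N.
  by rewrite lt0n; apply: contraNneq s0 => h; rewrite /s' h mul0r.
have T1 : Tp (1 - e / s').
  by apply: NP; apply: bN (bM be bs) _; rewrite /M; lia.
have -> : - a = (1 - e / s') * ((n - i)%:R / i%:R).
  have ii0 := nat_neq0 i0; have nni0 := nat_neq0 ni0.
  rewrite /e /s'; rewrite natrB // in nni0 *; field.
  by rewrite nn0 ii0 nni0.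
by apply: TpM => //; apply: TpM; [apply: Tp_nat|apply: TpV; apply: Tp_nat].
Qed.

Hypothesis nS : exists b, ~ S b.

Lemma Tp_inS b : Tp (1 + lp * b) -> S b.
Proof. by move=> [c _ cE]; apply/(inS_pow p_prime zP _ lam_neq0); exists c. Qed.

(** Otherwise [Tp_or] makes every nonzero element a p-th power, and S is everything. *)
Lemma nTpN1 : ~ Tp (-1).
Proof.
move=> TN; have [b nb] := nS; apply: nb.
have [e|e0] := eqVneq (1 + lp * b) 0.
  by apply: contrapT => /(notS_neq0 p_prime zP); rewrite e eqxx.
apply: Tp_inS; have [//|h] := Tp_or e0.
by have := TpM TN h; rewrite mulrNN mul1r.
Qed.

(** If the path from 1 to 1 + a comes close to 0, then -(i / n) a is close to 1, and -1 would be in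
    Tp. *)
Lemma Tp_1D a : Tp a -> Tp (1 + a).
Proof.
move=> Ta; have [N NP] := Tp_near.
pose M := `|N| + 10.
have [H|/existsNP[i /existsNP[n /not_implyP[le /not_implyP[n0 /b_neg]]]]] :=
    pselect (forall i n, (i <= n)%N -> (0 < n)%N ->
      1 + i%:R / n%:R * (1 + a - 1) != 0 /\ ball (- M) (1 + i%:R / n%:R * (1 + a - 1))^-1).
  exact: Tp_path H.
rewrite opprK; set e := 1 + _ => be; have nn0 := nat_neq0 n0.
have i0 : (0 < i)%N.
  rewrite lt0n; apply/eqP => i0; apply: bn1; move: be; rewrite /e i0 !mul0r addr0.
  by apply: bmono; rewrite /M; lia.
have T1 : Tp (1 - e) by apply: NP; apply: bN be _; rewrite /M; lia.
case: nTpN1; have -> : -1 = (1 - e) * (n%:R / i%:R) / a.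
  have ii0 := nat_neq0 i0; have a0 := Tp_neq0 Ta.
  by rewrite /e; field; rewrite nn0 ii0 a0.
apply: TpM; last exact: TpV.
by apply: TpM => //; apply: TpM; [apply: Tp_nat|apply: TpV; apply: Tp_nat].
Qed.

Lemma archimedean_eucl : p = 2%N /\ eucl F.
Proof.
have p2 : p = 2%N.
  case: (even_prime p_prime) => // po; case: nTpN1; exists (-1); first by rewrite oppr_eq0 oner_neq0.
  by rewrite -signr_odd po expr1.
have sqT c : Tp c -> exists w, c = w ^+ 2 by move=> [w _ ->]; exists w; rewrite p2.
have Tsq c : c != 0 -> Tp (c ^+ 2) by exists c; rewrite // p2.
split=> //; split.
- exact: (nat_neq0 (n := 2)).
- move=> x e; apply: nTpN1; rewrite -e; apply: Tsq; apply: contra_eqN e => /eqP ->.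
  by rewrite expr0n eq_sym oppr_eq0 oner_neq0.
- move=> x; have [->|x0] := eqVneq x 0; first by exists 0; left; rewrite expr0n.
  case: (Tp_or x0) => /sqT[w e]; exists w; [by left|right].
  by rewrite -e opprK.
- move=> x y; have [->|x0] := eqVneq x 0; first by exists y; rewrite expr0n add0r.
  have [->|y0] := eqVneq y 0; first by exists x; rewrite expr0n addr0.
  apply: sqT; have -> : x ^+ 2 + y ^+ 2 = x ^+ 2 * (1 + (y / x) ^+ 2) by field.
  by apply: TpM; [apply: Tsq|apply: Tp_1D; apply: Tsq; rewrite mulf_neq0 ?invr_eq0].
Qed.

End Archimedean.

End VTopology.

(** * Exhausting a field without nontrivial p-henselian rings *)

Section LemmaV.
Variables (p : nat) (p_prime : prime p) (F : fieldType) (z : F) (zP : qnat z p = 0).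
Variables (b : F) (nb : ~ inS p z b).
Hypothesis triv : forall O, phens p z O -> forall x, O x.

Section Missing.
Variables (d : F) (nd : ~ xset p z b 2 d).

Let ball (k : int) x := xbase p z b (d ^ k * x).

Let d0 : d != 0.
Proof. by apply/eqP => d0; apply: nd; rewrite d0; apply: xset0. Qed.

(** Otherwise the inverse of w / d is in [xbase], and d = w (w / d)^-1 is reached in two rounds. So
    division by d absorbs one round of sums and products: d is the scale of the balls. *)
Let W w : xset p z b 1 w -> dset p z b (d^-1 * w).
Proof.
move=> hw; apply: contrapT => nw; apply: nd.
have w0 : d^-1 * w != 0 by apply/eqP => e; apply: nw; rewrite e; apply: dset0.
have w1 : w != 0 by apply: contraNneq w0 => ->; rewrite mulr0.
have -> : d = w * (d^-1 * w)^-1 by field; rewrite w1 d0.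
apply: xsetM => //; apply: xset_succ => //; right; left; exists (d^-1 * w).
by rewrite mulVf.
Qed.

Let dN1 k : d ^ (k - 1) = d^-1 * d ^ k.
Proof. by rewrite expfzDr // mulrC. Qed.

Let bM j k x y : ball j x -> ball k y -> ball (j + k - 1) (x * y).
Proof.
move=> hx hy; rewrite /ball dN1 expfzDr //; left.
have -> : d^-1 * (d ^ j * d ^ k) * (x * y) = d^-1 * ((d ^ j * x) * (d ^ k * y)) by ring.
by apply: W; apply: (xsetM p_prime).
Qed.

Let bD k x y : ball k x -> ball k y -> ball (k - 1) (x + y).
Proof.
move=> hx hy; rewrite /ball dN1; left; rewrite -mulrA mulrDr.
by apply: W; apply: (xsetD p_prime).
Qed.

Let bmono j k x : (j <= k)%R -> ball k x -> ball j x.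
Proof.
move=> le; have -> : j = k - (absz (k - j))%:Z by lia.
elim: (absz _) => [|n IH] h; first by rewrite subr0.
have -> : k - n.+1%:Z = k - n%:Z - 1 by lia.
rewrite /ball dN1 -mulrA; left; apply: W; apply: (xset_succ p_prime).
exact: IH.
Qed.

Let bV k x : x != 0 -> ~ ball k x -> ball (- k) x^-1.
Proof.
move=> x0 /(xbase_inv _); rewrite mulf_neq0 ?expfz_neq0 // => /(_ isT) h.
by rewrite /ball -invr_expz -invfM; left.
Qed.

Let b0 k : ball k 0.
Proof. by rewrite /ball mulr0; apply/dset_xbase/dset0. Qed.
Let b1 : ball 0 1.
Proof. by rewrite /ball mulr1; apply: xbase1. Qed.
Let bN1 : ball 0 (-1).
Proof. by rewrite /ball mul1r; apply: xbaseN1. Qed.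

Let bn1 : ~ ball 1 1.
Proof.
rewrite /ball expr1z mulr1 => h; apply: nd.
by apply: (xset_leq p_prime (n := 0)).
Qed.

Let bS x : ball 1 x -> inS p z x.
Proof.
rewrite /ball expr1z => h; have /W : xset p z b 1 (d * x) by apply: (xset_succ p_prime).
by rewrite mulKf // => -[[]].
Qed.

Let bd k x : ball k (d * x) <-> ball (k + 1) x.
Proof. by rewrite /ball expfzDr // expr1z mulrA. Qed.

Let btot x : exists k, ball k x.
Proof.
have [n xn] : xunion p z b x by apply: triv; apply: xunion_phens.
suff [k kP] : exists k, forall x, xset p z b n x -> ball k x by exists k; apply: kP.
elim: n {x xn} => [|n [k kP]]; first by exists 0 => x; rewrite /ball mul1r.
exists (k + k - 1 - 1) => x [x1 [x2 [x3 [x4 [[h1 h2] [[h3 h4] ->]]]]]].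
by apply: bD; apply: bM; apply: kP.
Qed.

Lemma missing_eucl : p = 2%N /\ eucl F.
Proof.
have [bZ|nZ] := pselect (exists k, forall n : nat, ball k n%:R).
  case: (pbd_proper p_prime bmono bn1 bd).
  by apply: triv; apply: (pbd_phens p_prime zP bM bD bV bmono btot b0 b1 bn1 bS bZ).
have nb' : exists b, ~ inS p z b by exists b.
apply: (archimedean_eucl p_prime zP bM bD bV bmono btot b0 bN1 bn1 bS _ nb') => k.
by apply/existsNP => h; apply: nZ; exists k.
Qed.

End Missing.

Lemma xset2_full : ~ (p = 2%N /\ eucl F) -> forall x, xset p z b 2 x.
Proof. by move=> ne x; apply: contrapT => /missing_eucl. Qed.

End LemmaV.

Section Finest.
Variables (p : nat) (p_prime : prime p) (K : fieldType) (z : K) (zP : qnat z p = 0).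
Variables (v : valuation K).
Local Notation O := (ring_of v).
Local Notation lp := ((z - 1) ^+ p).
Hypothesis hO : phens p z O.
Let vO := hO.1.
Let zb := res v z.
Let zbP : qnat zb p = 0 := res_zP p_prime zP v.

Lemma inSx_res x : O x -> inSx p zb (res v x) -> inSx p z x.
Proof.
move=> Ox [Sx]; move/eqP; rewrite (res_lp_eq0 p_prime zP) // => u.
by split; [apply: (inS_res p_prime zP hO)|apply: nmx_neq0 u].
Qed.

Variables (b : K) (gb : good p z b O).
Let Ob : O b. Proof. by case: gb. Qed.
Let nb : ~ inS p z b. Proof. by case: gb. Qed.
Let ub : ~ mxi O (1 + lp * b). Proof. by case: gb. Qed.

Lemma notS_res : ~ inS p zb (res v b).
Proof. by move=> h; apply: nb; apply: (inS_res p_prime zP hO). Qed.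

Lemma res_div_unit x y : O x -> O y -> ~ mxi O y -> O (x / y) /\ res v (x / y) = res v x / res v y.
Proof.
move=> Ox Oy uy; have OV := nmx_vr uy; split; first exact: (vrM vO).
by rewrite resM // resV.
Qed.

Lemma dset_lift x : O x -> dset p zb (res v b) (res v x) -> dset p z b x.
Proof.
move=> Ox [Sx x1 [w [e Sw]]]; have O1 := vr1 vO; have O1x : O (1 + x) by apply: vrD.
have u1 : ~ mxi O (1 + x).
  by move=> /(res_eq0 O1x) h; move: x1; rewrite -(res1 v) -resD // h eqxx.
have x10 := nmx_neq0 u1.
have Obx : O (b * x) by apply: (vrM vO).
have [Oq qE] := res_div_unit Obx O1x u1.
split=> //; first exact: inSx_res.
exists (b * x / (1 + x)); rewrite divfK //; split=> //.
apply: (inSx_res Oq); suff -> : res v (b * x / (1 + x)) = w by [].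
by rewrite qE (resM Ob Ox) (resD O1 Ox) res1 -e mulfK.
Qed.

Lemma dset_res x : O x -> dset p z b x -> ~ mxi O (1 + lp * x) -> ~ mxi O (1 + x) ->
  ~ mxi O (1 + x + lp * (b * x)) -> dset p zb (res v b) (res v x).
Proof.
move=> Ox [[Sx _] x1 [w [e [Sw w1]]]] u1 u2 u3.
have O1 := vr1 vO; have O1x : O (1 + x) by apply: vrD.
have Obx : O (b * x) by apply: (vrM vO).
have [Oq qE] := res_div_unit Obx O1x u2.
have wE : w = b * x / (1 + x) by rewrite -e mulfK.
have Ow : O w by rewrite wE.
have rx1 : 1 + res v x != 0.
  by apply/eqP => h; apply: u2; apply/(res_eq0 O1x); rewrite resD // res1.
split=> //.
- split; first exact: (res_inS p_prime zP).
  by apply/eqP; rewrite (res_lp_eq0 p_prime zP).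
- exists (res v w); split; first by rewrite wE qE resD // res1 resM // divfK.
  split; first exact: (res_inS p_prime zP).
  apply/eqP; rewrite (res_lp_eq0 p_prime zP) // => m; apply: u3.
  have -> : 1 + x + lp * (b * x) = (1 + lp * w) * (1 + x) by rewrite -e; ring.
  exact: mxMr.
Qed.

Lemma xset_lift n y : xset p zb (res v b) n y -> exists x, [/\ O x, res v x = y & xset p z b n x].
Proof.
have O1 := vr1 vO; have Ol := vr_lp p_prime zP vO.
elim: n y => [|n IH] y; last first.
  move=> [y1 [y2 [y3 [y4 [[h1 h2] [[h3 h4] ->]]]]]].
  have [[x1 [O1' e1 X1]] [x2 [O2 e2 X2]]] := (IH _ h1, IH _ h2).
  have [[x3 [O3 e3 X3]] [x4 [O4 e4 X4]]] := (IH _ h3, IH _ h4).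
  exists (x1 * x2 + x3 * x4); split; last by exists x1, x2, x3, x4.
    by apply: vrD => //; apply: (vrM vO).
  by rewrite resD ?resM ?e1 ?e2 ?e3 ?e4 //; apply: (vrM vO).
have special x : O x -> xbase p z b x -> exists x0, [/\ O x0, res v x0 = res v x & xbase p z b x0].
  by exists x.
have m1 : xbase p z b (- lp) by right; right; left.
have m2 : xbase p z b (- (1 + b * lp)) by right; right; right.
have Om2 : O (- (1 + b * lp)) by apply: vrN => //; apply: vrD => //; apply: (vrM vO).
case=> [Dy|[[u [yu nu]]|[->|->]]].
- have [x Ox e] := res_surj y; exists x; split=> //; left.
  by apply: dset_lift => //; rewrite e.
- have [x Ox e] := res_surj y.
  have ux : ~ mxi O x.
    move=> /(res_eq0 Ox) h; move/eqP: yu; rewrite -e h mul0r eq_sym; exact/negP/oner_neq0.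
  have x0 := nmx_neq0 ux; have OV := nmx_vr ux.
  have uE : u = res v x^-1.
    rewrite resV // e; have y0 : y != 0 by apply: contra_eq_neq yu => ->; rewrite mul0r eq_sym oner_neq0.
    by apply: (mulfI y0); rewrite yu divff.
  have red a : O a -> mxi O ((x - a) / x) -> res v a = y.
    move=> Oa m; rewrite -e; apply/esym/res_eq => //.
    by rewrite -(divfK x0 (x - a)); apply: mxMr.
  (* [dset_res] leaves out three residue classes; in these x is congruent to -lp, -1 or -(1 + b lp),
     which all belong to [xbase]. *)
  have [h1|u1] := pselect (mxi O (1 + lp * x^-1)).
    exists (- lp); split=> //; first exact: vrN.
    by apply: red; [exact: vrN|rewrite opprK mulrDl divff].
  have [h2|u2] := pselect (mxi O (1 + x^-1)).
    exists (-1); split; [exact: vrN| |exact: xbaseN1].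
    by apply: red; [exact: vrN|rewrite opprK mulrDl divff // mul1r].
  have [h3|u3] := pselect (mxi O (1 + x^-1 + lp * (b * x^-1))).
    exists (- (1 + b * lp)); split=> //.
    apply: red => //; have -> : (x - - (1 + b * lp)) / x = 1 + x^-1 + lp * (b * x^-1) by field.
    by [].
  exists x; split=> //; right; left; exists x^-1; rewrite divff //; split=> // Dx.
  by apply: nu; rewrite uE; apply: dset_res.
- exists (- lp); split=> //; first exact: vrN.
  by rewrite resN // (res_lp p_prime zP).
- exists (- (1 + b * lp)); split=> //.
  rewrite resN; last by apply: vrD => //; apply: (vrM vO).
  by rewrite resD ?res1 ?resM ?(res_lp p_prime zP) //; apply: (vrM vO).
Qed.

Hypothesis finest : forall O', phens p z O' -> forall x, O x -> O' x.
Hypothesis ne : ~ (p = 2%N /\ eucl (residue_field v)).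

(** A p-henselian ring of the residue field pulls back to one inside O, hence is trivial, and two
    rounds exhaust the residue field. A lift of the residue of x to [xset 2] differs from x by an
    element of m, which is in [dset]; adding it is the third round. *)
Lemma finest_xset x : xset p z b 3 x <-> O x.
Proof.
split=> [|Ox]; first exact: (xset_sub p_prime zP hO gb).
have triv Q : phens p zb Q -> forall y, Q y.
  move=> hQ y; have [x' Ox' <-] := res_surj y.
  by have [] := finest (pullback_phens p_prime zP hO hQ) Ox'.
have := xset2_full p_prime zbP notS_res triv ne (res v x) => /xset_lift[x1 [Ox1 e Xx1]].
have m : mxi O (x - x1) by apply/res_eq.
have -> : x = x1 + (x - x1) by rewrite addrC subrK.
apply: (xsetD p_prime) => //; apply: (xset_leq p_prime (n := 0)) => //.
by left; apply: (max_dset p_prime zP hO gb).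
Qed.

End Finest.

(** * The formula *)

Section DefiningFormula.
Variables (p : nat) (p_prime : prime p).

Section OnField.
Variables (K : fieldType) (z : K).

Definition has_coarse := scls p z (coarseN p z).

(** Independence of the parameter is part of the condition: it identifies the ring with the
    canonical one in a field about which nothing else is known. *)
Definition has_finest := exists b0, let O := xset p z b0 3 in
  [/\ phens p z O, good p z b0 O & forall b, good p z b O -> forall x, xset p z b 3 x <-> O x].

(** The parameter of the second case is eliminated by intersection: every p-henselian ring contains
    the finest one. *)
Definition canonical_pred x :=
  (has_coarse /\ coarseN p z x) \/
  (~ has_coarse /\ forall b, phens p z (xset p z b 3) -> xset p z b 3 x).

Hypothesis zP : qnat z p = 0.
Local Notation v := (canonical_valuation p K).
Let cv : pcanon p z (ring_of v) := canonical_pcanon p_prime zP.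

Lemma has_coarseP : has_coarse <-> exists O, scls p z O.
Proof.
split=> [h|e]; first by exists (coarseN p z).
have [s m] := cv.1 e; apply: (scls_ext _ s) => x; apply: iff_sym.
exact: (coarseNP p_prime zP s m).
Qed.

Lemma good_exists O : phens p z O -> ~ scls p z O -> exists b, good p z b O.
Proof.
move=> hO nS; apply: contrapT => /forallNP ng; apply: nS; split=> // x Ox u.
by apply: contrapT => nx; apply: (ng x).
Qed.

Lemma canonical_predP : has_coarse \/ has_finest ->
  forall x, canonical_pred x <-> ring_of v x.
Proof.
move=> H x; have [hc|nc] := pselect has_coarse.
  have [s m] := cv.1 (has_coarseP.1 hc).
  have e := coarseNP p_prime zP s m x.
  split=> [[[_ /e]|[]]|/e] //; by left.
have nS : ~ exists O, scls p z O by move/has_coarseP.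
case: H => // -[b0 [h0 g0 u0]].
have [hv fin] := cv.2 nS.
have [b [Ob nb ub]] : exists b, good p z b (ring_of v).
  by apply: good_exists => // s; apply: nS; exists (ring_of v).
(* A parameter b good for the canonical ring is good for the larger ring of b0. So both parameters
   give the same ring, and that of b is inside the canonical ring. *)
have gb : good p z b (xset p z b0 3).
  split=> //; first exact: fin.
  by move=> m; apply: ub; apply: vr_mxS m; apply: fin.
have sub y : xset p z b0 3 y -> ring_of v y.
  by move=> /(u0 b gb)/(xset_sub p_prime zP hv); apply; split.
split=> [[[]|[_ /(_ b0 h0)/sub]]|vx] //.
by right; split=> // b1 h1; apply: fin.
Qed.

Lemma has_coarse_or_finest : p <> 2%N \/ ~ euclidean (residue_field v) -> has_coarse \/ has_finest.
Proof.
move=> ne; have [hc|nc] := pselect has_coarse; [by left|right].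
have nS : ~ exists O, scls p z O by move/has_coarseP.
have [hv fin] := cv.2 nS.
have [b gb] : exists b, good p z b (ring_of v).
  by apply: good_exists => // s; apply: nS; exists (ring_of v).
have ne' : ~ (p = 2%N /\ eucl (residue_field v)).
  by case: ne => ne [] // _ /euclideanP.
have xE b1 : good p z b1 (ring_of v) -> xset p z b1 3 = ring_of v.
  move=> g1; apply/funext => x; apply/propext.
  exact: (finest_xset p_prime zP hv g1 fin ne').
exists b; rewrite (xE b gb); split=> // b1 g1 x; by rewrite (xE b1 g1).
Qed.

End OnField.

(** The predicate is a family over all fields, so that one formula serves all of them. *)
Definition def n (P : forall K : fieldType, n.-tuple K -> Prop) :=
  exists f : ring_formula n, forall (K : fieldType) e, holds f e <-> P K e.

(* Differences of terms, since ring_term has no opposite. *)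
Definition tdef n (t : forall K : fieldType, n.-tuple K -> K) :=
  exists f g : ring_term n, forall (K : fieldType) (e : n.-tuple K), t K e = eval e f - eval e g.

Section Closure.
Variable n : nat.
Implicit Types (P Q : forall K : fieldType, n.-tuple K -> Prop).
Implicit Types (t u : forall K : fieldType, n.-tuple K -> K).

Lemma def_ext P Q : (forall K e, P K e <-> Q K e) -> def P -> def Q.
Proof. by move=> h [f fP]; exists f => K e; rewrite fP. Qed.
Lemma def_eq t u : tdef t -> tdef u -> def (fun K e => t K e = u K e).
Proof.
move=> [t1 [t2 tE]] [u1 [u2 uE]]; exists (fEqual (tAdd t1 u2) (tAdd u1 t2)) => K e /=.
rewrite tE uE; split=> [h|/eqP]; last by rewrite subr_eq addrAC eq_sym subr_eq => /eqP.
by apply/eqP; rewrite subr_eq addrAC eq_sym subr_eq; apply/eqP.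
Qed.
Lemma def_not P : def P -> def (fun K e => ~ P K e).
Proof. by move=> [f fP]; exists (fNot f) => K e /=; rewrite fP. Qed.
Lemma def_and P Q : def P -> def Q -> def (fun K e => P K e /\ Q K e).
Proof. by move=> [f fP] [g gP]; exists (fAnd f g) => K e /=; rewrite fP gP. Qed.
Lemma def_or P Q : def P -> def Q -> def (fun K e => P K e \/ Q K e).
Proof. by move=> [f fP] [g gP]; exists (fOr f g) => K e /=; rewrite fP gP. Qed.
Lemma def_imp P Q : def P -> def Q -> def (fun K e => P K e -> Q K e).
Proof. by move=> [f fP] [g gP]; exists (fImplies f g) => K e /=; rewrite fP gP. Qed.
Lemma def_iff P Q : def P -> def Q -> def (fun K e => P K e <-> Q K e).
Proof. by move=> hP hQ; apply: def_and; apply: def_imp. Qed.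

Definition tl (K : fieldType) (e : n.+1.-tuple K) : n.-tuple K := [tuple of behead e].
Definition hd (K : fieldType) (e : n.+1.-tuple K) : K := thead e.

Lemma tl_cons (K : fieldType) (x : K) (e : n.-tuple K) : tl [tuple of x :: e] = e.
Proof. exact: val_inj. Qed.
Lemma hd_cons (K : fieldType) (x : K) (e : n.-tuple K) : hd [tuple of x :: e] = x.
Proof. by []. Qed.

Lemma def_ex (Q : forall K : fieldType, K -> n.-tuple K -> Prop) :
  def (fun K e => Q K (hd e) (tl e)) -> def (fun K e => exists x, Q K x e).
Proof.
move=> [f fP]; exists (fExists f) => K e /=.
by split=> -[x h]; exists x; have := fP K [tuple of x :: e]; rewrite tl_cons hd_cons => [[h1 h2]]; auto.
Qed.
Lemma def_all (Q : forall K : fieldType, K -> n.-tuple K -> Prop) :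
  def (fun K e => Q K (hd e) (tl e)) -> def (fun K e => forall x, Q K x e).
Proof.
move=> [f fP]; exists (fForall f) => K e /=.
by split=> h x; have := fP K [tuple of x :: e]; rewrite tl_cons hd_cons => [[h1 h2]]; auto.
Qed.

Lemma tdef0 : tdef (fun (K : fieldType) (e : n.-tuple K) => 0).
Proof. by exists (tZero n), (tZero n) => K e /=; rewrite subrr. Qed.
Lemma tdef1 : tdef (fun (K : fieldType) (e : n.-tuple K) => 1).
Proof. by exists (tOne n), (tZero n) => K e /=; rewrite subr0. Qed.
Lemma tdefD t u : tdef t -> tdef u -> tdef (fun K e => t K e + u K e).
Proof.
move=> [t1 [t2 tE]] [u1 [u2 uE]]; exists (tAdd t1 u1), (tAdd t2 u2) => K e /=.
by rewrite tE uE; ring.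
Qed.
Lemma tdefN t : tdef t -> tdef (fun K e => - t K e).
Proof. by move=> [t1 [t2 tE]]; exists t2, t1 => K e /=; rewrite tE; ring. Qed.
Lemma tdefM t u : tdef t -> tdef u -> tdef (fun K e => t K e * u K e).
Proof.
move=> [t1 [t2 tE]] [u1 [u2 uE]].
exists (tAdd (tMul t1 u1) (tMul t2 u2)), (tAdd (tMul t1 u2) (tMul t2 u1)) => K e /=.
by rewrite tE uE; ring.
Qed.
Lemma tdef_ext t u : (forall K e, t K e = u K e) -> tdef t -> tdef u.
Proof. by move=> h [f [g E]]; exists f, g => K e; rewrite -h. Qed.
Lemma tdefX t k : tdef t -> tdef (fun K e => t K e ^+ k).
Proof.
move=> ht; elim: k => [|k IH]; first by apply: tdef_ext tdef1 => K e; rewrite expr0.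
by apply: (tdef_ext (t := fun K e => t K e * t K e ^+ k)) (tdefM ht IH) => K e; rewrite exprS.
Qed.
Lemma tdef_qnat t k : tdef t -> tdef (fun K e => qnat (t K e) k).
Proof.
move=> ht; elim: k => [|k IH]; first by apply: tdef_ext tdef0 => K e; rewrite qnat0.
apply: (tdef_ext (t := fun K e => qnat (t K e) k + t K e ^+ k)) (tdefD IH (tdefX k ht)) => K e.
by rewrite /qnat big_ord_recr.
Qed.
Lemma tdef_kas t u : tdef t -> tdef u -> tdef (fun K e => kas p (t K e) (u K e)).
Proof.
move=> ht hu; suff h k : tdef (fun K e => \prod_(i < k) (u K e - qnat (t K e) i)) by apply: h.
elim: k => [|k IH]; first by apply: tdef_ext tdef1 => K e; rewrite big_ord0.
apply: (tdef_ext (t := fun K e => (\prod_(i < k) (u K e - qnat (t K e) i)) * (u K e - qnat (t K e) k))).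
  by move=> K e; rewrite big_ord_recr.
by apply: tdefM => //; apply: tdefD => //; apply: tdefN; apply: tdef_qnat.
Qed.
Lemma def_neq t u : tdef t -> tdef u -> def (fun K e => t K e != u K e).
Proof.
move=> ht hu; apply: def_ext (def_not (def_eq ht hu)) => K e; split=> [h|/eqP//].
exact/eqP.
Qed.

Lemma tdef_hd : tdef (fun K (e : n.+1.-tuple K) => hd e).
Proof. by exists (tVar ord0), (tZero _) => K e /=; rewrite subr0. Qed.

Fixpoint tshift (t : ring_term n) : ring_term n.+1 :=
  match t with
  | tVar i => tVar (lift ord0 i)
  | tZero => tZero _
  | tOne => tOne _
  | tAdd t u => tAdd (tshift t) (tshift u)
  | tMul t u => tMul (tshift t) (tshift u)
  end.

Lemma eval_tshift (K : fieldType) (e : n.+1.-tuple K) (t : ring_term n) : eval e (tshift t) = eval (tl e) t.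
Proof.
elim: t => //= [i|t -> u -> //|t -> u -> //].
by rewrite [e]tuple_eta tl_cons !(tnth_nth 0).
Qed.

Lemma tdef_tl t : tdef t -> tdef (fun K (e : n.+1.-tuple K) => t K (tl e)).
Proof. by move=> [f [g E]]; exists (tshift f), (tshift g) => K e; rewrite !eval_tshift. Qed.

End Closure.

Lemma tdef_tl2 n (t : forall K : fieldType, n.-tuple K -> K) :
  tdef t -> tdef (fun K e => t K (tl (tl e))).
Proof. by move=> /tdef_tl/tdef_tl. Qed.
Lemma tdef_tl3 n (t : forall K : fieldType, n.-tuple K -> K) :
  tdef t -> tdef (fun K e => t K (tl (tl (tl e)))).
Proof. by move=> /tdef_tl/tdef_tl/tdef_tl. Qed.
Lemma tdef_tl4 n (t : forall K : fieldType, n.-tuple K -> K) :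
  tdef t -> tdef (fun K e => t K (tl (tl (tl (tl e))))).
Proof. by move=> /tdef_tl/tdef_tl/tdef_tl/tdef_tl. Qed.
Lemma tdef_hd2 n : tdef (fun (K : fieldType) (e : n.+2.-tuple K) => hd (tl e)).
Proof. exact: tdef_tl (tdef_hd n). Qed.
Lemma tdef_hd3 n : tdef (fun (K : fieldType) (e : n.+3.-tuple K) => hd (tl (tl e))).
Proof. exact: tdef_tl2 (tdef_hd n). Qed.
Lemma tdef_hd4 n : tdef (fun (K : fieldType) (e : n.+4.-tuple K) => hd (tl (tl (tl e)))).
Proof. exact: tdef_tl3 (tdef_hd n). Qed.

Ltac tdt := repeat first
  [ assumption | apply: tdef0 | apply: tdef1 | apply: tdef_hd4 | apply: tdef_hd3 | apply: tdef_hd2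
  | apply: tdef_hd | apply: tdef_kas | apply: tdef_qnat | apply: tdefX | apply: tdefN | apply: tdefD
  | apply: tdefM | apply: tdef_tl4 | apply: tdef_tl3 | apply: tdef_tl2 | apply: tdef_tl ].

Section Predicates.
Variable n : nat.
Implicit Types (z b a x : forall K : fieldType, n.-tuple K -> K).

Lemma def_inS z a : tdef z -> tdef a -> def (fun K e => inS p (z K e) (a K e)).
Proof.
move=> hz ha; apply: (def_ex (Q := fun K y e => kas p (z K e) y = a K e)).
by apply: def_eq; tdt.
Qed.

Lemma def_inSx z a : tdef z -> tdef a -> def (fun K e => inSx p (z K e) (a K e)).
Proof. by move=> hz ha; apply: def_and; [apply: def_inS|apply: def_neq; tdt]. Qed.

Lemma def_hS z b x : tdef z -> tdef b -> tdef x -> def (fun K e => hS p (z K e) (b K e) (x K e)).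
Proof.
move=> hz hb hx; apply: (def_ex (Q := fun K y e =>
  kas p (z K e) y * (b K e ^+ 2 + x K e ^+ 4) = b K e * x K e ^+ 4)).
by apply: def_eq; tdt.
Qed.

End Predicates.

Section Predicates2.
Variable n : nat.
Implicit Types (z b a x : forall K : fieldType, n.-tuple K -> K).

Lemma def_coarseN z x : tdef z -> tdef x -> def (fun K e => coarseN p (z K e) (x K e)).
Proof.
move=> hz hx; apply: (def_all (Q := fun K (b : K) e => ~ inS p (z K e) b -> forall c,
  tmul ((z K e - 1) ^+ p) b c = 0 -> hS p (z K e) b (x K e) \/ hS p (z K e) c (x K e))).
apply: def_imp; first by apply: def_not; apply: def_inS; tdt.
apply: (def_all (Q := fun K c e => tmul ((z K (tl e) - 1) ^+ p) (hd e) c = 0 ->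
  hS p (z K (tl e)) (hd e) (x K (tl e)) \/ hS p (z K (tl e)) c (x K (tl e)))).
apply: def_imp; first by rewrite /tmul; apply: def_eq; tdt.
by apply: def_or; apply: def_hS; tdt.
Qed.

Lemma def_dset z b x : tdef z -> tdef b -> tdef x ->
  def (fun K e => dset p (z K e) (b K e) (x K e)).
Proof.
move=> hz hb hx; apply: (def_ext (P := fun K e => inSx p (z K e) (x K e) /\ 1 + x K e != 0 /\
  exists w, w * (1 + x K e) = b K e * x K e /\ inSx p (z K e) w)).
  by move=> K e; split=> [[h1 [h2 h3]]|[h1 h2 h3]].
apply: def_and; first exact: def_inSx.
apply: def_and; first by apply: def_neq; tdt.
apply: (def_ex (Q := fun K w e => w * (1 + x K e) = b K e * x K e /\ inSx p (z K e) w)).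
by apply: def_and; [apply: def_eq; tdt|apply: def_inSx; tdt].
Qed.

End Predicates2.

Section Predicates3.
Variable n : nat.
Implicit Types (z b a x : forall K : fieldType, n.-tuple K -> K).

Lemma def_xbase z b x : tdef z -> tdef b -> tdef x ->
  def (fun K e => xbase p (z K e) (b K e) (x K e)).
Proof.
move=> hz hb hx; apply: def_or; first exact: def_dset.
apply: def_or; last by apply: def_or; apply: def_eq; tdt.
apply: (def_ex (Q := fun K y e => x K e * y = 1 /\ ~ dset p (z K e) (b K e) y)).
by apply: def_and; [apply: def_eq; tdt|apply: def_not; apply: def_dset; tdt].
Qed.

End Predicates3.

(** A common form for [coarseN] and [xset], so that ring conditions are translated once. Allowing
    arbitrary terms in [fdef] takes the place of substitution in formulas. *)
Definition fam := forall K : fieldType, K -> K -> K -> Prop.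
Definition fdef (X : fam) := forall n (z b x : forall K : fieldType, n.-tuple K -> K),
  tdef z -> tdef b -> tdef x -> def (fun K e => X K (z K e) (b K e) (x K e)).

Lemma fdef_coarseN : fdef (fun K z _ x => coarseN p z x).
Proof. by move=> n z b x hz _ hx; apply: def_coarseN. Qed.

Lemma fdef_xset k : fdef (fun K z b x => xset p z b k x).
Proof.
elim: k => [|k IH] n z b x hz hb hx; first exact: def_xbase.
apply: (def_ex (Q := fun K x1 e => exists x2 x3 x4,
  (xset p (z K e) (b K e) k x1 /\ xset p (z K e) (b K e) k x2) /\
  (xset p (z K e) (b K e) k x3 /\ xset p (z K e) (b K e) k x4) /\ x K e = x1 * x2 + x3 * x4)).
apply: (def_ex (Q := fun K x2 e => exists x3 x4,
  (xset p (z K (tl e)) (b K (tl e)) k (hd e) /\ xset p (z K (tl e)) (b K (tl e)) k x2) /\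
  (xset p (z K (tl e)) (b K (tl e)) k x3 /\ xset p (z K (tl e)) (b K (tl e)) k x4) /\
  x K (tl e) = hd e * x2 + x3 * x4)).
apply: (def_ex (Q := fun K x3 e => exists x4,
  (xset p (z K (tl (tl e))) (b K (tl (tl e))) k (hd (tl e)) /\
   xset p (z K (tl (tl e))) (b K (tl (tl e))) k (hd e)) /\
  (xset p (z K (tl (tl e))) (b K (tl (tl e))) k x3 /\
   xset p (z K (tl (tl e))) (b K (tl (tl e))) k x4) /\
  x K (tl (tl e)) = hd (tl e) * hd e + x3 * x4)).
apply: (def_ex (Q := fun K x4 e =>
  (xset p (z K (tl (tl (tl e)))) (b K (tl (tl (tl e)))) k (hd (tl (tl e))) /\
   xset p (z K (tl (tl (tl e)))) (b K (tl (tl (tl e)))) k (hd (tl e))) /\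
  (xset p (z K (tl (tl (tl e)))) (b K (tl (tl (tl e)))) k (hd e) /\
   xset p (z K (tl (tl (tl e)))) (b K (tl (tl (tl e)))) k x4) /\
  x K (tl (tl (tl e))) = hd (tl (tl e)) * hd (tl e) + hd e * x4)).
do !apply: def_and; try (apply: def_eq; tdt); apply: (IH _ _ _ _ _ _ _); tdt.
Qed.

Section Rings.
Variables (X : fam) (dX : fdef X) (n : nat).
Unset Implicit Arguments.
Variables (z b : forall K : fieldType, n.-tuple K -> K) (hz : tdef z) (hb : tdef b).
Set Implicit Arguments.
Local Notation O := (fun K e => X (z K e) (b K e)).

(** The inverse is the y with x y = 1, or 0 for x = 0. *)
Lemma def_inv x : tdef x -> def (fun K e => X (z K e) (b K e) (x K e)^-1).
Proof.
move=> hx; apply: (def_ext (P := fun K e => exists y,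
  (x K e * y = 1 \/ x K e = 0 /\ y = 0) /\ X (z K e) (b K e) y)).
  move=> K e; split=> [[y [[h|[h1 h2]] Xy]]|h].
  - have x0 : x K e != 0 by apply: contra_eq_neq h => ->; rewrite mul0r eq_sym oner_neq0.
    by suff -> : (x K e)^-1 = y by []; apply: (mulfI x0); rewrite h divff.
  - by rewrite h1 invr0 -h2.
  - exists (x K e)^-1; split=> //; have [->|x0] := eqVneq (x K e) 0.
      by right; rewrite invr0.
    by left; rewrite divff.
apply: (def_ex (Q := fun K y e => (x K e * y = 1 \/ x K e = 0 /\ y = 0) /\ X (z K e) (b K e) y)).
apply: def_and; last by apply: dX; tdt.
by apply: def_or; [|apply: def_and]; apply: def_eq; tdt.
Qed.

Lemma def_mxi x : tdef x -> def (fun K e => mxi (X (z K e) (b K e)) (x K e)).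
Proof. by move=> hx; apply: def_or; [apply: def_eq; tdt|apply: def_not; apply: def_inv]. Qed.

End Rings.

Section Rings2.
Variables (X : fam) (dX : fdef X) (n : nat).
Unset Implicit Arguments.
Variables (z b : forall K : fieldType, n.-tuple K -> K) (hz : tdef z) (hb : tdef b).
Set Implicit Arguments.

Lemma def_valring : def (fun K e => valring (X (z K e) (b K e))).
Proof.
apply: (def_ext (P := fun K e => X (z K e) (b K e) 1 /\
  (forall x y, X (z K e) (b K e) x -> X (z K e) (b K e) y -> X (z K e) (b K e) (x - y)) /\
  (forall x y, X (z K e) (b K e) x -> X (z K e) (b K e) y -> X (z K e) (b K e) (x * y)) /\
  (forall x, X (z K e) (b K e) x \/ X (z K e) (b K e) x^-1))).
  by move=> K e; split=> [[h1 [h2 [h3 h4]]]|[h1 h2 h3 h4]].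
apply: def_and; first by apply: dX; tdt.
apply: def_and.
  apply: (def_all (Q := fun K x e => forall y, X (z K e) (b K e) x -> X (z K e) (b K e) y -> X (z K e) (b K e) (x - y))).
  apply: (def_all (Q := fun K y e => X (z K (tl e)) (b K (tl e)) (hd e) -> X (z K (tl e)) (b K (tl e)) y -> X (z K (tl e)) (b K (tl e)) (hd e - y))).
  by do 2!(apply: def_imp; first by apply: dX; tdt); apply: dX; tdt.
apply: def_and.
  apply: (def_all (Q := fun K x e => forall y, X (z K e) (b K e) x -> X (z K e) (b K e) y -> X (z K e) (b K e) (x * y))).
  apply: (def_all (Q := fun K y e => X (z K (tl e)) (b K (tl e)) (hd e) -> X (z K (tl e)) (b K (tl e)) y -> X (z K (tl e)) (b K (tl e)) (hd e * y))).
  by do 2!(apply: def_imp; first by apply: dX; tdt); apply: dX; tdt.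
apply: (def_all (Q := fun K x e => X (z K e) (b K e) x \/ X (z K e) (b K e) x^-1)).
by apply: def_or; [apply: dX; tdt|apply: (def_inv dX); tdt].
Qed.

Lemma def_phens : def (fun K e => phens p (z K e) (X (z K e) (b K e))).
Proof.
apply: def_and; first exact: def_valring.
apply: (def_all (Q := fun K x e => mxi (X (z K e) (b K e)) x -> inS p (z K e) x)).
by apply: def_imp; [apply: (def_mxi dX); tdt|apply: def_inS; tdt].
Qed.

Lemma def_scls : def (fun K e => scls p (z K e) (X (z K e) (b K e))).
Proof.
apply: def_and; first exact: def_phens.
apply: (def_all (Q := fun K x e => X (z K e) (b K e) x ->
  ~ mxi (X (z K e) (b K e)) (1 + (z K e - 1) ^+ p * x) -> inS p (z K e) x)).
apply: def_imp; first by apply: dX; tdt.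
by apply: def_imp; [apply: def_not; apply: (def_mxi dX); tdt|apply: def_inS; tdt].
Qed.

Lemma def_good c : tdef c -> def (fun K e => good p (z K e) (c K e) (X (z K e) (b K e))).
Proof.
move=> hc; apply: (def_ext (P := fun K e => X (z K e) (b K e) (c K e) /\ ~ inS p (z K e) (c K e) /\
  ~ mxi (X (z K e) (b K e)) (1 + (z K e - 1) ^+ p * c K e))).
  by move=> K e; split=> [[h1 [h2 h3]]|[h1 h2 h3]].
apply: def_and; first exact: dX.
by apply: def_and; apply: def_not; [apply: def_inS|apply: (def_mxi dX); tdt].
Qed.

End Rings2.

Section Final.
Variable n : nat.
Unset Implicit Arguments.
Variables (z : forall K : fieldType, n.-tuple K -> K) (hz : tdef z).
Set Implicit Arguments.

Lemma def_has_coarse : def (fun K e => has_coarse (z K e)).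
Proof. exact: (def_scls fdef_coarseN hz (tdef0 n)). Qed.

Lemma def_has_finest : def (fun K e => has_finest (z K e)).
Proof.
apply: (def_ex (Q := fun K b0 e => [/\ phens p (z K e) (xset p (z K e) b0 3),
  good p (z K e) b0 (xset p (z K e) b0 3) &
  forall b, good p (z K e) b (xset p (z K e) b0 3) ->
    forall x, xset p (z K e) b 3 x <-> xset p (z K e) b0 3 x])).
apply: (def_ext (P := fun K e => phens p (z K (tl e)) (xset p (z K (tl e)) (hd e) 3) /\
  good p (z K (tl e)) (hd e) (xset p (z K (tl e)) (hd e) 3) /\
  forall b, good p (z K (tl e)) b (xset p (z K (tl e)) (hd e) 3) ->
    forall x, xset p (z K (tl e)) b 3 x <-> xset p (z K (tl e)) (hd e) 3 x)).
  by move=> K e; split=> [[h1 [h2 h3]]|[h1 h2 h3]].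
apply: def_and; first by apply: (def_phens (fdef_xset 3)); tdt.
apply: def_and; first by apply: (def_good (fdef_xset 3)); tdt.
apply: (def_all (Q := fun K b e => good p (z K (tl e)) b (xset p (z K (tl e)) (hd e) 3) ->
    forall x, xset p (z K (tl e)) b 3 x <-> xset p (z K (tl e)) (hd e) 3 x)).
apply: def_imp; first by apply: (def_good (fdef_xset 3)); tdt.
apply: (def_all (Q := fun K x e => xset p (z K (tl (tl e))) (hd e) 3 x <->
  xset p (z K (tl (tl e))) (hd (tl e)) 3 x)).
by apply: def_iff; apply: (fdef_xset 3); tdt.
Qed.

Lemma def_canonical_pred x : tdef x -> def (fun K e => canonical_pred (z K e) (x K e)).
Proof.
move=> hx; apply: def_or; apply: def_and.
- exact: def_has_coarse.
- exact: def_coarseN.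
- exact/def_not/def_has_coarse.
apply: (def_all (Q := fun K b e => phens p (z K e) (xset p (z K e) b 3) -> xset p (z K e) b 3 (x K e))).
by apply: def_imp; [apply: (def_phens (fdef_xset 3))|apply: (fdef_xset 3)]; tdt.
Qed.

End Final.

Lemma formula_exists : exists phi : ring_formula 1, forall (K : fieldType) (x : K),
  holds phi [tuple x] <-> exists z, qnat z p = 0 /\ canonical_pred z x.
Proof.
have [f fP] : def (fun K (e : 1.-tuple K) => exists z, qnat z p = 0 /\ canonical_pred z (hd e)).
  apply: (def_ex (Q := fun K z e => qnat z p = 0 /\ canonical_pred z (hd e))).
  by apply: def_and; [apply: def_eq; tdt|apply: def_canonical_pred; tdt].
by exists f => K x; rewrite fP.
Qed.

(** The sentence that carries the hypotheses of [canonical_predP] from K to all elementarily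
    equivalent fields. *)
Lemma transfer_sentence : exists s : ring_formula 0, forall K : fieldType,
  holds s ([tuple] : 0.-tuple K) <-> (exists z : K, qnat z p = 0) /\
    forall z : K, qnat z p = 0 -> has_coarse z \/ has_finest z.
Proof.
have [f fP] : def (fun K (e : 0.-tuple K) => (exists z : K, qnat z p = 0) /\
    forall z : K, qnat z p = 0 -> has_coarse z \/ has_finest z).
  apply: def_and.
    by apply: (def_ex (Q := fun K z e => qnat z p = 0)); apply: def_eq; tdt.
  apply: (def_all (Q := fun K z e => qnat z p = 0 -> has_coarse z \/ has_finest z)).
  apply: def_imp; first by apply: def_eq; tdt.
  by apply: def_or; [apply: def_has_coarse|apply: def_has_finest]; tdt.
by exists f => K; rewrite fP.
Qed.

End DefiningFormula.

(** * Euclidean residue fields *)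

Section EuclideanOrder.
Variables (R : fieldType) (eR : eucl R).

Definition nneg (x : R) := exists y, x = y ^+ 2.

Lemma nnegD x y : nneg x -> nneg y -> nneg (x + y).
Proof. by move=> [a ->] [b ->]; apply: euclD. Qed.
Lemma nnegM x y : nneg x -> nneg y -> nneg (x * y).
Proof. by move=> [a ->] [b ->]; exists (a * b); rewrite exprMn. Qed.
Lemma nneg0 : nneg 0. Proof. by exists 0; rewrite expr0n. Qed.
Lemma nneg1 : nneg 1. Proof. by exists 1; rewrite expr1n. Qed.
Lemma nneg_nat n : nneg n%:R.
Proof. by elim: n => [|n IH]; [apply: nneg0|rewrite -natr1; apply: nnegD => //; apply: nneg1]. Qed.
Lemma nneg_total x : nneg x \/ nneg (- x).
Proof. by have [y [->|->]] := euclT eR x; [left|right; rewrite opprK]; exists y. Qed.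
Lemma nnegN1 : ~ nneg (-1). Proof. by move=> [y /esym/(euclN1 eR)]. Qed.
Lemma nnegV x : nneg x -> nneg x^-1.
Proof. by move=> [y ->]; exists y^-1; rewrite exprVn. Qed.
Lemma nneg_sub x y : nneg (x - y) \/ nneg (y - x).
Proof. by have := nneg_total (x - y); rewrite opprB. Qed.

Let n2 : 2%:R != 0 :> R := eucl2 eR.

Definition vfin x := exists N : nat, nneg (N%:R - x) /\ nneg (N%:R + x).

Lemma vfin_valring : valring vfin.
Proof.
split.
- by exists 1%N; rewrite subrr; split; [apply: nneg0|apply: nnegD; apply: nneg1].
- move=> x y [N [a b]] [M [c d]]; exists (N + M)%N; rewrite natrD; split.
    by have := nnegD a d; congr nneg; ring.
  by have := nnegD b c; congr nneg; ring.
- move=> x y [N [a b]] [M [c d]]; exists (N * M)%N; rewrite natrM.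
  have h := nnegV (nneg_nat 2); split.
    by have := nnegM (nnegD (nnegM a d) (nnegM b c)) h; congr nneg; field.
  by have := nnegM (nnegD (nnegM b d) (nnegM a c)) h; congr nneg; field.
- have pos x : nneg (x - 1) -> vfin x^-1.
    move=> h; have hx : nneg x by rewrite -(subrK 1 x); apply: nnegD => //; apply: nneg1.
    exists 1%N; split; last by apply: nnegD; [apply: nneg1|apply: nnegV].
    have [x0|x0] := eqVneq x 0; first by case: nnegN1; move: h; rewrite x0 sub0r.
    by have := nnegM h (nnegV hx); congr nneg; field.
  move=> x; have [h1|/pos] := nneg_sub 1 x; last by right.
  have [h2|h] := nneg_total (1 + x); first by left; exists 1%N.
  right; have [N [a b]] : vfin (- x)^-1.
    by apply: pos; have := h; congr nneg; ring.
  by exists N; move: a b; rewrite invrN opprK; split.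
Qed.

(** For infinitesimal x, 1 + 4 x is positive, hence a square c^2, and (1 + c) / 2 is a root of y^2 -
    y = x. *)
Lemma vfin_phens : phens 2 (-1) vfin.
Proof.
split=> [|x]; first exact: vfin_valring.
have [->|x0] := eqVneq x 0; first by move=> _; apply: inS0.
case=> [/eqP|nV]; first by rewrite (negPf x0).
have n4 : 4%:R != 0 :> R by rewrite -[4%N]/(2 * 2)%N natrM mulf_neq0.
have [c cE] : nneg (1 + 4%:R * x).
  have [//|h] := nneg_total (1 + 4%:R * x); case: nV; exists 4%N.
  have mx : nneg (- x).
    have := nnegM (nnegD h nneg1) (nnegV (nneg_nat 4)); congr nneg; field.
    by [].
  have mV := nnegV mx; split.
    by have := nnegD (nneg_nat 4) mV; congr nneg; rewrite invrN.
  by have := nnegM h mV; congr nneg; field; rewrite oppr_eq0 x0.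
exists ((1 + c) / 2%:R); rewrite kas_N1_2.
have -> : x = (c ^+ 2 - 1) / 4%:R.
  by rewrite -cE; field.
by field; rewrite ?n4 ?n2.
Qed.

Lemma vfin_infinite w : (forall N : nat, nneg (w - N%:R)) -> ~ vfin w.
Proof.
move=> hw [N [a _]]; apply: nnegN1; have := nnegD a (hw N.+1).
by congr nneg; rewrite -natr1; ring.
Qed.

(** A root of y^2 - y = -1/2 would give (2 y - 1)^2 = -1. *)
Lemma eucl_notS : ~ forall a : R, inS 2 (-1) a.
Proof.
move=> /(_ (- 2%:R^-1))[y]; rewrite kas_N1_2 => e.
apply: (euclN1 eR (x := 2%:R * y - 1)).
have -> : (2%:R * y - 1) ^+ 2 = 4%:R * (y ^+ 2 - y) + 1 by ring.
by rewrite e; field.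
Qed.

End EuclideanOrder.

Local Open Scope classical_set_scope.

(** * Ultrapowers and the theorem of Los *)

Section Ultrapower.
Variables (K : fieldType) (U : set_system nat) (uU : UltraFilter U).

Definition ultra_seq := @prod_ring nat (fun _ => K) 0%N.
HB.instance Definition _ := GRing.ComNzRing.on ultra_seq.

Definition ultra_ideal : {pred ultra_seq} := fun a => `[< U [set k | a k = 0] >].

Lemma ultra_idealP (a : ultra_seq) : reflect (U [set k | a k = 0]) (a \in ultra_ideal).
Proof. exact: asboolP. Qed.

Lemma ultra_true : U setT. Proof. exact: filterT. Qed.
Lemma ultra_sub (A B : set nat) : A `<=` B -> U A -> U B. Proof. exact: filterS. Qed.
Lemma ultra_and (A B : set nat) : U A -> U B -> U (A `&` B). Proof. exact: filterI. Qed.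
Lemma ultra_not (A : set nat) : U A -> ~ U (~` A).
Proof.
by move=> a b; have := ultra_and a b; rewrite setICr; apply: filter_not_empty.
Qed.
Lemma ultra_compl (A : set nat) : ~ U A -> U (~` A).
Proof. by move=> n; case: (in_ultra_setVsetC A uU). Qed.

Lemma ultra_or (A B : set nat) : U [set k | A k \/ B k] -> U A \/ U B.
Proof.
move=> h; apply: contrapT => /not_orP[/ultra_compl h1 /ultra_compl h2].
apply: (ultra_not h); apply: ultra_sub (ultra_and h1 h2) => k [h3 h4] /= [].
  exact: h3.
exact: h4.
Qed.

Lemma ultra_ex (A : set nat) : U A -> exists k, A k.
Proof. by move=> h; apply: contrapT => n; apply: (ultra_not h); apply: ultra_sub ultra_true => k _ Ak; apply: n; exists k. Qed.

Fact ultra_ideal_closed : idealr_closed ultra_ideal.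
Proof.
split.
- by apply/ultra_idealP; apply: ultra_sub ultra_true.
- apply/ultra_idealP => h; apply: (ultra_not h); apply: ultra_sub ultra_true => k _ /=.
  exact/eqP/oner_neq0.
- move=> a x y /ultra_idealP hx /ultra_idealP hy; apply/ultra_idealP.
  apply: ultra_sub (ultra_and hx hy) => k [/= xk yk].
  by rewrite -[LHS]/(a k * x k + y k) xk yk mulr0 addr0.
Qed.

HB.instance Definition _ := isIdealr.Build ultra_seq ultra_ideal ultra_ideal_closed.

Fact ultra_ideal_max (x : ultra_seq) : x \notin ultra_ideal ->
  exists y, y * x - 1 \in ultra_ideal.
Proof.
move=> /ultra_idealP/ultra_compl h; exists (fun k => (x k)^-1); apply/ultra_idealP.
apply: ultra_sub h => k /= /eqP xk.
by rewrite -[LHS]/((x k)^-1 * x k - 1) mulVf // subrr.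
Qed.

Definition ultrapower : fieldType := max_quot ultra_ideal_max.
Definition upi : {rmorphism ultra_seq -> ultrapower} := @max_quot_pi _ _ ultra_ideal_max.

Lemma upi_surj (q : ultrapower) : exists a, upi a = q.
Proof. exact: max_quot_pi_surj. Qed.

Lemma upi_eq (a b : ultra_seq) : upi a = upi b <-> U [set k | a k = b k].
Proof.
have e : (upi a = upi b) <-> (a - b \in ultra_ideal).
  rewrite -(max_quot_pi_eq0 ultra_ideal_max) -[max_quot_pi _ _]/(upi (a - b)) rmorphB subr_eq0.
  by split=> /eqP.
rewrite e; split=> [/ultra_idealP|h].
  by apply: ultra_sub => k /= /eqP; rewrite -[(a - b) k]/(a k - b k) subr_eq0 => /eqP.
apply/ultra_idealP; apply: ultra_sub h => k /= h.
by rewrite -[LHS]/(a k - b k) h subrr.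
Qed.

Lemma upiV (a : ultra_seq) : upi (fun k => (a k)^-1) = (upi a)^-1.
Proof.
have [a0|a0] := eqVneq (upi a) 0.
  rewrite a0 invr0 -(rmorph0 upi); apply/upi_eq.
  move: a0; rewrite -(rmorph0 upi) => /upi_eq; apply: ultra_sub => k /= ->.
  exact: invr0.
apply: (mulfI a0); rewrite divff // -rmorphM -(rmorph1 upi); apply/upi_eq.
have /ultra_compl : ~ U [set k | a k = 0].
  by move=> h; case/eqP: a0; rewrite -(rmorph0 upi); apply/upi_eq.
by apply: ultra_sub => k /= /eqP ak; rewrite -[LHS]/(a k * (a k)^-1) divff.
Qed.

Definition uenv n (a : n.-tuple ultra_seq) : n.-tuple ultrapower := [tuple of map upi a].
Definition unth n (a : n.-tuple ultra_seq) (k : nat) : n.-tuple K :=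
  [tuple of map (fun s : ultra_seq => s k) a].

Lemma ultra_eval n (a : n.-tuple ultra_seq) (t : ring_term n) :
  eval (uenv a) t = upi (fun k => eval (unth a k) t).
Proof.
elim: t => /= [i|||t -> u ->|t -> u ->].
- rewrite tnth_map; apply/upi_eq; apply: ultra_sub ultra_true => k _ /=.
  by rewrite tnth_map.
- by rewrite -(rmorph0 upi).
- by rewrite -(rmorph1 upi).
- by rewrite -rmorphD.
- by rewrite -rmorphM.
Qed.

Lemma uenv_cons n (a : n.-tuple ultra_seq) x : [tuple of upi x :: uenv a] = uenv [tuple of x :: a].
Proof. exact: val_inj. Qed.
Lemma unth_cons n (a : n.-tuple ultra_seq) x k : [tuple of x k :: unth a k] = unth [tuple of x :: a] k.
Proof. exact: val_inj. Qed.

Lemma los n (f : ring_formula n) (a : n.-tuple ultra_seq) :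
  holds f (uenv a) <-> U [set k | holds f (unth a k)].
Proof.
elim: f a => {n} [n t u a|n f IH a|n f IHf g IHg a|n f IHf g IHg a|n f IHf g IHg a|n f IH a|n f IH a] /=.
- by rewrite !ultra_eval upi_eq.
- rewrite IH; split=> [/ultra_compl//|h h']; exact: ultra_not h' h.
- rewrite IHf IHg; split=> [[h1 h2]|h]; first exact: ultra_and.
  by split; apply: ultra_sub h => k [].
- rewrite IHf IHg; split=> [[h|h]|h].
    by apply: ultra_sub h => k h; left.
    by apply: ultra_sub h => k h; right.
  exact: ultra_or.
- rewrite IHf IHg; split=> [h|h h1]; last by apply: ultra_sub (ultra_and h h1) => k [/= h2 h3]; apply: h2.
  have [h1|/ultra_compl h1] := pselect (U [set k | holds f (unth a k)]).
    by apply: ultra_sub (h h1) => k /= h2 _.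
  by apply: ultra_sub h1 => k /= h2 /h2.
- split=> [[q]|h].
    have [x <-] := upi_surj q; rewrite uenv_cons IH; apply: ultra_sub => k /= h.
    by exists (x k); rewrite unth_cons.
  have ex k : exists y, (exists x, holds f [tuple of x :: unth a k]) -> holds f [tuple of y :: unth a k].
    have [[x hx]|n'] := pselect (exists x, holds f [tuple of x :: unth a k]); first by exists x.
    by exists 0 => /n'.
  pose x : ultra_seq := fun k => projT1 (cid (ex k)).
  exists (upi x); rewrite uenv_cons IH; apply: ultra_sub h => k /= h.
  by rewrite -unth_cons; apply: (projT2 (cid (ex k))).
- split=> [h|h q]; last first.
    have [x <-] := upi_surj q; rewrite uenv_cons IH; apply: ultra_sub h => k /= h.
    by rewrite -unth_cons.
  have ex k : exists y, ~ (forall x, holds f [tuple of x :: unth a k]) -> ~ holds f [tuple of y :: unth a k].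
    have [n'|/existsNP[x hx]] := pselect (forall x, holds f [tuple of x :: unth a k]); first by exists 0.
    by exists x.
  pose x : ultra_seq := fun k => projT1 (cid (ex k)).
  have := h (upi x); rewrite uenv_cons IH; apply: ultra_sub => k /=.
  rewrite -unth_cons => hk; apply: contrapT => nk.
  exact: (projT2 (cid (ex k)) nk hk).
Qed.

Lemma ultrapower_equiv : elementarily_equivalent K ultrapower.
Proof.
move=> s; have := los s [tuple]; rewrite (_ : uenv [tuple] = [tuple]); last exact: val_inj.
have -> : [set k | holds s (unth [tuple] k)] = [set k | holds s ([tuple] : 0.-tuple K)].
  apply/funext => k; apply/propext => /=.
  by rewrite (_ : unth [tuple] k = [tuple]) //; apply: val_inj.
move=> ->; split=> [h|h]; first by apply: ultra_sub ultra_true.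
apply: contrapT => n; apply: (ultra_not h); exact: ultra_sub ultra_true.
Qed.

Lemma los1 (f : ring_formula 1) (a : ultra_seq) :
  holds f [tuple upi a] <-> U [set k | holds f [tuple a k]].
Proof.
have := los f [tuple a]; rewrite (_ : uenv [tuple a] = [tuple upi a]); last exact: val_inj.
move=> ->; rewrite (_ : [set k | holds f (unth [tuple a] k)] = [set k | holds f [tuple a k]]) //.
apply/funext => k; apply/propext => /=.
by rewrite (_ : unth [tuple a] k = [tuple a k]) //; apply: val_inj.
Qed.

End Ultrapower.

Arguments ultra_true {U uU}.
Arguments ultra_sub {U uU A B}.
Arguments ultra_and {U uU A B}.
Arguments ultra_not {U uU A}.
Arguments ultra_compl {U uU A}.
Arguments ultra_or {U uU A B}.
Arguments ultra_ex {U uU A}.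

(** The axioms [eucl] of the residue field, pulled back to elements of O and m, in which form they
    pass to the ultrapower. *)
Record eucl_ring (K : fieldType) (O : K -> Prop) : Prop := EuclRing {
  eucl_ring2 : ~ mxi O 2%:R;
  eucl_ringN1 : forall x, O x -> ~ mxi O (x ^+ 2 + 1);
  eucl_ringT : forall x, O x -> exists y, O y /\ (mxi O (x - y ^+ 2) \/ mxi O (x + y ^+ 2));
  eucl_ringD : forall x y, O x -> O y -> exists w, O w /\ mxi O (x ^+ 2 + y ^+ 2 - w ^+ 2)
}.

Lemma eucl_residue (K : fieldType) (v : valuation K) :
  eucl (residue_field v) <-> eucl_ring (ring_of v).
Proof.
set O := ring_of v; have vO : valring O := ring_of_valring v.
have O1 := vr1 vO; have O2 : O 2%:R by apply: vr_nat.
have r2 : res v 2%:R = 2%:R by rewrite -natr1 resD // !res1.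
split=> [[e2 eN eT eD]|[e2 eN eT eD]]; split.
- by move=> /(res_eq0 O2); rewrite r2 => /eqP; apply/negP.
- move=> x Ox m; have Ox2 : O (x ^+ 2) by apply: vrX.
  have Ox3 : O (x ^+ 2 + 1) by apply: vrD.
  apply: (eN (res v x)); apply/eqP; rewrite -addr_eq0 -(res1 v) -resX // -resD //.
  exact/eqP/(res_eq0 Ox3).
- move=> x Ox; have [yb yE] := eT (res v x); have [y Oy yr] := res_surj yb.
  have Oy2 : O (y ^+ 2) by apply: vrX.
  exists y; split=> //; case: yE => h; [left|right].
    by apply/res_eq => //; rewrite resX // yr.
  rewrite -[y ^+ 2]opprK; apply/res_eq; rewrite ?resN ?resX ?yr //; exact: vrN.
- move=> x y Ox Oy; have [wb wE] := eD (res v x) (res v y); have [w Ow wr] := res_surj wb.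
  have [Ox2 Oy2 Ow2] : [/\ O (x ^+ 2), O (y ^+ 2) & O (w ^+ 2)] by split; apply: vrX.
  by exists w; split=> //; apply/res_eq => //; [apply: vrD|rewrite resD // !resX // wr].
- by apply/eqP; rewrite -r2 res_eq0.
- move=> xb; have [x Ox <-] := res_surj xb => h; apply: (eN x) => //.
  have Ox2 : O (x ^+ 2) by apply: vrX.
  by apply/res_eq0; [apply: vrD|rewrite resD // resX // h res1 addrC subrr].
- move=> xb; have [x Ox <-] := res_surj xb; have [y [Oy yE]] := eT x Ox.
  have Oy2 : O (y ^+ 2) by apply: vrX.
  exists (res v y); rewrite -resX //; case: yE => h; [left|right].
    exact/res_eq.
  rewrite -resN //; apply/res_eq => //; first exact: vrN.
  by rewrite opprK.
- move=> xb yb; have [x Ox <-] := res_surj xb; have [y Oy <-] := res_surj yb.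
  have [w [Ow h]] := eD x y Ox Oy.
  have [Ox2 Oy2 Ow2] : [/\ O (x ^+ 2), O (y ^+ 2) & O (w ^+ 2)] by split; apply: vrX.
  exists (res v w); rewrite -!resX // -resD //; apply/res_eq => //; exact: vrD.
Qed.

(** * Undefinability over Euclidean residue fields *)

Section Undefinable.
Variables (K : fieldType) (U : set_system nat) (uU : UltraFilter U) (UN : \oo `<=` U).
Variables (O : K -> Prop) (eO : eucl_ring O) (vO : valring O).
Local Notation L := (ultrapower K uU).
Local Notation upi := (@upi K U uU).
Variables (OL : L -> Prop) (vOL : valring OL).
Hypothesis OLE : forall a, OL (upi a) <-> U [set k | O (a k)].

Let mxE a : mxi OL (upi a) <-> U [set k | mxi O (a k)].
Proof.
rewrite /mxi -upiV OLE -(rmorph0 upi) upi_eq; split=> [[h|h]|/ultra_or].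
- by apply: ultra_sub h => k /= ->; left.
- by apply: ultra_sub (ultra_compl h) => k /= hk; right.
- case=> [h|h]; [left|right] => // h'.
  exact: ultra_not h' h.
Qed.

Let choice (P : nat -> K -> Prop) : U [set k | exists y, P k y] ->
  exists b : ultra_seq K, U [set k | P k (b k)].
Proof.
move=> h; have ex k : exists y, (exists x, P k x) -> P k y.
  by have [[x hx]|n] := pselect (exists x, P k x); [exists x|exists 0 => /n].
exists (fun k => projT1 (cid (ex k))); apply: ultra_sub h => k /= hk.
exact: (projT2 (cid (ex k)) hk).
Qed.

Lemma ultra_eucl_ring : eucl_ring OL.
Proof.
split.
- rewrite -[2%:R](rmorph_nat upi); move=> /mxE/ultra_ex[k]; exact: (eucl_ring2 eO).
- move=> x; have [a <-] := upi_surj x; move=> /OLE Oa.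
  rewrite -rmorphXn -(rmorph1 upi) -rmorphD => /mxE m.
  by have [k [h1 h2]] := ultra_ex (uU := uU) (ultra_and (uU := uU) Oa m); apply: (eucl_ringN1 eO h1 h2).
- move=> x; have [a <-] := upi_surj x; move=> /OLE Oa.
  have /choice[b hb] : U [set k | exists y, O y /\ (mxi O (a k - y ^+ 2) \/ mxi O (a k + y ^+ 2))].
    by apply: ultra_sub Oa => k /= /(eucl_ringT eO).
  exists (upi b); split; first by apply/OLE; apply: ultra_sub hb => k [].
  have /ultra_or[h|h] : U [set k | mxi O (a k - b k ^+ 2) \/ mxi O (a k + b k ^+ 2)].
      by apply: ultra_sub hb => k [].
    by left; rewrite -rmorphXn -rmorphB; apply/mxE.
  by right; rewrite -rmorphXn -rmorphD; apply/mxE.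
- move=> x y; have [a <-] := upi_surj x; have [b <-] := upi_surj y; move=> /OLE Oa /OLE Ob.
  have /choice[c hc] : U [set k | exists w, O w /\ mxi O (a k ^+ 2 + b k ^+ 2 - w ^+ 2)].
    by apply: ultra_sub (ultra_and Oa Ob) => k [/= h1 h2]; apply: (eucl_ringD eO).
  exists (upi c); split; first by apply/OLE; apply: ultra_sub hc => k [].
  rewrite -!rmorphXn -rmorphD -rmorphB; apply/mxE.
  by apply: ultra_sub hc => k [].
Qed.

(** A natural number is a sum of squares, hence a square modulo m. So the class of the sequence 0,
    1, 2, ... exceeds every N by a square, the indices k >= N being almost all. *)
Lemma ultra_infinite : exists2 w, OL w &
  forall N : nat, exists y, OL y /\ mxi OL (w - N%:R - y ^+ 2).
Proof.
have sq n : exists y, O y /\ mxi O (n%:R - y ^+ 2).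
  elim: n => [|n [y [Oy my]]].
    by exists 0; rewrite expr0n subr0; split; [apply: vr0|left].
  have [w [Ow mw]] := eucl_ringD eO (vr1 vO) Oy; exists w; split=> //.
  have -> : n.+1%:R - w ^+ 2 = (n%:R - y ^+ 2) + (1 ^+ 2 + y ^+ 2 - w ^+ 2).
    by rewrite expr1n -natr1 [1 + _]addrC !addrA subrK.
  exact: mxD.
exists (upi (fun k => k%:R)).
  by apply/OLE; apply: ultra_sub ultra_true => k _; apply: vr_nat.
move=> N; have /choice[b hb] : U [set k | exists y, O y /\ mxi O (k%:R - N%:R - y ^+ 2)].
  apply: UN; exists N => // k /= Nk; rewrite -natrB //; exact: sq.
exists (upi b); split; first by apply/OLE; apply: ultra_sub hb => k [].
rewrite -(rmorph_nat upi) -rmorphXn -!rmorphB; apply/mxE.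
apply: ultra_sub hb => k [_ /=]; congr (mxi O _); congr (_ - _ - _).
have h t n : (n%:R : ultra_seq K) t = n%:R.
  by elim: n => // n IH; rewrite -!natr1 -IH.
by rewrite h.
Qed.

End Undefinable.

Lemma euclidean_undefinable (K : fieldType) :
  eucl (residue_field (canonical_valuation 2 K)) -> ~ definable_as_such 2 K.
Proof.
move=> eF [phi phiP]; have p2 : prime 2 by [].
(* If such a ring existed, the canonical ring would be one and S of its residue field everything,
   against [eucl_notS]. So the canonical ring is the finest p-henselian one. *)
have noscls (E : fieldType) (v := canonical_valuation 2 E) : eucl (residue_field v) ->
    ~ exists O : E -> Prop, scls 2 (-1) O.
  move=> e ex; have cv := canonical_pcanon p2 (qnat_N1_2 E).
  have [s _] := cv.1 ex; apply: (eucl_notS e).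
  have := (scls_resP p2 (qnat_N1_2 E) s.1).1 s.
  by rewrite resN ?res1 //; apply: (vr1 (ring_of_valring _)).
have [U [uU UN]] := ultraFilterLemma eventually_filter.
set v := canonical_valuation 2 K in eF.
pose L := ultrapower K uU; pose w := canonical_valuation 2 L.
have eq0 := ultrapower_equiv K uU.
have OLE a : ring_of w (upi K uU a) <-> U [set k | ring_of v (a k)].
  rewrite /ring_of -(phiP _ eq0) los1.
  have -> : [set k | holds phi [tuple a k]] = [set k | a k \in valuation_ring v] => //.
  by apply/funext => k; apply/propext; apply: phiP.
have eO := (eucl_residue v).1 eF.
have vO : valring (ring_of v) := ring_of_valring v.
have vOL : valring (ring_of w) := ring_of_valring w.
have eG : eucl (residue_field w) by apply/eucl_residue; apply: ultra_eucl_ring eO _ OLE.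
have [om Oom omP] := ultra_infinite UN eO vO OLE.
have [hw fin] := (canonical_pcanon p2 (qnat_N1_2 L)).2 (noscls _ eG).
have hV : phens 2 (res w (-1)) (vfin (R := residue_field w)).
  rewrite resN ?res1; [exact: vfin_phens|exact: (vr1 vOL)].
have [_] := fin _ (pullback_phens p2 (qnat_N1_2 L) hw hV) om Oom.
apply: vfin_infinite => // N; have [y [Oy my]] := omP N.
have ON : ring_of w N%:R by apply: vr_nat.
have rN : res w N%:R = N%:R.
  elim: (N) => [|n IH]; first exact: res0.
  by rewrite -!natr1 resD ?res1 ?IH //; [apply: vr_nat|apply: (vr1 vOL)].
exists (res w y); rewrite -rN -resB // -resX //; apply/res_eq => //.
  exact: (vrB vOL).
exact: vrX.
Qed.

Lemma qnat_root_exists (p : nat) (K : fieldType) : prime p ->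
  p \in [pchar K] \/ (exists zeta : K, p.-primitive_root zeta) -> exists z : K, qnat z p = 0.
Proof.
move=> p_prime [chp|[zeta prim]].
  exists 1; rewrite /qnat; under eq_bigr do rewrite expr1n.
  by rewrite sumr_const card_ord; apply: pcharf0.
exists zeta; have z1 : zeta - 1 != 0.
  rewrite subr_eq0; apply/eqP => z1; have := prim_order_gt0 prim.
  have := prim_order_dvd prim 1; rewrite expr1 z1 eqxx dvdn1 => /eqP p1.
  by rewrite p1 in p_prime.
by apply: (mulfI z1); rewrite qnatE mulr0 prim_expr_order // subrr.
Qed.

Lemma canonical_pred_defines (p : nat) (K : fieldType) (phi : ring_formula 1) : prime p ->
  (forall (L : fieldType) (x : L),
    holds phi [tuple x] <-> exists z : L, qnat z p = 0 /\ canonical_pred p z x) ->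
  (exists z : K, qnat z p = 0) ->
  p <> 2%N \/ ~ euclidean (residue_field (canonical_valuation p K)) ->
  defines_as_such p K phi.
Proof.
move=> p_prime phiP ex ne L KL x.
have [s sP] := transfer_sentence p.
have /sP[[z zP] hz] : holds s ([tuple] : 0.-tuple L).
  by apply/KL/sP; split=> // z zP; apply: has_coarse_or_finest.
rewrite phiP; split=> [[y [yP]]|vx].
  by move/(canonical_predP p_prime yP (hz y yP)).
by exists z; split=> //; apply/(canonical_predP p_prime zP (hz z zP)).
Qed.

Theorem mainTheorem1 (p : nat) (p_prime : prime p) :
  exists phi : ring_formula 1,
    forall K : fieldType,
      p \in [pchar K] \/ (exists zeta : K, p.-primitive_root zeta) ->
      (defines_as_such p K phi <-> definable_as_such p K) /\
      (definable_as_such p K <->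
         p <> 2%N \/ ~ euclidean (residue_field (canonical_valuation p K))).
Proof.
have [phi phiP] := formula_exists p; exists phi => K /(qnat_root_exists p_prime) ex.
have h12 : defines_as_such p K phi -> definable_as_such p K by exists phi.
have h31 := canonical_pred_defines (K := K) p_prime phiP ex.
have h23 : definable_as_such p K ->
    p <> 2%N \/ ~ euclidean (residue_field (canonical_valuation p K)).
  have [->|/eqP] := eqVneq p 2%N; last by left.
  by move=> d; right=> /euclideanP/euclidean_undefinable; apply.
by split; split=> // h; [apply/h31/h23|apply/h12/h31].
Qed.
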